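(* Let $\ell_1,\ell_2\ge1$ be integers and set $\ell=\ell_1+\ell_2$. Then the double $\xi$-value $\xi(2\ell_1,2\ell_2)$ is a linear combination of regularised Eichler integrals from $\tau=i$ to infinity: there exists $$P_{\ell_1,\ell_2}(\tau)\ \in\ \mathbb{Q}\,i\tau^{2\ell_2-1}+\sum_{k=0}^{\ell-1}\mathbb{Q}\,\tau^{2k}$$ such that $$\pi^{-\ell_1-\ell_2}\,\xi(2\ell_1,2\ell_2)=\frac1i\int_i^{\overset{\rightarrow}{1}_\infty}P_{\ell_1,\ell_2}(\tau)\,\mathbb{G}_{2\ell}(\tau)\,d\tau .$$
   Context: Eisenstein series: $\mathbb{G}_{2\ell}(\tau)=-\frac{b_{2\ell}}{4\ell}+\sum_{n\ge1}\sigma_{2\ell-1}(n)q^n$, $q=e^{2\pi i\tau}$, where $b_{2\ell}$ is the Bernoulli number and $\sigma_{2\ell-1}(n)=\sum_{d\mid n}d^{2\ell-1}$. Let $\mathbb{G}_{2\ell}^0=\mathbb{G}_{2\ell}+\frac{b_{2\ell}}{4\ell}$. Regularised Eichler integral along the imaginary axis $\tau=iy$ (with respect to the unit tangent vector $\overset{\rightarrow}{1}_\infty$ at $i\infty$): for a polynomial $P$, $$\int_i^{\overset{\rightarrow}{1}_\infty}P(\tau)\mathbb{G}_{2\ell}(\tau)\,d\tau=i\left(\int_1^\infty P(iy)\,\mathbb{G}^0_{2\ell}(iy)\,dy+\frac{b_{2\ell}}{4\ell}\int_0^1P(iy)\,dy\right).$$ Double Riemann $\xi$-function: let $\theta_{\mathbb{Q}}(t)=\sum_{n\in\mathbb{Z}}e^{-\pi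 n^2t^2}$ and $\theta^0_{\mathbb{Q}}(t)=\theta_{\mathbb{Q}}(t)-1$ for $t>0$. For $\mathrm{Re}(s_1),\mathrm{Re}(s_2)>1$, $$\xi(s_1,s_2)=\int_{0\le t_1\le t_2\le\infty}\theta_{\mathbb{Q}}(t_1)t_1^{s_1-1}\theta^0_{\mathbb{Q}}(t_2)t_2^{s_2-1}\,dt_1dt_2-\int_{0\le t_1\le t_2\le\infty}t_1^{s_2-1}\theta_{\mathbb{Q}}^0(t_2)t_2^{s_1-1}\,dt_1dt_2 .$$ *)

(* Defs.v *)
From HB Require Import structures.
From mathcomp Require Import all_boot all_order all_algebra.
From mathcomp Require Import complex.
From mathcomp Require Import all_classical all_reals all_analysis.

Set Implicit Arguments.
Unset Strict Implicit.
Unset Printing Implicit Defensive.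

Import Order.TTheory GRing.Theory Num.Theory.
Import numFieldNormedType.Exports.

Local Open Scope classical_set_scope.
Local Open Scope ring_scope.
Local Open Scope complex_scope.

(* b_0, ..., b_(n-1), computed from the recurrence
   \sum_(k <= n) 'C(n.+1, k) * b_k = (n == 0)  (so that b_1 = - 1 / 2). *)
Fixpoint bernoulli_seq (n : nat) : seq rat :=
  if n is m.+1 then
    let s := bernoulli_seq m in
    rcons s
      (((m == 0)%N%:R - \sum_(k < m) 'C(m.+1, k)%:R * s`_k) / m.+1%:R)
  else [::].

Definition bernoulli_num (n : nat) : rat := (bernoulli_seq n.+1)`_n.

Lemma size_bernoulli_seq n : size (bernoulli_seq n) = n.
Proof. by elim: n => //= n IHn; rewrite size_rcons IHn. Qed.

Lemma nth_bernoulli_seq n k :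
  (k < n)%N -> (bernoulli_seq n)`_k = bernoulli_num k.
Proof.
elim: n => // n IHn; rewrite ltnS leq_eqVlt => /orP[/eqP-> //|kn].
by rewrite /= nth_rcons size_bernoulli_seq kn IHn.
Qed.

Lemma bernoulli_num_rec n :
  \sum_(k < n.+1) 'C(n.+1, k)%:R * bernoulli_num k = (n == 0)%N%:R.
Proof.
rewrite big_ord_recr /= binSn /bernoulli_num /= nth_rcons.
rewrite size_bernoulli_seq ltnn eqxx mulrC divfK ?pnatr_eq0//.
rewrite [X in _ + (_ - X)](eq_bigr (fun k : 'I_n =>
  'C(n.+1, k)%:R * bernoulli_num k)) ?subrKC// => k _.
by rewrite nth_bernoulli_seq.
Qed.

Definition divisor_sigma (k n : nat) : nat := \sum_(d <- divisors n) d ^ k.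

Section Analysis.
Variable R : realType.

Definition cexp (z : R[i]) : R[i] :=
  (expR (complex.Re z))%:C * (cos (complex.Im z) +i* sin (complex.Im z)).

(* t ^ s for t > 0 *)
Definition cpow (t : R) (s : R[i]) : R[i] := cexp (s * (ln t)%:C).

Definition Cintegral d (T : measurableType d) (mu : {measure set T -> \bar R})
    (D : set T) (f : T -> R[i]) : R[i] :=
  (\int[mu]_(x in D) complex.Re (f x)) +i* (\int[mu]_(x in D) complex.Im (f x)).

(* Sum of the u n for n >= 1; R[i]^o carries the topology of the modulus. *)
Definition Cseries (u : nat -> R[i]) : R[i] :=
  limn (fun N : nat => \sum_(1 <= n < N) u n : R[i]^o).

(* l is half the weight. *)
Definition eisenstein (l : nat) (tau : R[i]) : R[i] :=
  let q := cexp (2 * (pi : R)%:C * 'i%C * tau) in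
  - ratr (bernoulli_num (2 * l)) / (4 * l)%:R +
  Cseries (fun n => (divisor_sigma (2 * l - 1) n)%:R * q ^+ n).

Definition eisenstein0 (l : nat) (tau : R[i]) : R[i] :=
  eisenstein l tau + ratr (bernoulli_num (2 * l)) / (4 * l)%:R.

(* \int_i^(vec 1_oo) P(tau) G_(2l)(tau) dtau, along tau = i y *)
Definition reg_eichler (l : nat) (P : {poly R[i]}) : R[i] :=
  'i%C * (Cintegral (@lebesgue_measure R) `[1, +oo[
          (fun y => P.['i%C * y%:C] * eisenstein0 l ('i%C * y%:C))
        + ratr (bernoulli_num (2 * l)) / (4 * l)%:R *
          Cintegral (@lebesgue_measure R) `[0, 1] (fun y => P.['i%C * y%:C])).

(* The sum has nonnegative terms; it is finite when t > 0. *)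
Definition theta (t : R) : R :=
  fine (\esum_(n in [set: int]) (expR (- (pi * n%:~R ^+ 2 * t ^+ 2)))%:E)%E.

Definition theta0 (t : R) : R := theta t - 1.

(* The integrands are undefined on the null set t.1 = 0, which is left out. *)
Definition simplex2 : set (R * R) := [set t | 0 < t.1 /\ t.1 <= t.2].

(* Given by absolutely convergent integrals for Re s1, Re s2 > 1. *)
Definition double_xi (s1 s2 : R[i]) : R[i] :=
  Cintegral (@lebesgue_measure R \x @lebesgue_measure R)%E simplex2
    (fun t => (theta t.1)%:C * cpow t.1 (s1 - 1) *
              ((theta0 t.2)%:C * cpow t.2 (s2 - 1)))
  - Cintegral (@lebesgue_measure R \x @lebesgue_measure R)%E simplex2
    (fun t => cpow t.1 (s2 - 1) * ((theta0 t.2)%:C * cpow t.2 (s1 - 1))).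

End Analysis.

(* Main.v *)
Require Import Defs.
From HB Require Import structures.
From mathcomp Require Import all_boot all_order all_algebra.
From mathcomp Require Import complex.
From mathcomp Require Import all_classical all_reals all_analysis.
From mathcomp Require Import ring lra zify measurable_realfun.

(** Put k = l1 + l2 - 1. Expand both theta functions. A pair of Gaussians with
frequencies b in the first variable and a in the second, integrated over the
simplex by means of t1 = x t2, gives a constant times the rational integral of
x^(2 l1 - 1) / (a^2 + b^2 x^2)^(k+1) over [0, 1]. Hence the double xi value is
k! / (2 pi^(k+1)) times 4 T + zeta(2k+2) (1/l1 - 1/l2), where T is the sum of
those integrals over a, b >= 1 ([double_xi_value]); the zeta terms come from the
constant term of the first theta function and from the subtracted integral.

The main point is an identity between integrals over [0, 1]
([kernel_identity]): the rational integral is, up to a rational factor, the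
integral of a polynomial with rational coefficients, the same for all a and b,
against Re (a + i b x)^(-2k-2). Summed over a and b and carried to [1, +oo[ by
x = 1/y, the kernel becomes the sum of Re (a y + i b)^(-2k-2) over the open
quadrant. Lipschitz's formula ([lipschitz]), obtained here from a Fourier series
evaluated by Cesaro means, sums it over b. Up to constants the result is the
q-expansion of the Eisenstein series at i y without its constant term, minus a
multiple of zeta(2k+2) y^(-2k-2) for the missing axis b = 0.

The polynomial has a nonzero constant term, so that the sum and the integral
cannot be exchanged at once: after inversion the integrand decays only like 1/y.
The remedy is to subtract a multiple of the coboundary 1 - (i x)^(2k). Its
integrals against the kernels of (a, b) and of (b, a) cancel
([coboundary_antisym]), hence it contributes nothing to a sum over a square
a, b <= N, and what remains is dominated by a multiple of y^(-2)
([square_sums_limit]).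

There remain the multiples of zeta(2k+2). By Euler's formula ([euler_zeta]) they
are multiples of the constant term of the Eisenstein series, and they add up to
exactly the integral of the same polynomial over [0, 1] that regularisation
prescribes ([xi_eichler_real]). The polynomial is even apart from one monomial
of degree 2 l2 - 1. Written in tau = i y, its even powers keep rational
coefficients and the odd one acquires the factor i. *)

Set Implicit Arguments.
Unset Strict Implicit.
Unset Printing Implicit Defensive.

Import Order.TTheory GRing.Theory Num.Theory.
Import numFieldNormedType.Exports.

Local Open Scope classical_set_scope.
Local Open Scope ring_scope.
Local Open Scope complex_scope.

Local Notation Re := complex.Re.
Local Notation Im := complex.Im.

(** * Derivatives of complex functions of a real variable *)

Section ComplexCalculus.
Variable R : realType.
Implicit Types (f g : R -> R[i]) (x : R) (u v : R[i]).

Lemma eq_is_derive (h : R -> R) x (d e : R) :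
  is_derive x 1 h d -> d = e -> is_derive x 1 h e.
Proof. by move=> ? <-. Qed.

Lemma rderiveD (h k : R -> R) x (d e : R) : is_derive x 1 h d ->
  is_derive x 1 k e -> is_derive x 1 (fun t => h t + k t) (d + e).
Proof. by move=> hd ke; exact: (is_deriveD hd ke). Qed.

Lemma rderiveN (h : R -> R) x (d : R) : is_derive x 1 h d ->
  is_derive x 1 (fun t => - h t) (- d).
Proof. by move=> hd; exact: (is_deriveN hd). Qed.

Lemma rderiveM (h k : R -> R) x (d e : R) : is_derive x 1 h d ->
  is_derive x 1 k e -> is_derive x 1 (fun t => h t * k t) (d * k x + h x * e).
Proof.
move=> hd ke; apply: eq_is_derive (is_deriveM hd ke) _.
by rewrite /GRing.scale/= addrC mulrC.
Qed.

Lemma rderiveZ (c : R) (h : R -> R) x (d : R) : is_derive x 1 h d ->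
  is_derive x 1 (fun t => c * h t) (c * d).
Proof. by move=> hd; exact: (is_deriveZ c hd). Qed.

Lemma rderive_id x : is_derive x 1 (fun t : R => t) 1.
Proof. exact: is_derive_id. Qed.

Lemma rderive_cst (c : R) x : is_derive x 1 (fun=> c) 0.
Proof. exact: is_derive_cst. Qed.

Lemma rderiveX n x : is_derive x 1 (fun t : R => t ^+ n.+1) (n.+1%:R * x ^+ n).
Proof.
elim: n => [|n IH]; first by apply: eq_is_derive (rderive_id x) _; rewrite expr0 mulr1.
rewrite (_ : (fun t => _) = (fun t => t * t ^+ n.+1)).
  apply: eq_is_derive (rderiveM (rderive_id x) IH) _.
  by rewrite -[in RHS]natr1 exprS; ring.
by apply/funext => t; rewrite exprS.
Qed.

Lemma rderiveV (h : R -> R) x (d : R) : h x != 0 -> is_derive x 1 h d ->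
  is_derive x 1 (fun t => (h t)^-1) (- d / h x ^+ 2).
Proof.
move=> h0 hd; apply: eq_is_derive (is_deriveV h0 hd) _.
by rewrite /GRing.scale/= mulNr mulrC mulNr.
Qed.

Lemma rderive_comp (h k : R -> R) x (d e : R) : is_derive (k x) 1 h d ->
  is_derive x 1 k e -> is_derive x 1 (fun t => h (k t)) (d * e).
Proof. by move=> hd ke; exact: is_derive1_comp. Qed.

Lemma is_derive_continuous (h h' : R -> R) :
  (forall x, is_derive x 1 h (h' x)) -> continuous h.
Proof.
by move=> hd x; apply: differentiable_continuous; apply/derivable1_diffP; exact: ex_derive.
Qed.

(** Componentwise, so that the real calculus applies to both parts. *)
Definition cderive f x v :=
  is_derive x 1 (fun t => Re (f t)) (Re v) /\
  is_derive x 1 (fun t => Im (f t)) (Im v).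

Lemma Re_mulc u v : Re (u * v) = Re u * Re v - Im u * Im v.
Proof. by case: u; case: v. Qed.

Lemma Im_mulc u v : Im (u * v) = Re u * Im v + Im u * Re v.
Proof. by case: u; case: v. Qed.

Lemma Re_addc u v : Re (u + v) = Re u + Re v.
Proof. by case: u; case: v. Qed.

Lemma Im_addc u v : Im (u + v) = Im u + Im v.
Proof. by case: u; case: v. Qed.

Lemma eq_complexP u v : Re u = Re v -> Im u = Im v -> u = v.
Proof. by case: u => a b; case: v => c d /= -> ->. Qed.

Lemma eq_cderive f x u v : cderive f x u -> u = v -> cderive f x v.
Proof. by move=> ? <-. Qed.

Lemma cderive_cst u x : cderive (fun=> u) x 0.
Proof. by split; apply: is_derive_cst. Qed.

Lemma cderive_real (h : R -> R) x d :
  is_derive x 1 h d -> cderive (fun t => (h t)%:C) x d%:C.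
Proof. by move=> hd; split => //=; apply: is_derive_cst. Qed.

Lemma cderiveD f g x u v :
  cderive f x u -> cderive g x v -> cderive (fun t => f t + g t) x (u + v).
Proof.
move=> [f1 f2] [g1 g2]; split.
  rewrite (_ : (fun t => _) = (fun t => Re (f t) + Re (g t))).
    by rewrite Re_addc; exact: rderiveD.
  by apply/funext => t /=; rewrite Re_addc.
rewrite (_ : (fun t => _) = (fun t => Im (f t) + Im (g t))).
  by rewrite Im_addc; exact: rderiveD.
by apply/funext => t /=; rewrite Im_addc.
Qed.

Lemma cderiveM f g x u v : cderive f x u -> cderive g x v ->
  cderive (fun t => f t * g t) x (u * g x + f x * v).
Proof.
move=> [f1 f2] [g1 g2]; split.
  rewrite (_ : (fun t => _) =
      (fun t => Re (f t) * Re (g t) + - (Im (f t) * Im (g t)))).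
    apply: eq_is_derive (rderiveD (rderiveM f1 g1) (rderiveN (rderiveM f2 g2))) _.
    by rewrite Re_addc !Re_mulc; ring.
  by apply/funext => t; rewrite Re_mulc.
rewrite (_ : (fun t => _) =
    (fun t => Re (f t) * Im (g t) + Im (f t) * Re (g t))).
  apply: eq_is_derive (rderiveD (rderiveM f1 g2) (rderiveM f2 g1)) _.
  by rewrite Im_addc !Im_mulc; ring.
by apply/funext => t; rewrite Im_mulc.
Qed.

Lemma cderiveZ f x u v : cderive f x v -> cderive (fun t => u * f t) x (u * v).
Proof.
move=> fx; apply: eq_cderive (cderiveM (cderive_cst u x) fx) _.
by rewrite mul0r add0r.
Qed.

Lemma cderiveX f x u n : cderive f x u ->
  cderive (fun t => f t ^+ n.+1) x (n.+1%:R * f x ^+ n * u).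
Proof.
move=> fx; elim: n => [|n IH].
  by apply: eq_cderive fx _; rewrite expr0; ring.
apply: eq_cderive.
  rewrite (_ : (fun t => _) = (fun t => f t * f t ^+ n.+1)).
    exact: (cderiveM fx IH).
  by apply/funext => t; rewrite exprS.
rewrite [f x ^+ n.+1 in RHS]exprS [f x ^+ n.+1]exprS -!natr1; ring.
Qed.

Lemma cderive_id x : cderive (fun t => t%:C) x 1.
Proof. by apply: (@cderive_real id); apply: is_derive_id. Qed.

Lemma cderive_line (a b : R[i]) x : cderive (fun t => a + b * t%:C) x b.
Proof.
apply: eq_cderive (cderiveD (cderive_cst a x) (cderiveZ b (cderive_id x))) _.
by rewrite add0r mulr1.
Qed.

Lemma sumsq_neq0 u : u != 0 -> Re u ^+ 2 + Im u ^+ 2 != 0.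
Proof.
case: u => a b; rewrite eq_complex /= negb_and => ab.
rewrite paddr_eq0 ?sqr_ge0// !sqrf_eq0 negb_and//.
Qed.

Lemma Re_invc u : Re u^-1 = Re u / (Re u ^+ 2 + Im u ^+ 2).
Proof. by case: u. Qed.

Lemma Im_invc u : Im u^-1 = - Im u / (Re u ^+ 2 + Im u ^+ 2).
Proof. by case: u => a b /=; rewrite mulNr. Qed.

Lemma cderiveV f x u : (forall t, f t != 0) -> cderive f x u ->
  cderive (fun t => (f t)^-1) x (- u / f x ^+ 2).
Proof.
move=> f0 [f1 f2].
pose N t := Re (f t) * Re (f t) + Im (f t) * Im (f t).
have NE t : Re (f t) ^+ 2 + Im (f t) ^+ 2 = N t by rewrite /N; ring.
have N0 t : N t != 0 by rewrite -NE sumsq_neq0.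
have dV := rderiveV (N0 x) (rderiveD (rderiveM f1 f1) (rderiveM f2 f2)).
have fxE : f x ^+ 2 =
    (Re (f x) ^+ 2 - Im (f x) ^+ 2) +i* (2 * Re (f x) * Im (f x)).
  by rewrite expr2; apply: eq_complexP; rewrite ?Re_mulc ?Im_mulc/=; ring.
have N2E : (Re (f x) ^+ 2 - Im (f x) ^+ 2) ^+ 2
    + (2 * Re (f x) * Im (f x)) ^+ 2 = N x ^+ 2 by rewrite -NE; ring.
split.
  rewrite (_ : (fun t => _) = (fun t => Re (f t) * (N t)^-1)).
    apply: eq_is_derive (rderiveM f1 dV) _.
    rewrite -!/(N x) Re_mulc Re_invc Im_invc fxE /= N2E.
    case: u f1 f2 dV => c d _ _ _ /=; have := N0 x; rewrite /N.
    by move: (Re (f x)) (Im (f x)) => a b ab; field.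
  by apply/funext => t; rewrite Re_invc NE.
rewrite (_ : (fun t => _) = (fun t => - Im (f t) * (N t)^-1)).
  apply: eq_is_derive (rderiveM (rderiveN f2) dV) _.
  rewrite -!/(N x) Im_mulc Re_invc Im_invc fxE /= N2E.
  case: u f1 f2 dV => c d _ _ _ /=; have := N0 x; rewrite /N.
  by move: (Re (f x)) (Im (f x)) => a b ab; field.
by apply/funext => t; rewrite Im_invc NE.
Qed.

Lemma cexp0 : cexp (0 : R[i]) = 1.
Proof. by rewrite /cexp /= expR0 cos0 sin0 mul1r. Qed.

Lemma cderive_cexp (c : R[i]) x :
  cderive (fun t => cexp (c * t%:C)) x (c * cexp (c * x%:C)).
Proof.
have E1 t : Re (cexp (c * t%:C)) = expR (Re c * t) * cos (Im c * t).
  by rewrite /cexp Re_mulc Re_mulc Im_mulc /= !mulr0 !mul0r !subr0 add0r.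
have E2 t : Im (cexp (c * t%:C)) = expR (Re c * t) * sin (Im c * t).
  by rewrite /cexp Im_mulc Re_mulc Im_mulc /= !mulr0 !mul0r !subr0 addr0 add0r.
have L (k : R) : is_derive x 1 (fun t => k * t) k.
  by apply: eq_is_derive (rderiveZ k (rderive_id x)) _; rewrite mulr1.
have D1 := rderive_comp (is_derive_expR (Re c * x)) (L (Re c)).
have D2 := rderive_comp (is_derive_cos (Im c * x)) (L (Im c)).
have D3 := rderive_comp (is_derive_sin (Im c * x)) (L (Im c)).
split.
  rewrite (_ : (fun t => _) = (fun t => expR (Re c * t) * cos (Im c * t))).
    by apply: eq_is_derive (rderiveM D1 D2) _; rewrite Re_mulc E1 E2; ring.
  by apply/funext => t; rewrite E1.
rewrite (_ : (fun t => _) = (fun t => expR (Re c * t) * sin (Im c * t))).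
  by apply: eq_is_derive (rderiveM D1 D3) _; rewrite Im_mulc E1 E2; ring.
by apply/funext => t; rewrite E2.
Qed.

End ComplexCalculus.

(** * Integrals over segments *)

Section SegmentIntegrals.
Variable R : realType.
Notation mu := (@lebesgue_measure R).
Implicit Types (f g h F : R -> R) (a b : R).

Definition segint a b f : R := (\int[mu]_(x in `[a, b]) f x)%R.

Lemma continuous_integrable f a b :
  continuous f -> mu.-integrable `[a, b] (EFin \o f).
Proof.
move=> cf; apply: continuous_compact_integrable; first exact: segment_compact.
exact: continuous_subspaceT.
Qed.

Lemma eq_segint f g a b :
  (forall x, a <= x <= b -> f x = g x) -> segint a b f = segint a b g.
Proof.
by move=> fg; apply: eq_Rintegral => x /[!inE] /= /[!in_itv] /= /fg.
Qed.

Lemma segintD f g a b : continuous f -> continuous g ->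
  segint a b (fun x => f x + g x) = segint a b f + segint a b g.
Proof. by move=> cf cg; apply: RintegralD => //; exact: continuous_integrable. Qed.

Lemma segintZ c f a b : continuous f ->
  segint a b (fun x => c * f x) = c * segint a b f.
Proof. by move=> cf; apply: RintegralZl => //; exact: continuous_integrable. Qed.

Lemma segintN f a b : continuous f ->
  segint a b (fun x => - f x) = - segint a b f.
Proof.
move=> cf; rewrite -mulN1r -segintZ//.
by congr (segint _ _ _); apply/funext => x; rewrite mulN1r.
Qed.

Lemma segint_cst c a b : a <= b -> segint a b (fun=> c) = c * (b - a).
Proof.
move=> ab; rewrite /segint Rintegral_cst//= lebesgue_measure_itv/= lte_fin.
by rewrite lt_neqAle ab andbT; case: eqVneq => [->|_] /=; rewrite ?subrr ?mulr0.
Qed.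

Lemma continuous_sum (I : Type) (r : seq I) (P : pred I) (f : I -> R -> R) :
  (forall i, continuous (f i)) -> continuous (fun x => \sum_(i <- r | P i) f i x).
Proof.
move=> cf; elim: r => [|i r IH] x.
  rewrite (_ : (fun _ => _) = fun=> 0); first exact: cvg_cst.
  by apply/funext => y; rewrite big_nil.
rewrite (_ : (fun _ => _) =
    fun y => (if P i then f i y else 0) + \sum_(j <- r | P j) f j y).
  by apply: cvgD (IH x); case: ifP => _; [exact: cf|exact: cvg_cst].
by apply/funext => y; rewrite big_cons; case: ifP => // _; rewrite add0r.
Qed.

Lemma segint_sum (I : Type) (r : seq I) (P : pred I) (f : I -> R -> R) a b :
  (forall i, continuous (f i)) ->
  segint a b (fun x => \sum_(i <- r | P i) f i x) =
  \sum_(i <- r | P i) segint a b (f i).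
Proof.
move=> cf; elim: r => [|i r IH].
  rewrite big_nil -[RHS](Rintegral_set0 mu (fun=> 0)).
  transitivity (segint a b (fun=> 0)).
    by apply: eq_segint => x _; rewrite big_nil.
  by rewrite /segint /Rintegral !integral0.
rewrite big_cons; case: ifPn => Pi; last first.
  by rewrite -IH; apply: eq_segint => x _; rewrite big_cons (negbTE Pi).
rewrite -IH -segintD//; last exact: continuous_sum.
by apply: eq_segint => x _; rewrite big_cons Pi.
Qed.

Lemma le_segint f g a b : continuous f -> continuous g ->
  (forall x, a <= x <= b -> f x <= g x) -> segint a b f <= segint a b g.
Proof.
move=> cf cg fg; apply: le_Rintegral; try exact: continuous_integrable.
  exact: measurable_itv.
by move=> x /=; rewrite in_itv/=; exact: fg.
Qed.

Lemma continuous_normr f : continuous f -> continuous (fun x => `|f x|).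
Proof. by move=> cf x; apply: (cvg_norm (cf x)). Qed.

Lemma le_norm_segint f a b : continuous f ->
  `|segint a b f| <= segint a b (fun x => `|f x|).
Proof. by move=> cf; apply: le_normr_Rintegral => //; exact: continuous_integrable. Qed.

Lemma segint_FTC F f a b : a <= b -> continuous f ->
  (forall x, a <= x <= b -> is_derive x 1 F (f x)) ->
  segint a b f = F b - F a.
Proof.
move=> ab cf dF; move: ab; rewrite le_eqVlt => /predU1P[<-|ab].
  by rewrite /segint set_itv1 Rintegral_set1 subrr.
have cF x : a <= x <= b -> {for x, continuous F}.
  by move=> /dF ?; apply: differentiable_continuous; apply/derivable1_diffP; exact: ex_derive.
rewrite /segint /Rintegral (@continuous_FTC2 _ f F a b)//.
- exact: continuous_subspaceT.
- split.
  + move=> x /[!in_itv]/= /andP[ax xb].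
    have /dF [] : a <= x <= b by rewrite !ltW.
    by [].
  + by apply: cvg_at_right_filter; apply: cF; rewrite lexx ltW.
  + by apply: cvg_at_left_filter; apply: cF; rewrite lexx ltW.
- move=> x /[!in_itv]/= /andP[ax xb]; rewrite derive1E.
  have /dF [_ ->] : a <= x <= b by rewrite !ltW.
  by [].
Qed.

Lemma is_derive_segint f a x : continuous f -> a < x ->
  is_derive x 1 (fun t => segint a t f) (f x).
Proof.
move=> cf ax.
have xx1 : x < x + 1 by rewrite ltrDl.
have [d e] := continuous_FTC1_closed xx1 (@continuous_integrable f a (x + 1) cf) ax (cf x).
by apply: DeriveDef => //; rewrite -derive1E.
Qed.

(** Starting the integral to the left of the points of interest makes it
differentiable at all of them. *)
Lemma antiderivative f : continuous f ->
  exists H : R -> R, forall x : R, -1 < x -> is_derive x 1 H (f x).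
Proof.
by move=> cf; exists (fun t => segint (-1) t f) => x; exact: is_derive_segint.
Qed.

Lemma fcontinuous_cst (c : R) : continuous (fun _ : R => c).
Proof. by move=> x; exact: cvg_cst. Qed.

Lemma fcontinuousD f g : continuous f -> continuous g ->
  continuous (fun x => f x + g x).
Proof. by move=> cf cg x; exact: (cvgD (cf x) (cg x)). Qed.

Lemma fcontinuousB f g : continuous f -> continuous g ->
  continuous (fun x => f x - g x).
Proof. by move=> cf cg x; exact: (cvgB (cf x) (cg x)). Qed.

Lemma fcontinuousM f g : continuous f -> continuous g ->
  continuous (fun x => f x * g x).
Proof. by move=> cf cg x; exact: (cvgM (cf x) (cg x)). Qed.

Lemma fcontinuousZ (c : R) f : continuous f -> continuous (fun x => c * f x).
Proof. by move=> cf x; exact: (cvgM (@cvg_cst _ _ _ _ _) (cf x)). Qed.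

Lemma fcontinuousN f : continuous f -> continuous (fun x => - f x).
Proof. by move=> cf x; exact: (cvgN (cf x)). Qed.

Lemma fcontinuousXn n : continuous (fun x : R => x ^+ n).
Proof. exact: exprn_continuous. Qed.

Lemma fcontinuousX f n : continuous f -> continuous (fun x => f x ^+ n).
Proof.
move=> cf x.
exact: (@continuous_comp _ _ _ f (fun y : R => y ^+ n) x (cf x) (@fcontinuousXn n (f x))).
Qed.

End SegmentIntegrals.

Section ComplexIntegrals.
Variable R : realType.
Notation mu := (@lebesgue_measure R).
Implicit Types (f g F : R -> R[i]) (a b : R).

Definition ccontinuous f :=
  continuous (fun t => Re (f t)) /\ continuous (fun t => Im (f t)).

Definition csegint a b f : R[i] :=
  segint a b (fun x => Re (f x)) +i* segint a b (fun x => Im (f x)).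

Lemma cderive_continuous F f : (forall x, cderive F x (f x)) -> ccontinuous F.
Proof.
move=> dF; split.
  by apply: (@is_derive_continuous _ _ (fun x => Re (f x))) => x; case: (dF x).
by apply: (@is_derive_continuous _ _ (fun x => Im (f x))) => x; case: (dF x).
Qed.

Lemma csegint_FTC F f a b : a <= b -> ccontinuous f ->
  (forall x, cderive F x (f x)) -> csegint a b f = F b - F a.
Proof.
move=> ab [c1 c2] dF; apply: eq_complexP => /=.
  have /= -> := segint_FTC ab c1 (fun x _ => (dF x).1).
  by case: (F b) => ? ?; case: (F a).
have /= -> := segint_FTC ab c2 (fun x _ => (dF x).2).
by case: (F b) => ? ?; case: (F a).
Qed.

Lemma csegintD f g a b : ccontinuous f -> ccontinuous g ->
  csegint a b (fun x => f x + g x) = csegint a b f + csegint a b g.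
Proof.
move=> [f1 f2] [g1 g2]; rewrite /csegint; apply: eq_complexP => /=.
  by rewrite -segintD//; apply: eq_segint => x _; rewrite Re_addc.
by rewrite -segintD//; apply: eq_segint => x _; rewrite Im_addc.
Qed.

Lemma csegintZ u f a b : ccontinuous f ->
  csegint a b (fun x => u * f x) = u * csegint a b f.
Proof.
move=> [f1 f2]; apply: eq_complexP.
  rewrite [in RHS]Re_mulc /= -!segintZ// -segintN; last exact: fcontinuousZ.
  rewrite -segintD; [|exact: fcontinuousZ|].
    by apply: eq_segint => x _; rewrite Re_mulc.
  by move=> x; apply: cvgN; exact: fcontinuousZ.
rewrite [in RHS]Im_mulc /= -!segintZ// -segintD; [|exact: fcontinuousZ..].
by apply: eq_segint => x _; rewrite Im_mulc.
Qed.

Lemma eq_csegint f g a b :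
  (forall x, a <= x <= b -> f x = g x) -> csegint a b f = csegint a b g.
Proof. by move=> fg; congr (_ +i* _); apply: eq_segint => x /fg ->. Qed.

End ComplexIntegrals.

(** * An integral of powers of the linear form a + i b x *)

Section MoreCalculus.
Variable R : realType.

(** The primitive in [kernel_identity] contains negative powers of the variable, so
that at the left end only a limit from the right is at hand. *)
Lemma segint_FTC_right (F f : R -> R) (a b : R) : a < b -> continuous f ->
  (forall x : R, a < x <= b -> is_derive x 1 F (f x)) ->
  F x @[x --> a^'+] --> F a ->
  segint a b f = F b - F a.
Proof.
move=> ab cf dF Fa.
have cF (x : R) : a < x <= b -> {for x, continuous F}.
  by move=> /dF ?; apply: differentiable_continuous; apply/derivable1_diffP; exact: ex_derive.
rewrite /segint /Rintegral (@continuous_FTC2 _ f F a b)//.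
- exact: continuous_subspaceT.
- split => //.
  + move=> x /[!in_itv]/= /andP[ax xb].
    have /dF [] : a < x <= b by rewrite ax ltW.
    by [].
  + by apply: cvg_at_left_filter; apply: cF; rewrite lexx ab.
- move=> x /[!in_itv]/= /andP[ax xb]; rewrite derive1E.
  have /dF [_ ->] : a < x <= b by rewrite ax ltW.
  by [].
Qed.

Lemma cderive_sum n (f : 'I_n -> R -> R[i]) (v : 'I_n -> R[i]) x :
  (forall i, cderive (f i) x (v i)) ->
  cderive (fun t => \sum_(i < n) f i t) x (\sum_(i < n) v i).
Proof.
elim: n f v => [|n IH] f v fv.
  rewrite big_ord0 (_ : (fun _ => _) = fun=> 0); first exact: cderive_cst.
  by apply/funext => t; rewrite big_ord0.
rewrite big_ord_recl (_ : (fun _ => _) =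
    fun t => f ord0 t + \sum_(i < n) f (lift ord0 i) t).
  by apply: cderiveD => //; apply: IH.
by apply/funext => t; rewrite big_ord_recl.
Qed.

End MoreCalculus.

Section Kernel.
Variable R : realType.
Implicit Types (a b s x : R).

Lemma rcD a b : (a + b)%:C = a%:C + b%:C :> R[i].
Proof. exact: rmorphD. Qed.

Lemma rcB a b : (a - b)%:C = a%:C - b%:C :> R[i].
Proof. exact: rmorphB. Qed.

Lemma rcN a : (- a)%:C = - a%:C :> R[i].
Proof. exact: rmorphN. Qed.

Lemma rcM a b : (a * b)%:C = a%:C * b%:C :> R[i].
Proof. exact: rmorphM. Qed.

Lemma rcX a n : (a ^+ n)%:C = a%:C ^+ n :> R[i].
Proof. exact: rmorphXn. Qed.

Lemma rcV a : (a^-1)%:C = a%:C^-1 :> R[i].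
Proof. exact: fmorphV. Qed.

Lemma rc_nat n : (n%:R : R)%:C = n%:R :> R[i].
Proof. exact: rmorph_nat. Qed.

Definition rcE := (rcD, rcB, rcN, rcM, rcX, rcV, rc_nat).

(** The linear form attached to the lattice point (a, b); its real part a never
vanishes below, which makes all its negative powers smooth in x. *)
Definition lin a b x : R[i] := a%:C + ('i%C * b%:C) * x%:C.

Lemma Re_lin a b x : Re (lin a b x) = a.
Proof. by rewrite /lin /=; ring. Qed.

Lemma Im_lin a b x : Im (lin a b x) = b * x.
Proof. by rewrite /lin /=; ring. Qed.

Lemma lin_neq0 a b x : a != 0 -> lin a b x != 0.
Proof.
by apply: contraNneq => /(congr1 (@complex.Re R)); rewrite Re_lin => ->.
Qed.

Definition normsq (u : R[i]) : R := Re u ^+ 2 + Im u ^+ 2.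

Lemma normsqM u v : normsq (u * v) = normsq u * normsq v.
Proof. by rewrite /normsq Re_mulc Im_mulc; ring. Qed.

Lemma normsqX u n : normsq (u ^+ n) = normsq u ^+ n.
Proof.
elim: n => [|n IH]; last by rewrite !exprS normsqM IH.
by rewrite !expr0 /normsq /=; ring.
Qed.

Lemma normsqV u : u != 0 -> normsq u^-1 = (normsq u)^-1.
Proof.
move=> u0; apply: (mulfI (sumsq_neq0 u0)); rewrite divff ?sumsq_neq0//.
by rewrite -/(normsq u) -normsqM divff// /normsq/=; ring.
Qed.

Lemma normsq_lin a b x : normsq (lin a b x) = a ^+ 2 + b ^+ 2 * x ^+ 2.
Proof. by rewrite /normsq Re_lin Im_lin exprMn. Qed.

Lemma le_norm_Re_expV u l : u != 0 ->
  `|Re (u ^- (2 * l))| <= (normsq u) ^- l.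
Proof.
move=> u0; have N0 : 0 <= normsq u by rewrite addr_ge0 ?sqr_ge0.
rewrite -(ler_pXn2r (n := 2)) ?nnegrE ?invr_ge0 ?exprn_ge0//.
rewrite real_normK ?num_real// exprVn -exprM mulnC -normsqX -normsqV ?expf_neq0//.
by rewrite lerDl sqr_ge0.
Qed.

Lemma cderive_lin a b x : cderive (lin a b) x ('i%C * b%:C).
Proof. exact: cderive_line. Qed.

Lemma cderive_linV a b n x : a != 0 -> cderive (fun x => lin a b x ^- n.+1) x
  (- n.+1%:R * ('i%C * b%:C) * lin a b x ^- n.+2).
Proof.
move=> a0; have l0 t : lin a b t != 0 by exact: lin_neq0.
rewrite (_ : (fun _ => _) = fun t => (lin a b t)^-1 ^+ n.+1); last first.
  by apply/funext => t; rewrite exprVn.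
apply: eq_cderive (cderiveX n (cderiveV l0 (cderive_lin a b x))) _.
have := l0 x; move: (lin a b x) => u u0; rewrite !exprVn !exprS expr0.
by field; rewrite ?u0 ?expf_neq0.
Qed.

Lemma ccontinuous_linV a b n : a != 0 -> ccontinuous (fun x => lin a b x ^- n).
Proof.
case: n => [a0|n a0].
  rewrite (_ : (fun _ => _) = fun=> 1).
    by split => x; exact: cvg_cst.
  by apply/funext => t; rewrite expr0 invr1.
split.
  apply: (@is_derive_continuous _ _ (fun x => Re (- n.+1%:R * ('i%C * b%:C) * lin a b x ^- n.+2))) => x.
  by have [] := @cderive_linV a b n x a0.
apply: (@is_derive_continuous _ _ (fun x => Im (- n.+1%:R * ('i%C * b%:C) * lin a b x ^- n.+2))) => x.
by have [] := @cderive_linV a b n x a0.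
Qed.

(** The integral of (1 - v^2)^k over [0, 1], written so as to have a meaning over the
rationals as well. *)
Definition beta_half (F : fieldType) k : F := \sum_(j < k.+1) (-1) ^+ j * 'C(k, j)%:R / (2 * j).+1%:R.

Lemma Re_imag_odd (c : R) j : Re (('i%C * c%:C) ^+ (2 * j).+1) = 0.
Proof.
rewrite exprS exprM (_ : ('i%C * c%:C) ^+ 2 = (- c ^+ 2)%:C); last first.
  by rewrite expr2; apply: eq_complexP => /=; ring.
by rewrite -rmorphXn /=; ring.
Qed.

Lemma Re_sumc (I : Type) (r : seq I) (P : pred I) (F : I -> R[i]) :
  Re (\sum_(i <- r | P i) F i) = \sum_(i <- r | P i) Re (F i).
Proof. by elim/big_rec2: _ => //= i y1 y2 _ <-; rewrite Re_addc. Qed.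

Lemma Re_realM (c : R) u : Re (c%:C * u) = c * Re u.
Proof. by rewrite Re_mulc /=; ring. Qed.

Let scaled_power (A u y : R[i]) k : A != 0 -> u != 0 ->
  A^-1 ^+ k.+1 * ((A * y / u ^+ 2) ^+ k * (A / u ^+ 2)) =
  y ^+ k * u ^- (2 * k.+1).
Proof.
move=> A0 /(expf_neq0 2); rewrite exprM; move: (u ^+ 2) => v v0.
have := expf_neq0 k A0; have := expf_neq0 k v0.
rewrite !exprMn !exprVn !exprSr.
by move: (A ^+ k) (v ^+ k) => B w w0 B0; field; rewrite ?A0 ?B0 ?v0 ?w0.
Qed.

(** The variable w = (a x + i b s^2) / (a + i b x) turns the integrand into a
constant multiple of (s^2 - w^2)^k dw. Only odd powers of w occur in a primitive;
at x = 0, w is purely imaginary and they have no real part, while at x = s,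
w = s. *)
Lemma inner_integral a b s k : 0 <= s -> a != 0 ->
  segint 0 s (fun x => (s ^+ 2 - x ^+ 2) ^+ k * Re (lin a b x ^- (2 * k.+1)))
  = beta_half R k * (s ^+ (2 * k).+1 / (a ^+ 2 + b ^+ 2 * s ^+ 2) ^+ k.+1).
Proof.
move=> s0 a0; have l0 t : lin a b t != 0 by exact: lin_neq0.
set D := a ^+ 2 + b ^+ 2 * s ^+ 2.
have D0 : D != 0.
  apply: lt0r_neq0; apply: ltr_pwDl; last by rewrite mulr_ge0 ?sqr_ge0.
  by rewrite lt_def sqrf_eq0 a0 sqr_ge0.
pose w x : R[i] := (('i%C * b%:C * (s ^+ 2)%:C) + a%:C * x%:C) * (lin a b x)^-1.
pose c j : R := 'C(k, j)%:R * (s ^+ 2) ^+ (k - j) * (-1) ^+ j.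
pose F x := (D^-1 ^+ k.+1)%:C *
  \sum_(j < k.+1) (c j / (2 * j).+1%:R)%:C * w x ^+ (2 * j).+1.
pose f x := ((s ^+ 2 - x ^+ 2) ^+ k)%:C * lin a b x ^- (2 * k.+1).
have dw x : cderive w x (D%:C / lin a b x ^+ 2).
  apply: eq_cderive
    (cderiveM (cderive_line _ _ x) (cderiveV l0 (cderive_lin a b x))) _.
  have := l0 x; rewrite /D /lin !rcE.
  have := @sqr_i R; move: ('i%C) => i ii h; field: ii.
  by rewrite h.
(* w is a homography of x that fixes s and - s. *)
have wE x : s%:C ^+ 2 - w x ^+ 2 = D%:C * (s ^+ 2 - x ^+ 2)%:C / lin a b x ^+ 2.
  have := l0 x; rewrite /w => h; apply: (mulIf (expf_neq0 2 h)).
  rewrite mulrVK ?unitfE ?expf_neq0// mulrBl exprMn exprVn.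
  rewrite mulrVK ?unitfE ?expf_neq0//.
  rewrite /D /lin !rcE.
  have := @sqr_i R; move: ('i%C) => i ii.
  rewrite !sqrrD !exprMn ii; ring: ii.
have dF x : cderive F x (f x).
  have dS := @cderive_sum R k.+1 _ _ x (fun j =>
    cderiveZ (c j / (2 * j).+1%:R)%:C (cderiveX (2 * j) (dw x))).
  apply: eq_cderive (cderiveZ _ dS) _.
  have -> : \sum_(i < k.+1) (c i / (2 * i).+1%:R)%:C *
      ((2 * i).+1%:R * w x ^+ (2 * i) * (D%:C / lin a b x ^+ 2)) =
      (s%:C ^+ 2 - w x ^+ 2) ^+ k * (D%:C / lin a b x ^+ 2).
    rewrite exprBn mulr_suml; apply: eq_bigr => j _.
    rewrite !mulrA; congr (_ * _ * _); rewrite /c !rcE -mulr_natl.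
    by rewrite -!mulrA mulKf ?pnatr_eq0// exprM; ring.
  rewrite wE /f !rcX rcV.
  have hD : D%:C != 0 :> R[i] by rewrite (fmorph_eq0 (@real_complex R)).
  exact: scaled_power.
have cc : ccontinuous f.
  have [c1 c2] := @ccontinuous_linV a b (2 * k.+1) a0.
  have cp : continuous (fun x : R => (s ^+ 2 - x ^+ 2) ^+ k).
    apply: (@fcontinuousX _ (fun x => s ^+ 2 - x ^+ 2)).
    apply: (@fcontinuousB _ (fun=> s ^+ 2) (fun x => x ^+ 2)).
      exact: fcontinuous_cst.
    exact: fcontinuousXn.
  split.
    rewrite (_ : (fun _ => _) = fun t => (s ^+ 2 - t ^+ 2) ^+ k * Re (lin a b t ^- (2 * k.+1))).
      exact: (fcontinuousM cp c1).
    by apply/funext => t; rewrite Re_realM.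
  rewrite (_ : (fun _ => _) = fun t => (s ^+ 2 - t ^+ 2) ^+ k * Im (lin a b t ^- (2 * k.+1))).
    exact: (fcontinuousM cp c2).
  by apply/funext => t; rewrite Im_mulc /=; ring.
have := congr1 (@complex.Re R) (csegint_FTC s0 cc dF).
rewrite /= /csegint /= => E.
transitivity (segint 0 s (fun x => Re (f x))).
  by apply: eq_segint => x _; rewrite Re_realM.
rewrite E.
have Re0 : Re (F 0) = 0.
  rewrite /F Re_realM Re_sumc big1 ?mulr0// => j _.
  have -> : w 0 = 'i%C * (b * s ^+ 2 / a)%:C.
    by rewrite /w /lin !rcE !mulr0 !addr0; ring.
  by rewrite Re_realM Re_imag_odd mulr0.
have ws : w s = s%:C.
  rewrite /w; apply: (mulIf (l0 s)); rewrite divfK//.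
  by rewrite /lin !rcE; ring.
have Fs : Re (F s) = D ^- k.+1 * (beta_half R k * s ^+ (2 * k).+1).
  rewrite /F Re_realM ws exprVn; congr (_ * _).
  rewrite Re_sumc /beta_half mulr_suml; apply: eq_bigr => j _.
  rewrite -rcX Re_realM /= /c.
  have -> : (2 * k).+1 = (2 * (k - j) + (2 * j).+1)%N.
    by rewrite addnS -mulnDr subnK// -ltnS.
  by rewrite exprD -exprM; ring.
have -> : Re (F s - F 0) = Re (F s) - Re (F 0).
  by case: (F s) => ? ?; case: (F 0).
by rewrite Re0 Fs subr0; ring.
Qed.

End Kernel.

(** * The tail polynomial against the powers of the linear form *)

Section KernelIdentity.
Variable R : realType.
Implicit Types (a b s x : R).

(** The denominator is odd, hence nonzero in characteristic 0. *)
Definition tail_coef (F : fieldType) (p k j : nat) : F :=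
  (-1) ^+ j * 'C(k, j)%:R / ((2 * p - 1)%:R - (2 * j)%:R).

(** This is the integral of s^(2p-2) (1 - x^2 / s^2)^k over s in [x, 1]. *)
Definition tail_poly p k x : R :=
  \sum_(j < k.+1) tail_coef R p k j * (x ^+ (2 * j) - x ^+ (2 * p - 1)).

Lemma tail_coef_den (F : numFieldType) p j : (0 < p)%N ->
  (2 * p - 1)%:R - (2 * j)%:R != 0 :> F.
Proof.
move=> p0; rewrite subr_eq0 eqr_nat; apply/eqP.
by case: p p0 => // p _; rewrite mulnS addSn subn1 /= => /(congr1 odd);
   rewrite /= !mul2n !odd_double.
Qed.

Lemma rderiveXn n x : is_derive x 1 (fun t : R => t ^+ n) (n%:R * x ^+ n.-1).
Proof.
case: n => [|n]; last exact: rderiveX.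
by rewrite mul0r; exact: is_derive_cst.
Qed.

Lemma rderiveX_ratio m n x : x != 0 ->
  is_derive x 1 (fun t : R => t ^+ m.+1 * (t ^+ n)^-1)
    ((m.+1%:R - n%:R) * (x ^+ m * (x ^+ n)^-1)).
Proof.
move=> x0; have dV := @rderiveV R (fun t => t ^+ n) x _ (expf_neq0 n x0) (rderiveXn n x).
apply: eq_is_derive (rderiveM (rderiveX m x) dV) _.
case: n {dV} => [|n]; first by rewrite !expr0 /= mulr0n; field.
have := expf_neq0 n x0; rewrite /= !exprS.
by move: (x ^+ n) (x ^+ m) => u v u0; field; rewrite x0 u0.
Qed.

Lemma continuous_poly_div a b m k : a != 0 ->
  continuous (fun s => s ^+ m / (a ^+ 2 + b ^+ 2 * s ^+ 2) ^+ k).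
Proof.
move=> a0; apply: (@fcontinuousM _ (fun s => s ^+ m)); first exact: fcontinuousXn.
have D0 s : a ^+ 2 + b ^+ 2 * s ^+ 2 != 0.
  by rewrite -normsq_lin; apply: sumsq_neq0; exact: lin_neq0.
move=> s; apply: cvgV; first by rewrite expf_neq0.
apply: (@fcontinuousX _ (fun s => a ^+ 2 + b ^+ 2 * s ^+ 2)) => {}s.
apply: cvgD; first exact: cvg_cst.
exact: (@fcontinuousZ _ (b ^+ 2) (fun s => s ^+ 2) (@fcontinuousXn _ 2)).
Qed.

Lemma segint_id (f : R -> R) c : segint c c f = 0.
Proof. by rewrite /segint set_itv1 Rintegral_set1. Qed.

Section Moments.
Variables (a b : R) (k : nat).
Hypothesis a0 : a != 0.

Let A x := Re (lin a b x ^- (2 * k.+1)).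
Let M i s := segint 0 s (fun x => x ^+ i * A x).
Let K := (a ^+ 2) ^- k.+1.

Lemma continuous_moment i : continuous (fun x => x ^+ i * A x).
Proof.
apply: (@fcontinuousM _ (fun x => x ^+ i)); first exact: fcontinuousXn.
by have [] := @ccontinuous_linV R a b (2 * k.+1) a0.
Qed.

Lemma sqr_gt0_neq0 : 0 < a ^+ 2.
Proof. by rewrite lt_def sqrf_eq0 a0 sqr_ge0. Qed.

Lemma norm_kernel_le x : `|A x| <= K.
Proof.
apply: le_trans (le_norm_Re_expV _ (lin_neq0 b x a0)) _.
have D : a ^+ 2 <= a ^+ 2 + b ^+ 2 * x ^+ 2 by rewrite lerDl mulr_ge0 ?sqr_ge0.
have D0 := lt_le_trans sqr_gt0_neq0 D.
rewrite normsq_lin /K lef_pV2 ?posrE; last 2 first.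
- by apply: exprn_gt0; exact: D0.
- by apply: exprn_gt0; exact: sqr_gt0_neq0.
by apply: lerXn2r => //; rewrite nnegrE; apply: ltW => //; exact: sqr_gt0_neq0.
Qed.

Lemma norm_moment_le i s : 0 <= s -> `|M i s| <= K * s ^+ i.+1.
Proof.
move=> s0; apply: le_trans (le_norm_segint _ _ (@continuous_moment i)) _.
apply: (@le_trans _ _ (segint 0 s (fun=> K * s ^+ i))).
  apply: le_segint.
  - exact: continuous_normr (@continuous_moment i).
  - exact: fcontinuous_cst.
  - move=> x /andP[x0 xs]; rewrite normrM mulrC ler_pM ?norm_kernel_le//.
    by rewrite ger0_norm ?exprn_ge0// lerXn2r// nnegrE.
by rewrite segint_cst// subr0 exprSr mulrA.
Qed.

Lemma is_derive_moment i s : 0 < s -> is_derive s 1 (M i) (s ^+ i * A s).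
Proof. by move=> s0; apply: is_derive_segint => //; exact: continuous_moment. Qed.

(** The binomial expansion of (s^2 - x^2)^k under the integral. *)
Lemma sum_moments s : s != 0 ->
  \sum_(j < k.+1) (-1) ^+ j * 'C(k, j)%:R * (s ^+ (2 * j))^-1 * M (2 * j) s
  = (s ^+ (2 * k))^-1 * segint 0 s (fun x => (s ^+ 2 - x ^+ 2) ^+ k * A x).
Proof.
move=> s0; have sk := expf_neq0 (2 * k) s0.
transitivity ((s ^+ (2 * k))^-1 * \sum_(j < k.+1) segint 0 s
    (fun x => ((-1) ^+ j * 'C(k, j)%:R * s ^+ (2 * (k - j))) * (x ^+ (2 * j) * A x))).
  rewrite mulr_sumr; apply: eq_bigr => j _.
  rewrite segintZ; last exact: continuous_moment.
  rewrite -/(M _ _) !mulrA; congr (_ * _).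
  have jk : (j <= k)%N by rewrite -ltnS.
  have -> : (2 * k = 2 * j + 2 * (k - j))%N by rewrite -mulnDr subnKC.
  rewrite exprD; have := expf_neq0 (2 * j) s0; have := expf_neq0 (2 * (k - j)) s0.
  by move: (s ^+ _) (s ^+ _) => u v u0 v0; field; rewrite u0 v0.
congr (_ * _); rewrite -segint_sum; last first.
  move=> j; apply: fcontinuousZ; exact: continuous_moment.
apply: eq_segint => x _; rewrite exprBn mulr_suml; apply: eq_bigr => j _.
by rewrite -!exprM -mulr_natl; ring.
Qed.

(** Multiply [inner_integral] by s^(2p-2-2k) and integrate over s in [0, 1].
Exchanging the two integrations, the left side becomes the integral of the kernel
against the integral of s^(2p-2) (1 - x^2 / s^2)^k over s in [x, 1], that is
[tail_poly]. Instead of exchanging integrals, the proof exhibits a primitive in s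
and checks that it tends to 0 at the origin. *)
Lemma kernel_identity p : (0 < p)%N -> (p <= k)%N ->
  segint 0 1 (fun x => tail_poly p k x * A x) =
  beta_half R k *
    segint 0 1 (fun s => s ^+ (2 * p - 1) / (a ^+ 2 + b ^+ 2 * s ^+ 2) ^+ k.+1).
Proof.
move=> p0 pk; have [n nE] : exists n, (2 * p - 1)%N = n.+1.
  by exists (2 * p - 2)%N; lia.
pose g s := \sum_(j < k.+1) tail_coef R p k j *
  ((s ^+ n.+1 * (s ^+ (2 * j))^-1) * M (2 * j) s + - M n.+1 s).
pose f s := beta_half R k * (s ^+ n.+1 / (a ^+ 2 + b ^+ 2 * s ^+ 2) ^+ k.+1).
have cf : continuous f by apply: fcontinuousZ; exact: continuous_poly_div.
have dg s : 0 < s -> is_derive s 1 g (f s).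
  move=> s0; have sn0 : s != 0 by rewrite gt_eqF.
  have -> : g = \sum_(j < k.+1) (fun t => tail_coef R p k j *
      ((t ^+ n.+1 * (t ^+ (2 * j))^-1) * M (2 * j) t + - M n.+1 t)).
    by apply/funext => t; rewrite /g fct_sumE.
  have -> : f s = \sum_(j < k.+1) s ^+ n *
      ((-1) ^+ j * 'C(k, j)%:R * (s ^+ (2 * j))^-1 * M (2 * j) s).
    rewrite -mulr_sumr sum_moments// inner_integral ?ltW// /f [s ^+ n.+1]exprS.
    rewrite [s ^+ (2 * k).+1]exprS; have := expf_neq0 (2 * k) sn0.
    set D := (_ + _) ^+ _; have D0 : D != 0.
      by rewrite expf_neq0// -normsq_lin; apply: sumsq_neq0; exact: lin_neq0.
    by move: (s ^+ (2 * k)) D D0 => u D D0 u0; field; rewrite u0 D0.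
  apply: is_derive_sum => j.
  apply: eq_is_derive (rderiveZ _ (rderiveD (rderiveM
    (rderiveX_ratio n (2 * j) sn0) (is_derive_moment (2 * j) s0))
    (rderiveN (is_derive_moment n.+1 s0)))) _.
  rewrite /tail_coef nE; have := tail_coef_den R j p0; rewrite nE.
  have := expf_neq0 (2 * j) sn0; rewrite !exprS.
  move: (s ^+ (2 * j)) (s ^+ n) (M _ _) (_ - _) => u v w d u0 d0.
  by field; rewrite u0 d0.
have g0 : g 0 = 0.
  by rewrite /g big1// => j _; rewrite /M !segint_id mulr0 subr0 mulr0.
have gcvg : g s @[s --> 0^'+] --> g 0.
  rewrite g0; apply/cvgrPdist_le => e e0.
  pose C := \sum_(j < k.+1) `|tail_coef R p k j| * (K + K).
  have K0 : 0 <= K by rewrite invr_ge0 exprn_ge0 ?sqr_ge0.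
  have C0 : 0 <= C by apply: sumr_ge0 => j _; rewrite mulr_ge0 ?addr_ge0.
  near=> s; rewrite sub0r normrN.
  have s0 : 0 < s by [].
  have s1 : s <= 1 by near: s; exact: nbhs_right_le.
  have se : s <= e / (C + 1).
    by near: s; apply: nbhs_right_le; rewrite divr_gt0// ltr_wpDl.
  have sX m : s ^+ m.+1 <= s.
    by rewrite exprS ger_pMr// exprn_ile1// ltW.
  apply: (@le_trans _ _ (C * s)); last first.
    apply: (@le_trans _ _ ((C + 1) * s)); first by rewrite ler_pM2r// lerDl.
    by rewrite mulrC -ler_pdivlMr// ltr_wpDl.
  rewrite /C mulr_suml; apply: le_trans (ler_norm_sum _ _ _) _.
  apply: ler_sum => j _; rewrite normrM -[leRHS]mulrA ler_wpM2l//.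
  rewrite mulrDl; apply: le_trans (ler_normD _ _) _; apply: lerD; last first.
    rewrite normrN; apply: le_trans (norm_moment_le _ (ltW s0)) _.
    by rewrite ler_wpM2l.
  rewrite normrM ger0_norm; last by rewrite mulr_ge0 ?invr_ge0 ?exprn_ge0 ?ltW.
  apply: (@le_trans _ _ ((s ^+ n.+1 / s ^+ (2 * j)) * (K * s ^+ (2 * j).+1))).
    apply: ler_wpM2l; first by rewrite mulr_ge0 ?invr_ge0 ?exprn_ge0 ?ltW.
    by apply: norm_moment_le; exact: ltW.
  have -> : s ^+ n.+1 / s ^+ (2 * j) * (K * s ^+ (2 * j).+1) = K * s ^+ n.+2.
    rewrite !exprS; have := expf_neq0 (2 * j) (lt0r_neq0 s0).
    by move: (s ^+ (2 * j)) => u u0; field.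
  by rewrite ler_wpM2l.
rewrite nE -segintZ; last exact: continuous_poly_div.
rewrite (segint_FTC_right ltr01 cf _ gcvg) => [|s /andP[s0 _]]; last exact: dg.
rewrite g0 subr0 /g.
transitivity (\sum_(j < k.+1) segint 0 1 (fun x => tail_coef R p k j *
    (x ^+ (2 * j) * A x + - (x ^+ n.+1 * A x)))).
  rewrite -segint_sum => [|j].
    by apply: eq_segint => x _; rewrite mulr_suml; apply: eq_bigr => j _; rewrite nE; ring.
  apply: fcontinuousZ; apply: (@fcontinuousB _ (fun x => x ^+ (2 * j) * A x)); exact: continuous_moment.
apply: eq_bigr => j _; rewrite segintZ; last first.
  by apply: (@fcontinuousB _ (fun x => x ^+ (2 * j) * A x)); exact: continuous_moment.
rewrite segintD; [|exact: continuous_moment|]; last first.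
  by move=> x; apply: cvgN; exact: continuous_moment.
by rewrite segintN ?expr1n ?invr1 ?mul1r//; exact: continuous_moment.
Unshelve. all: by end_near. Qed.

End Moments.
End KernelIdentity.

(** * The coboundary polynomial *)

Section Corrections.
Variable R : realType.
Implicit Types (a b s x : R).

(** It is at least the integral of (1 - x)^k. *)
Lemma beta_half_neq0 k : beta_half R k != 0.
Proof.
have := @inner_integral R 1 0 1 k ler01 (oner_neq0 R).
rewrite !expr1n mulr1 expr0n /= addr0 expr1n divr1 mulr1 => <-.
apply: lt0r_neq0; apply: (@lt_le_trans _ _ (segint 0 1 (fun x => (1 - x) ^+ k))).
  have c1 : continuous (fun x : R => (1 - x) ^+ k).
    apply: (@fcontinuousX _ (fun x => 1 - x)).
    by apply: (@fcontinuousB _ (fun=> 1) id) => y; [exact: cvg_cst|exact: cvg_id].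
  have dF x : is_derive x 1 (fun x => - (k.+1%:R^-1 * (1 - x) ^+ k.+1)) ((1 - x) ^+ k).
    have d1 : is_derive x 1 (fun t : R => 1 - t) (- 1).
      by apply: eq_is_derive (rderiveD (rderive_cst 1 x) (rderiveN (rderive_id x))) _; rewrite add0r.
    have d2 := @rderive_comp R (fun t => t ^+ k.+1) (fun t => 1 - t) x _ _ (rderiveX k (1 - x)) d1.
    apply: eq_is_derive (rderiveN (rderiveZ k.+1%:R^-1 d2)) _.
    by rewrite mulrN1 mulrN opprK mulKf// pnatr_eq0.
  rewrite (segint_FTC ler01 c1 (fun x _ => dF x)).
  by rewrite subrr subr0 expr0n /= mulr0 expr1n mulr1 oppr0 sub0r opprK invr_gt0.
apply: le_segint.
- apply: (@fcontinuousX _ (fun x => 1 - x)).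
  by apply: (@fcontinuousB _ (fun=> 1) id) => y; [exact: cvg_cst|exact: cvg_id].
- apply: (@fcontinuousM _ (fun x => (1 - x ^+ 2) ^+ k)).
    apply: (@fcontinuousX _ (fun x => 1 - x ^+ 2)).
    apply: (@fcontinuousB _ (fun=> 1) (fun x => x ^+ 2)); last exact: fcontinuousXn.
    by move=> y; exact: cvg_cst.
  by have [] := @ccontinuous_linV R 1 0 (2 * k.+1) (oner_neq0 R).
- move=> x /andP[x0 x1]; have -> : lin 1 0 x = 1.
    by apply: eq_complexP; rewrite ?Re_lin ?Im_lin ?mul0r.
  rewrite expr1n invr1 mulr1; apply: lerXn2r.
  + by rewrite nnegrE subr_ge0.
  + by rewrite nnegrE subr_ge0 expr_le1.
  + by rewrite lerD2l lerN2 expr2 ler_piMl.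
Qed.

Lemma segint_kernel a b k : a != 0 -> b != 0 ->
  segint 0 1 (fun x => Re (lin a b x ^- (2 * k.+1))) =
  - Im (lin a b 1 ^- (2 * k).+1) / ((2 * k).+1%:R * b).
Proof.
(* c is minus the inverse of (2 k + 1) times i b, from differentiating the power. *)
move=> a0 b0; pose c : R[i] := 'i%C * ((2 * k).+1%:R * b)^-1%:C.
have dF x : cderive (fun x => c * lin a b x ^- (2 * k).+1) x (lin a b x ^- (2 * k.+1)).
  apply: eq_cderive (cderiveZ c (cderive_linV b (2 * k) x a0)) _.
  rewrite mulnS !mulrA (_ : c * _ * _ * _ = 1) ?mul1r//.
  rewrite /c !rcE; have := @sqr_i R; move: 'i%C => i ii.
  have bC : b%:C != 0 :> R[i] by rewrite (fmorph_eq0 (@real_complex R)).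
  field: ii; by rewrite bC -natrM nat1r pnatr_eq0.
have := congr1 (@complex.Re R) (csegint_FTC ler01 (ccontinuous_linV b (2 * k.+1) a0) dF).
rewrite /csegint /= => ->.
have E0 : lin a b 0 ^- (2 * k).+1 = (a ^- (2 * k).+1)%:C.
  by rewrite /lin !mulr0 !addr0 !rcE.
rewrite E0; case: (lin a b 1 ^- (2 * k).+1) => u v; rewrite /c /=; ring.
Qed.

Lemma segint_kernel_top a b k : a != 0 ->
  segint 0 1 (fun x => x ^+ (2 * k) * Re (lin a b x ^- (2 * k.+1))) =
  Re (lin a b 1 ^- (2 * k).+1) / ((2 * k).+1%:R * a).
Proof.
move=> a0; pose c : R[i] := ((2 * k).+1%:R * a)^-1%:C.
have l0 t : lin a b t != 0 by exact: lin_neq0.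
have aC : a%:C != 0 :> R[i] by rewrite (fmorph_eq0 (@real_complex R)).
pose f x := (x ^+ (2 * k))%:C * lin a b x ^- (2 * k.+1).
have dF x : cderive (fun x => c * (x%:C * (lin a b x)^-1) ^+ (2 * k).+1) x (f x).
  (* The integrand is (1/a) w^(2k) dw for w = x / (a + i b x). *)
  have dw : cderive (fun x => x%:C * (lin a b x)^-1) x (a%:C / lin a b x ^+ 2).
    apply: eq_cderive (cderiveM (cderive_id x) (cderiveV l0 (cderive_lin a b x))) _.
    by have := l0 x; rewrite /lin => h; field; exact: h.
  apply: eq_cderive (cderiveZ c (cderiveX (2 * k) dw)) _.
  rewrite /f mulnS exprMn exprVn rcX /c rcV rcM rc_nat (exprD _ 2).
  have := expf_neq0 (2 * k) (l0 x); have := l0 x.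
  move: (lin a b x ^+ (2 * k)) (lin a b x) (x%:C ^+ _) => u v w v0 u0.
  by field; rewrite u0 v0 aC -natrM nat1r pnatr_eq0.
have cf : ccontinuous f.
  have [c1 c2] := @ccontinuous_linV R a b (2 * k.+1) a0.
  split.
    rewrite (_ : (fun _ => _) = fun t => t ^+ (2 * k) * Re (lin a b t ^- (2 * k.+1))).
      by apply: (@fcontinuousM _ (fun t => t ^+ (2 * k))) => //; exact: fcontinuousXn.
    by apply/funext => t; rewrite Re_realM.
  rewrite (_ : (fun _ => _) = fun t => t ^+ (2 * k) * Im (lin a b t ^- (2 * k.+1))).
    by apply: (@fcontinuousM _ (fun t => t ^+ (2 * k))) => //; exact: fcontinuousXn.
  by apply/funext => t; rewrite Im_mulc /=; ring.
have := congr1 (@complex.Re R) (csegint_FTC ler01 cf dF).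
rewrite /csegint /= => E.
transitivity (segint 0 1 (fun x => Re (f x))).
  by apply: eq_segint => x _; rewrite Re_realM.
rewrite E mul0r expr0n /= mulr0 subr0 mul1r exprVn Re_realM.
by rewrite mulrC.
Qed.

(** The value at X = i x of 1 - X^(2k), the coboundary in the period polynomials of
weight 2k + 2. *)
Definition coboundary k x : R := 1 + (-1) ^+ k.+1 * x ^+ (2 * k).

(** Against the constant and against x^(2k) the kernel has explicit primitives, whose
end point values are the imaginary and the real part of a power of a + i b. As
b + i a is i times the conjugate of a + i b, exchanging a and b exchanges these
two values up to sign. *)
Lemma coboundary_antisym a b k : a != 0 -> b != 0 ->
  segint 0 1 (fun x => coboundary k x * Re (lin a b x ^- (2 * k.+1))) +
  segint 0 1 (fun x => coboundary k x * Re (lin b a x ^- (2 * k.+1))) = 0.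
Proof.
move=> a0 b0.
have E c d : c != 0 -> d != 0 ->
    segint 0 1 (fun x => coboundary k x * Re (lin c d x ^- (2 * k.+1))) =
    - Im (lin c d 1 ^- (2 * k).+1) / ((2 * k).+1%:R * d) +
    (-1) ^+ k.+1 * (Re (lin c d 1 ^- (2 * k).+1) / ((2 * k).+1%:R * c)).
  move=> c0 d0; rewrite -segint_kernel// -segint_kernel_top// -segintZ; last first.
    exact: continuous_moment.
  rewrite -segintD.
  - by apply: eq_segint => x _; rewrite /coboundary; ring.
  - by have [] := @ccontinuous_linV R c d (2 * k.+1) c0.
  - by apply: fcontinuousZ; exact: continuous_moment.
rewrite !E//.
have L : lin b a 1 = 'i%C * (lin a b 1)^*%C.
  by apply: eq_complexP; rewrite /lin /=; ring.
have iE n : ('i%C ^+ (2 * n).+1)^-1 = ((-1) ^+ n.+1)%:C * 'i%C :> R[i].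
  have i0 : 'i%C != 0 :> R[i] by rewrite eq_complex /= oner_eq0 andbF.
  apply: (mulfI (expf_neq0 (2 * n).+1 i0)); rewrite divff ?expf_neq0//.
  have := @sqr_i R; rewrite (exprS _ (2 * n)) (exprM _ 2); move: ('i%C) => i ii; rewrite ii.
  rewrite rcX exprS rcN -[1 in LHS](_ : (-1) ^+ n * (-1) ^+ n = 1 :> R[i]).
    by ring: ii.
  by rewrite -expr2 sqrr_sign.
have vE : (lin b a 1 ^+ (2 * k).+1)^-1 =
    ((-1) ^+ k.+1)%:C * ('i%C * ((lin a b 1 ^+ (2 * k).+1)^-1)^*%C).
  rewrite L exprMn invfM iE -mulrA conjc_inv; congr (_ * (_ * _^-1)).
  by rewrite -(rmorphXn (@conjc R)).
rewrite vE Re_realM Im_mulc.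
case: ((lin a b 1 ^+ (2 * k).+1)^-1) => u v /=.
set e := (-1) ^+ k.+1; have ee : e * e = 1 by rewrite -expr2 sqrr_sign.
have n0 : (2 * k).+1%:R != 0 :> R by rewrite pnatr_eq0.
by field: ee; rewrite a0 b0 -natrM nat1r n0.
Qed.

End Corrections.

(** * From [0, 1] to [1, +oo[ by inversion *)

Section InverseSubstitution.
Variable R : realType.
Notation mu := (@lebesgue_measure R).
Implicit Types (h : R -> R) (x y : R).

Lemma continuous_weighted h y : continuous h -> y != 0 ->
  {for y, continuous (fun y => y ^- 2 * h y^-1)}.
Proof.
move=> ch y0; apply: (@cvgM _ _ _ _ (fun y => y ^- 2)).
  by apply: cvgV; [rewrite expf_neq0|exact: fcontinuousXn].
apply: (@continuous_comp _ _ _ (fun y : R => y^-1) h); last exact: ch.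
by apply: cvgV => //; exact: cvg_id.
Qed.

Lemma within_weighted h : continuous h ->
  {within `[1, +oo[, continuous (fun y => y ^- 2 * h y^-1)}.
Proof.
move=> ch; apply: continuous_in_subspaceT => y.
rewrite inE/= in_itv/= andbT => y1; apply: continuous_weighted => //.
by rewrite gt_eqF// (lt_le_trans _ y1).
Qed.

Lemma ge0_integral_inv h : continuous h ->
  (forall x, 0 <= x <= 1 -> 0 <= h x) ->
  (\int[mu]_(y in `[(1 : R)%R, +oo[) (y ^- 2 * h y^-1)%:E = (segint 0 1 h)%:E)%E.
Proof.
move=> ch h0; have [H dH] := antiderivative ch.
have dF y : 0 < y -> is_derive y 1 (fun y => - H y^-1) (y ^- 2 * h y^-1).
  move=> y0; have yV : -1 < y^-1 by rewrite (lt_trans _ (_ : 0 < y^-1)) ?invr_gt0 ?ltrN10.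
  have dV := rderiveV (lt0r_neq0 y0) (rderive_id y).
  apply: eq_is_derive (rderiveN (rderive_comp (dH _ yV) dV)) _.
  by rewrite mulNr mul1r mulrN opprK mulrC.
have cH0 : {for 0, continuous H}.
  have d0 := dH 0 (ltrN10 _).
  by apply: differentiable_continuous; apply/derivable1_diffP; exact: ex_derive.
rewrite (@ge0_continuous_FTC2y R (fun y => y ^- 2 * h y^-1) (fun y => - H y^-1) 1 (- H 0)).
- rewrite invr1 -EFinB opprK addrC; congr _%:E; apply/esym.
  apply: (segint_FTC ler01 ch) => x /andP[x0 _].
  by apply: dH; rewrite (lt_le_trans _ x0)// ltrN10.
- move=> y y1; have y0 : 0 < y by rewrite (lt_le_trans _ y1).
  by rewrite mulr_ge0 ?invr_ge0 ?exprn_ge0 ?(ltW y0)// h0// invr_ge0 ltW//= invf_le1.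
- exact: within_weighted.
- apply: cvgN; apply: (cvg_comp (fun y => y^-1) H); last exact: cH0.
  by apply/gtr0_cvgV0; [near do done|exact: cvg_id].
- by move=> y y1; have [] := dF y (lt_trans ltr01 y1).
- have c1 : {for 1, continuous (fun y => - H y^-1)}.
    apply: differentiable_continuous; apply/derivable1_diffP.
    by have [] := dF 1 ltr01.
  exact: (cvg_at_right_filter c1).
- move=> y; rewrite in_itv/= andbT => y1.
  by rewrite derive1E; have [_ ->] := dF y (lt_trans ltr01 y1).
Unshelve. all: by end_near. Qed.

Lemma measurable_weighted h : continuous h ->
  measurable_fun `[(1 : R)%R, +oo[ (fun y => y ^- 2 * h y^-1).
Proof.
move=> ch; apply: subspace_continuous_measurable_fun => //.
exact: within_weighted.
Qed.

Lemma ge0_integrable_inv h : continuous h ->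
  (forall x, 0 <= x <= 1 -> 0 <= h x) ->
  mu.-integrable `[(1 : R)%R, +oo[ (EFin \o (fun y => y ^- 2 * h y^-1)).
Proof.
move=> ch h0; apply/integrableP; split.
  by apply/measurable_EFinP; exact: measurable_weighted.
have := ge0_integral_inv ch h0.
rewrite (_ : (\int[mu]_(x in _) `|_ x|)%E =
    (\int[mu]_(y in `[(1 : R)%R, +oo[) (y ^- 2 * h y^-1)%:E)%E) => [->|].
  by rewrite ltry.
apply: eq_integral => y; rewrite inE/= in_itv/= andbT => y1.
have y0 : 0 < y by rewrite (lt_le_trans _ y1).
rewrite ger0_norm// mulr_ge0 ?invr_ge0 ?exprn_ge0 ?(ltW y0)// h0//.
by rewrite invr_ge0 ltW//= invf_le1.
Qed.

(** The substitution y = 1/x; the general case follows from that of a nonnegative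
function by adding a constant. *)
Lemma integral_inv h : continuous h ->
  mu.-integrable `[(1 : R)%R, +oo[ (EFin \o (fun y => y ^- 2 * h y^-1)) /\
  (\int[mu]_(y in `[(1 : R)%R, +oo[) (y ^- 2 * h y^-1))%R = segint 0 1 h.
Proof.
move=> ch.
have [c _ hc] := @EVT_max R (fun x => `|h x|) 0 1 ler01
  (continuous_subspaceT (continuous_normr ch)).
set C := `|h c| in hc.
have C0 : 0 <= C by rewrite /C normr_ge0.
have ch1 : continuous (fun x => h x + C).
  by apply: (fcontinuousD ch); exact: fcontinuous_cst.
have h10 x : 0 <= x <= 1 -> 0 <= h x + C.
  move=> x01; have := hc x; rewrite in_itv/= => /(_ x01).
  by rewrite ler_norml => /andP[+ _]; rewrite -lerBlDr sub0r.
have cC := @fcontinuous_cst R C.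
have i1 := ge0_integrable_inv ch1 h10.
have i2 := @ge0_integrable_inv (fun=> C) cC (fun x _ => C0).
have E : (fun y : R => y ^- 2 * h y^-1) = (fun y => y ^- 2 * (h y^-1 + C) - y ^- 2 * C).
  by apply/funext => y; ring.
split.
  by rewrite E; apply: (integrableB _ i1 i2).
rewrite E RintegralB//; rewrite /Rintegral (ge0_integral_inv ch1 h10).
rewrite (@ge0_integral_inv (fun=> C) cC (fun x _ => C0)) /=.
by rewrite (segintD _ _ ch cC) addrK.
Qed.

End InverseSubstitution.

Section SquareSums.
Variable R : realType.
Notation mu := (@lebesgue_measure R).
Variables (p k : nat).
Hypotheses (p0 : (0 < p)%N) (pk : (p <= k)%N).
Implicit Types (x y : R).

(** The multiple of the coboundary is chosen to cancel the constant term, for the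
sake of [reduced_tail_le]. *)
Definition reduced_tail x : R := tail_poly p k x - tail_coef R p k 0 * coboundary k x.
Definition period_poly y : R := y ^+ (2 * k) * reduced_tail y^-1.

Definition lattice_term (y : R) (m n : nat) : R :=
  Re (lin (n.+1%:R * y) m.+1%:R 1 ^- (2 * k.+1)).

Definition beta_int (m n : nat) : R := segint 0 1
  (fun s => s ^+ (2 * p - 1) / (n.+1%:R ^+ 2 + m.+1%:R ^+ 2 * s ^+ 2) ^+ k.+1).

Lemma continuous_tail_poly : continuous (@tail_poly R p k).
Proof.
apply: continuous_sum => j; apply: fcontinuousZ.
by apply: (@fcontinuousB _ (fun x => x ^+ (2 * j))); exact: fcontinuousXn.
Qed.

Lemma continuous_coboundary : continuous (@coboundary R k).
Proof.
apply: (@fcontinuousD _ (fun=> 1)); first exact: fcontinuous_cst.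
by apply: fcontinuousZ; exact: fcontinuousXn.
Qed.

Lemma continuous_reduced_tail : continuous reduced_tail.
Proof.
apply: fcontinuousB; first exact: continuous_tail_poly.
by apply: fcontinuousZ; exact: continuous_coboundary.
Qed.

Lemma reduced_tail_le : exists2 C : R, 0 <= C &
  forall x, 0 <= x <= 1 -> `|reduced_tail x| <= C * x.
Proof.
pose a := tail_coef R p k.
pose C := \sum_(j < k) `|a j.+1| + \sum_(j < k.+1) `|a j| + `|a 0%N|.
exists C; first by rewrite !addr_ge0// sumr_ge0.
move=> x /andP[x0 x1]; have [k' kE] : exists k', k = k'.+1 by exists k.-1; lia.
have [p' pE] : exists p', (2 * p - 1 = p'.+1)%N by exists (2 * p - 2)%N; lia.
have xX n : x ^+ n.+1 <= x by rewrite exprS ler_piMr// exprn_ile1.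
have xX0 n : 0 <= x ^+ n by rewrite exprn_ge0.
have -> : reduced_tail x = \sum_(j < k) a j.+1 * x ^+ (2 * j.+1)
    - (\sum_(j < k.+1) a j) * x ^+ (2 * p - 1)
    - a 0%N * (-1) ^+ k.+1 * x ^+ (2 * k).
  rewrite /reduced_tail /tail_poly /coboundary.
  under eq_bigr do rewrite mulrBr.
  rewrite sumrB -mulr_suml big_ord_recl /= muln0 expr0.
  by rewrite -/a; under eq_bigr do rewrite /bump /=; ring.
rewrite /C !mulrDl; apply: le_trans (ler_normB _ _) _; apply: lerD.
  apply: le_trans (ler_normB _ _) _; apply: lerD.
    rewrite mulr_suml; apply: le_trans (ler_norm_sum _ _ _) _.
    apply: ler_sum => j _; rewrite normrM ler_wpM2l// ger0_norm//.
    by rewrite mulnS; exact: (xX (2 * j).+1).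
  rewrite normrM ler_pM//; first exact: ler_norm_sum.
  by rewrite pE ger0_norm.
rewrite -mulrA normrM ler_wpM2l// normrM normrX normrN1 expr1n mul1r ger0_norm//.
by rewrite kE mulnS; exact: (xX (2 * k').+1).
Qed.

Lemma lattice_termE y m n : 0 < y ->
  y ^- 2 * (reduced_tail y^-1 * Re (lin n.+1%:R m.+1%:R y^-1 ^- (2 * k.+1))) =
  period_poly y * lattice_term y m n.
Proof.
move=> y0; have yn := lt0r_neq0 y0.
have -> : lin n.+1%:R m.+1%:R y^-1 = (y^-1)%:C * lin (n.+1%:R * y) m.+1%:R 1.
  apply: eq_complexP; rewrite ?Re_realM ?Im_mulc ?Re_lin ?Im_lin /=.
    by rewrite mulrCA mulVf// mulr1.
  by rewrite mul0r addr0 mulr1 mulrC.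
rewrite exprMn (invfM ((y^-1)%:C ^+ _)) (_ : ((y^-1)%:C ^+ (2 * k.+1))^-1 = (y ^+ (2 * k.+1))%:C).
  2: by rewrite !rcE exprVn invrK.
rewrite Re_realM /period_poly /lattice_term.
rewrite mulnS exprD; move: (Re _) (y ^+ (2 * k)) => u v.
by field.
Qed.

Lemma continuous_kernel (a b : R) : a != 0 ->
  continuous (fun x => Re (lin a b x ^- (2 * k.+1))).
Proof. by move=> a0; have [] := @ccontinuous_linV R a b (2 * k.+1) a0. Qed.

Lemma nat1_neq0 (n : nat) : n.+1%:R != 0 :> R.
Proof. by rewrite pnatr_eq0. Qed.

Let kern m n x : R := reduced_tail x * Re (lin n.+1%:R m.+1%:R x ^- (2 * k.+1)).

Lemma continuous_kern m n : continuous (kern m n).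
Proof.
apply: fcontinuousM; first exact: continuous_reduced_tail.
exact: continuous_kernel (nat1_neq0 n).
Qed.

Definition square_sum N y : R := \sum_(m < N) \sum_(n < N) lattice_term y m n.

Lemma square_sumE N y : 0 < y -> period_poly y * square_sum N y =
  y ^- 2 * (fun x => \sum_(m < N) \sum_(n < N) kern m n x) y^-1.
Proof.
move=> y0; rewrite /square_sum !mulr_sumr; apply: eq_bigr => m _.
by rewrite !mulr_sumr; apply: eq_bigr => n _; rewrite lattice_termE.
Qed.

Lemma continuous_kern_sum N :
  continuous (fun x => \sum_(m < N) \sum_(n < N) kern m n x).
Proof.
by apply: continuous_sum => m; apply: continuous_sum => n; exact: continuous_kern.
Qed.

(** The sum over a square is invariant under exchange of the two indices. *)
Lemma sum_coboundary_eq0 N : \sum_(m < N) \sum_(n < N) segint 0 1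
  (fun x => coboundary k x * Re (lin n.+1%:R m.+1%:R x ^- (2 * k.+1))) = 0 :> R.
Proof.
set S := LHS.
suff : S + S = 0 by move/eqP; rewrite -mulr2n mulrn_eq0 /= => /eqP.
rewrite {1}/S exchange_big /= -big_split big1// => m _.
rewrite -big_split big1// => n _ /=.
by apply: coboundary_antisym; exact: nat1_neq0.
Qed.

Lemma integral_square_sum N :
  mu.-integrable `[(1 : R)%R, +oo[ (EFin \o (fun y => period_poly y * square_sum N y)) /\
  (\int[mu]_(y in `[(1 : R)%R, +oo[) (period_poly y * square_sum N y))%R =
  beta_half R k * \sum_(m < N) \sum_(n < N) beta_int m n.
Proof.
have [i1 i2] := integral_inv (@continuous_kern_sum N).
have E y : y \in `[(1 : R)%R, +oo[%classic -> y ^- 2 * (fun x => \sum_(m < N) \sum_(n < N) kern m n x) y^-1 =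
    period_poly y * square_sum N y.
  rewrite inE/= in_itv/= andbT => y1; rewrite square_sumE//.
  exact: lt_le_trans y1.
split.
  apply: eq_integrable i1 => // y yD /=; congr _%:E; exact: E.
transitivity (\int[mu]_(y in `[(1 : R)%R, +oo[) (y ^- 2 * (fun x => \sum_(m < N) \sum_(n < N) kern m n x) y^-1))%R.
  by apply: eq_Rintegral => y yD; rewrite -E.
rewrite i2 segint_sum; last by move=> m; apply: continuous_sum => n; exact: continuous_kern.
transitivity (beta_half R k * \sum_(m < N) \sum_(n < N) beta_int m n -
  tail_coef R p k 0 * \sum_(m < N) \sum_(n < N) segint 0 1
    (fun x => coboundary k x * Re (lin n.+1%:R m.+1%:R x ^- (2 * k.+1)))); last first.
  by rewrite sum_coboundary_eq0 mulr0 subr0.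
rewrite !mulr_sumr -sumrB.
apply: eq_bigr => m _; rewrite segint_sum; last by move=> n; exact: continuous_kern.
rewrite !mulr_sumr -sumrB; apply: eq_bigr => n _.
rewrite -(kernel_identity m.+1%:R (nat1_neq0 n) p0 pk).
have ck := @continuous_kernel n.+1%:R m.+1%:R (nat1_neq0 n).
rewrite -segintZ; last exact: (fcontinuousM continuous_coboundary ck).
rewrite -segintN; last by apply: fcontinuousZ; exact: (fcontinuousM continuous_coboundary ck).
rewrite -segintD; last 2 first.
- exact: (fcontinuousM continuous_tail_poly ck).
- apply: fcontinuousN; apply: fcontinuousZ; exact: (fcontinuousM continuous_coboundary ck).
by apply: eq_segint => x _; rewrite /kern /reduced_tail; ring.
Qed.

End SquareSums.

(** * Comparison with inverse squares *)

Section InverseSquares.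
Variable R : realType.

(** Telescoping, as 1 / (m+1)^2 <= 1/m - 1/(m+1). *)
Lemma sum_inv_sq M N : (0 < M)%N ->
  \sum_(M <= m < N) (m.+1%:R ^- 2 : R) <= M%:R^-1.
Proof.
move=> M0; apply: (@le_trans _ _ (\sum_(M <= m < N) (m%:R^-1 - m.+1%:R^-1 : R))).
  apply: ler_sum_nat => m /andP[Mm _]; have m0 : (0 < m)%N by lia.
  have mR : (0 : R) < m%:R by rewrite ltr0n.
  have mR1 : (0 : R) < m.+1%:R by rewrite ltr0n.
  rewrite -subr_ge0 (_ : _ - _ = (m%:R * m.+1%:R ^+ 2)^-1); last first.
    by rewrite -natr1; field; rewrite natr1 !lt0r_neq0.
  by rewrite invr_ge0 mulr_ge0 ?exprn_ge0// ltW.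
have [MN|NM] := leqP M N; last by rewrite big_geq ?invr_ge0// ltnW.
rewrite (GRing.Theory.telescope_sumr_eq (fun m => - (m%:R^-1 : R)))//.
  by rewrite opprK addrC gerBl invr_ge0.
by move=> m _; rewrite opprK addrC.
Qed.

(** The explicit bound for the tails is what gives uniformity in parameters, in
[cvg_square_lattice]. *)
Lemma inv_sq_series (u : nat -> R) C :
  (forall m, `|u m| <= C * m.+1%:R ^- 2) ->
  exists2 l, (fun M => \sum_(m < M) u m) @ \oo --> l &
    forall M, (0 < M)%N -> `|l - \sum_(m < M) u m| <= C / M%:R.
Proof.
move=> uC; have C0 : 0 <= C.
  by have := le_trans (normr_ge0 _) (uC 0%N); rewrite expr1n invr1 mulr1.
have tail M N : (0 < M)%N -> `|\sum_(M <= m < N) u m| <= C / M%:R.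
  move=> M0; apply: le_trans (ler_norm_sum _ _ _) _.
  apply: le_trans (ler_sum _ (fun m _ => uC m)) _.
  by rewrite -mulr_sumr ler_wpM2l// sum_inv_sq.
have cu : cvgn (series u).
  apply/cauchy_cvgP/cauchy_seriesP => e e0.
  have CM : \forall M \near \oo, C / M%:R < e.
    near=> M; rewrite ltr_pdivrMr; last by rewrite ltr0n; near: M; exists 1%N.
    rewrite mulrC -ltr_pdivrMr//.
    near: M; exact: nbhs_infty_gtr.
  case: CM => M1 _ CM1; exists ([set m | (M1.+1 <= m)%N], [set m | (M1.+1 <= m)%N]).
    by split; exists M1.+1.
  move=> [a b] [/= Ma Mb]; apply: le_lt_trans (tail _ _ _) (CM1 a _) => //=; lia.
exists (limn (series u)).
  by move: cu; rewrite /series /=; under eq_fun do rewrite big_mkord.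
move=> M M0; apply: (@cvgr_to_le _ (\oo)%classic _ _ (fun N => `|series u N - \sum_(m < M) u m|)).
  by apply: cvg_norm; apply: cvgB => //; exact: cvg_cst.
near=> N; have MN : (M <= N)%N by near: N; exists M.
rewrite /series /= -(big_mkord xpredT u) (big_cat_nat (leq0n M) MN) /= addrAC subrr add0r.
exact: tail.
Unshelve. all: by end_near. Qed.

End InverseSquares.

(** * The value of a Fourier series by Cesaro means *)

Section Fejer.
Variable R : realType.
Implicit Types (f : R -> R) (t : R) (N k : nat).

Definition dirichlet k t : R :=
  1 + 2 * \sum_(m < k) cos (2 * pi * m.+1%:R * t).
Definition fejer N t : R := \sum_(k < N) dirichlet k t.

Lemma sin_dirichlet k t :
  sin (pi * t) * dirichlet k t = sin ((2 * k).+1%:R * (pi * t)).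
Proof.
elim: k => [|k IH]; first by rewrite /dirichlet big_ord0 mulr0 addr0 mulr1 muln0 mul1r.
have -> : dirichlet k.+1 t = dirichlet k t + 2 * cos (2 * pi * k.+1%:R * t).
  by rewrite /dirichlet big_ord_recr /= mulrDr addrA.
rewrite mulrDr IH; set y := 2 * pi * k.+1%:R * t.
have -> : (2 * k).+1%:R * (pi * t) = y - pi * t :> R.
  by rewrite /y; ring.
have -> : (2 * k.+1).+1%:R * (pi * t) = y + pi * t :> R.
  by rewrite /y; ring.
by rewrite sinB sinD; ring.
Qed.

(** The closed form of the Fejer kernel, from which it is nonnegative and
concentrated at the integers. *)
Lemma sin2_fejer N t : sin (pi * t) ^+ 2 * fejer N t = sin (N%:R * (pi * t)) ^+ 2.
Proof.
elim: N => [|N IH]; first by rewrite /fejer big_ord0 mulr0 mul0r sin0 expr0n.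
rewrite /fejer big_ord_recr /= mulrDr -/(fejer N t) IH expr2 -mulrA sin_dirichlet.
set x := pi * t; set y := N%:R * x.
have -> : (2 * N).+1%:R * x = y + (y + x) by rewrite /y; ring.
have -> : N.+1%:R * x = y + x by rewrite /y; ring.
have -> : sin x = sin (y + x) * cos y - cos (y + x) * sin y.
  by rewrite -sinB addrAC subrr add0r.
rewrite (sinD y (y + x)); move: (cos2Dsin2 y) (cos2Dsin2 (y + x)).
move: (sin y) (cos y) (sin (y + x)) (cos (y + x)) => s c S C h1 h2.
have e1 : c ^+ 2 = 1 - s ^+ 2 by rewrite -h1 addrK.
have e2 : C ^+ 2 = 1 - S ^+ 2 by rewrite -h2 addrK.
transitivity (s ^+ 2 + S ^+ 2 * c ^+ 2 - C ^+ 2 * s ^+ 2); first by ring.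
by rewrite e1 e2; ring.
Qed.

Lemma sin_pi_gt0 t : 0 < t < 1 -> 0 < sin (pi * t).
Proof.
move=> /andP[t0 t1]; apply: sin_gt0_pi.
by rewrite mulr_gt0 ?pi_gt0//= gtr_pMr ?pi_gt0.
Qed.

Lemma two_pi_natE (n : nat) : 2 * pi * n%:R = 0 + pi *+ 2 *+ n :> R.
Proof. by rewrite add0r [2 * pi]mulrC !mulr_natr. Qed.

Lemma cos_2pin (n : nat) : cos (2 * pi * n%:R) = 1 :> R.
Proof.
by rewrite two_pi_natE (periodicn (@cosD2pi R)) cos0.
Qed.

Lemma sin_2pin (n : nat) : sin (2 * pi * n%:R) = 0 :> R.
Proof.
by rewrite two_pi_natE (periodicn (@sinD2pi R)) sin0.
Qed.

Lemma fejer_ge0 N t : 0 <= t <= 1 -> 0 <= fejer N t.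
Proof.
have end_ge0 s : (forall m : nat, cos (2 * pi * m.+1%:R * s) = 1 :> R) -> 0 <= fejer N s.
  move=> c1; apply: sumr_ge0 => k _; rewrite addr_ge0// mulr_ge0//.
  by apply: sumr_ge0 => m _; rewrite c1.
move=> /andP[]; rewrite le_eqVlt => /predU1P[<- _|t0].
  by apply: end_ge0 => m; rewrite mulr0 cos0.
rewrite le_eqVlt => /predU1P[->|t1].
  by apply: end_ge0 => m; rewrite mulr1 cos_2pin.
have s0 : 0 < sin (pi * t) ^+ 2 by rewrite exprn_gt0// sin_pi_gt0// t0.
by rewrite -(pmulr_rge0 _ s0) sin2_fejer sqr_ge0.
Qed.

Lemma continuous_cosZ (c : R) : continuous (fun t => cos (c * t)).
Proof.
move=> t; apply: (@continuous_comp _ _ _ (fun t => c * t) cos).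
  exact: (@fcontinuousZ _ c id (fun x => @cvg_id _ _)).
exact: continuous_cos.
Qed.

Lemma continuous_sinZ (c : R) : continuous (fun t => sin (c * t)).
Proof.
move=> t; apply: (@continuous_comp _ _ _ (fun t => c * t) sin).
  exact: (@fcontinuousZ _ c id (fun x => @cvg_id _ _)).
exact: continuous_sin.
Qed.

Lemma continuous_dirichlet k : continuous (dirichlet k).
Proof.
apply: (@fcontinuousD _ (fun=> 1)); first exact: fcontinuous_cst.
by apply: fcontinuousZ; apply: continuous_sum => m; exact: continuous_cosZ.
Qed.

Lemma continuous_fejer N : continuous (fejer N).
Proof. by apply: continuous_sum => m; exact: continuous_dirichlet. Qed.

Lemma segint_cos n : segint 0 1 (fun t => cos (2 * pi * n.+1%:R * t)) = 0 :> R.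
Proof.
set c := 2 * pi * n.+1%:R.
have c0 : c != 0 by rewrite !mulf_neq0 ?pnatr_eq0// lt0r_neq0// pi_gt0.
have L t : is_derive t 1 (fun t => c * t) c.
  by apply: eq_is_derive (rderiveZ c (rderive_id t)) _; rewrite mulr1.
have dF t : is_derive t 1 (fun t => c^-1 * sin (c * t)) (cos (c * t)).
  apply: eq_is_derive (rderiveZ c^-1 (rderive_comp (is_derive_sin (c * t)) (L t))) _.
  by rewrite mulrCA mulVf// mulr1.
rewrite (segint_FTC ler01 (@continuous_cosZ c) (fun t _ => dF t)).
by rewrite mulr1 mulr0 sin0 /c sin_2pin !mulr0 subrr.
Qed.

Definition fourier_sum f k : R := segint 0 1 f +
  2 * \sum_(m < k) segint 0 1 (fun t => f t * cos (2 * pi * m.+1%:R * t)).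

Lemma fourier_sumE f k : continuous f ->
  fourier_sum f k = segint 0 1 (fun t => f t * dirichlet k t).
Proof.
move=> cf; rewrite /fourier_sum -segint_sum; last first.
  by move=> m; exact: (fcontinuousM cf (@continuous_cosZ _)).
have cs : continuous (fun t => \sum_(m < k) f t * cos (2 * pi * m.+1%:R * t)).
  by apply: continuous_sum => m; exact: (fcontinuousM cf (@continuous_cosZ _)).
rewrite -segintZ// -segintD//; last exact: fcontinuousZ.
by apply: eq_segint => t _; rewrite /dirichlet -mulr_sumr; ring.
Qed.

Lemma sum_fourier_sumE f N : continuous f ->
  \sum_(k < N) fourier_sum f k = segint 0 1 (fun t => f t * fejer N t).
Proof.
move=> cf; under eq_bigr do rewrite fourier_sumE//.
rewrite -segint_sum; last by move=> k; exact: (fcontinuousM cf (@continuous_dirichlet k)).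
by apply: eq_segint => t _; rewrite mulr_sumr.
Qed.

Lemma segint_fejer N : segint 0 1 (fejer N) = N%:R.
Proof.
have := sum_fourier_sumE N (@fcontinuous_cst R 1).
under eq_bigr => k _.
  rewrite /fourier_sum segint_cst// subr0 mulr1 big1; last first.
    move=> m _; rewrite -[RHS](@segint_cos m); apply: eq_segint => t _.
    by rewrite mul1r.
  rewrite mulr0 addr0.
  over.
rewrite sumr_const card_ord => ->.
by apply: eq_segint => t _; rewrite mul1r.
Qed.

(** Near the ends the oscillation of a continuous function is small, and away
from them the sine is bounded below. *)
Lemma oscillation_le f e : continuous f -> f 0 = f 1 -> 0 < e ->
  exists2 K, 0 <= K &
    forall t, 0 <= t <= 1 -> `|f t - f 0| <= e + K * sin (pi * t) ^+ 2.
Proof.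
move=> cf f01 e0.
have near_end c : \forall t \near c, `|f c - f t| < e.
  by have /cvgrPdist_lt := cf c; exact.
have [d d0 H0] : exists2 d : R, 0 < d & forall t, `|t| < d -> `|f 0 - f t| < e.
  have /nbhs_ballP[d /= d0 H] := near_end 0; exists d => // t td; apply: H.
  by rewrite /ball /= sub0r normrN.
have [d' d'0 H1] : exists2 d : R, 0 < d & forall t, `|1 - t| < d -> `|f 1 - f t| < e.
  have /nbhs_ballP[d1 /= d10 H] := near_end 1; exists d1 => // t td; exact: H.
(* At most 1/2, so that [h, 1 - h] is not empty and the sine has a positive minimum
on it. *)
pose h := Num.min (Num.min d d') 2^-1.
have h0 : 0 < h by rewrite !lt_min d0 d'0 invr_gt0 ltr0n.
have hd : h <= d by rewrite !ge_min lexx.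
have hd' : h <= d' by rewrite !ge_min lexx orbT.
have h2 : h <= 2^-1 by rewrite ge_min lexx orbT.
have hh : h <= 1 - h by lra.
have cs : continuous (fun t : R => sin (pi * t) ^+ 2).
  by apply: fcontinuousX; exact: continuous_sinZ.
have [c cI cmin] := @EVT_min R (fun t => sin (pi * t) ^+ 2) _ _ hh (continuous_subspaceT cs).
have [c' _ cmax] := @EVT_max R (fun t => `|f t - f 0|) 0 1 ler01
  (continuous_subspaceT (continuous_normr (fcontinuousB cf (@fcontinuous_cst R (f 0))))).
set s := sin (pi * c) ^+ 2 in cmin; set B := `|f c' - f 0| in cmax.
have B0 : 0 <= B by rewrite /B normr_ge0.
have s0 : 0 < s.
  rewrite exprn_gt0// sin_pi_gt0//; move: cI; rewrite in_itv/=.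
  by move=> /andP[c1 c2]; rewrite (lt_le_trans h0 c1) /= (le_lt_trans c2)// ltrBlDr ltrDl.
exists (B / s); first by rewrite divr_ge0// ltW.
move=> t t01; have Kt0 : 0 <= B / s * sin (pi * t) ^+ 2.
  by rewrite mulr_ge0 ?sqr_ge0// divr_ge0// ltW.
have [th|ht] := ltP t h.
  apply: (@le_trans _ _ e); last by rewrite lerDl.
  by rewrite distrC ltW// H0// ger0_norm; [exact: lt_le_trans th hd|case/andP: t01].
have [ht'|th'] := ltP (1 - h) t.
  apply: (@le_trans _ _ e); last by rewrite lerDl.
  rewrite f01 distrC ltW// H1// ger0_norm; last by case/andP: t01; rewrite subr_ge0.
  by apply: lt_le_trans hd'; rewrite ltrBlDr -ltrBlDl.
apply: (@le_trans _ _ B); first by apply: cmax; rewrite in_itv.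
have st : s <= sin (pi * t) ^+ 2 by apply: cmin; rewrite in_itv /= ht.
rewrite -[leLHS]add0r lerD ?(ltW e0)// -mulrA ler_peMr// mulrC.
by rewrite ler_pdivlMr// mul1r.
Qed.

(** The Cesaro mean at 0 is the integral of f against the normalised Fejer kernel.
Of the two terms in [oscillation_le], the first integrates to e, and the
squared sine cancels the denominator of the kernel. *)
Lemma fejer_mean_dist f e : continuous f -> f 0 = f 1 -> 0 < e ->
  exists2 K, 0 <= K & forall N,
    `|N.+1%:R^-1 * \sum_(k < N.+1) fourier_sum f k - f 0| <= e + K / N.+1%:R.
Proof.
move=> cf f01 e0; have [K K0 HK] := oscillation_le cf f01 e0.
exists K => // N; have n0 : (0 : R) < N.+1%:R by rewrite ltr0n.
have cg := fcontinuousB cf (@fcontinuous_cst R (f 0)).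
have cF := @continuous_fejer N.+1.
have cs : continuous (fun t : R => sin (N.+1%:R * pi * t) ^+ 2).
  by apply: fcontinuousX; exact: continuous_sinZ.
have -> : N.+1%:R^-1 * \sum_(k < N.+1) fourier_sum f k - f 0 =
    N.+1%:R^-1 * segint 0 1 (fun t => (f t - f 0) * fejer N.+1 t).
  rewrite sum_fourier_sumE//.
  have -> : segint 0 1 (fun t => f t * fejer N.+1 t) =
      segint 0 1 (fun t => (f t - f 0) * fejer N.+1 t) + f 0 * N.+1%:R.
    rewrite -segint_fejer -segintZ// -segintD.
    - by apply: eq_segint => t _; ring.
    - exact: (fcontinuousM cg cF).
    - exact: fcontinuousZ.
  by rewrite mulrDr [f 0 * _]mulrC mulKf ?lt0r_neq0// addrK.
rewrite normrM gtr0_norm ?invr_gt0// ler_pdivrMl//.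
apply: le_trans (le_norm_segint _ _ (fcontinuousM cg cF)) _.
apply: (@le_trans _ _ (segint 0 1
    (fun t => e * fejer N.+1 t + K * sin (N.+1%:R * pi * t) ^+ 2))).
  apply: le_segint.
  - exact: continuous_normr (fcontinuousM cg cF).
  - apply: fcontinuousD; exact: fcontinuousZ.
  - move=> t t01; rewrite -mulrA -sin2_fejer normrM [`|fejer _ _|]ger0_norm ?fejer_ge0//.
    by rewrite mulrA -mulrDl ler_wpM2r ?fejer_ge0// HK.
rewrite segintD; [|exact: fcontinuousZ..].
rewrite !segintZ// segint_fejer [leRHS]mulrDr [e * _]mulrC lerD2l mulrCA divff ?lt0r_neq0//.
rewrite mulr1 ler_piMr//.
have E1 : segint 0 1 (fun=> 1) = 1 :> R by rewrite segint_cst// subr0 mulr1.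
rewrite -[leRHS]E1.
apply: le_segint; [exact: cs|exact: fcontinuous_cst|move=> t _].
by rewrite sin2cos2 gerBl sqr_ge0.
Qed.

(** Cesaro means of the Fourier series at 0 tend to f 0 for every continuous periodic
f, and a convergent sequence has the same limit as its Cesaro means. Thus the
value of the series is known as soon as it converges. *)
Theorem fourier_value f S : continuous f -> f 0 = f 1 ->
  fourier_sum f k @[k --> \oo] --> S -> S = f 0.
Proof.
move=> cf f01 /cesaro cS.
rewrite -(cvg_lim (@Rhausdorff R) cS); apply: cvg_lim => //.
apply/cvgrPdist_le => e e0.
have e2 : 0 < e / 2 by rewrite divr_gt0.
have [K K0 HK] := fejer_mean_dist cf f01 e2.
near=> N.
rewrite /arithmetic_mean /= distrC /series /= big_mkord.
apply: le_trans (HK N) _.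
rewrite [leRHS](splitr e) lerD2l ler_pdivrMr ?ltr0n//.
rewrite mulrC -ler_pdivrMr//.
apply: (@le_trans _ _ N%:R); last by rewrite ler_nat.
by near: N; exact: nbhs_infty_ger.
Unshelve. all: by end_near. Qed.

End Fejer.

(** * Lipschitz's formula and Euler's zeta values *)

Section ExpPolynomials.
Variable R : realType.
Variables (x : R) (beta : nat -> R).
Implicit Types (t : R) (k m : nat).

(** An Appell sequence: each member has the preceding one as derivative, and the
numbers [beta] are the values at 0. *)
Definition appell k t : R := \sum_(j < k.+1) beta (k - j) * (t ^+ j / j`!%:R).
Definition fexp k t : R := expR (- x * t) * appell k t.
Definition freq m : R[i] := x%:C + 'i%C * (2 * pi * m%:R)%:C.
(** The Fourier coefficient at m of exp (- x t) [appell k t] on [0, 1]. *)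
Definition fhat k m : R[i] :=
  csegint 0 1 (fun t => cexp (- freq m * t%:C) * (appell k t)%:C).

Lemma is_derive_appell k t : is_derive t 1 (appell k.+1) (appell k t).
Proof.
have -> : appell k.+1 = \sum_(j < k.+2) (fun t => beta (k.+1 - j) * (t ^+ j / j`!%:R)).
  by apply/funext => s; rewrite fct_sumE.
have -> : appell k t = \sum_(j < k.+2)
    beta (k.+1 - j) * (j%:R * t ^+ j.-1 * j`!%:R^-1).
  rewrite [RHS]big_ord_recl /= !mul0r mulr0 add0r; apply: eq_bigr => j _.
  rewrite /bump /= add1n subSS; congr (_ * _).
  have f0 : j`!%:R != 0 :> R by rewrite pnatr_eq0 -lt0n fact_gt0.
  by rewrite factS natrM; field; rewrite f0 nat1r pnatr_eq0.
apply: is_derive_sum => j; apply: rderiveZ.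
apply: eq_is_derive (rderiveM (rderiveXn j t) (rderive_cst _ t)) _.
by rewrite mulr0 addr0.
Qed.

Lemma continuous_appell k : continuous (appell k).
Proof.
apply: continuous_sum => j; apply: fcontinuousZ.
by apply: (@fcontinuousM _ (fun t => t ^+ j)); [exact: fcontinuousXn|exact: fcontinuous_cst].
Qed.

Lemma appell0 k : appell k 0 = beta k.
Proof.
rewrite /appell big_ord_recl /= subn0 expr0 fact0 invr1 !mulr1 big1 ?addr0//.
by move=> j _; rewrite exprS mul0r mul0r mulr0.
Qed.

Lemma Re_freq m : Re (freq m) = x.
Proof. by rewrite /freq /=; ring. Qed.

Lemma Im_freq m : Im (freq m) = 2 * pi * m%:R.
Proof. by rewrite /freq /=; ring. Qed.

Lemma Re_cexp_freq m t :
  Re (cexp (- freq m * t%:C)) = expR (- x * t) * cos (2 * pi * m%:R * t).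
Proof.
have E1 : Re (- freq m * t%:C) = - x * t.
  by rewrite Re_mulc; case: (freq m) (Re_freq m) => a b /= ->; ring.
have E2 : Im (- freq m * t%:C) = - (2 * pi * m%:R * t).
  rewrite Im_mulc; case: (freq m) (Im_freq m) => a b /= ->.
  by rewrite mulr0 add0r mulNr.
by rewrite /cexp Re_realM E1 E2 /= cosN.
Qed.

Lemma cexp_freq1 m : cexp (- freq m * 1) = (expR (- x))%:C.
Proof.
rewrite mulr1; case: (freq m) (Re_freq m) (Im_freq m) => a b /= -> ->.
rewrite /cexp /= cosN sinN cos_2pin sin_2pin oppr0.
by apply: eq_complexP => /=; ring.
Qed.

Lemma ccontinuous_integrand k m :
  ccontinuous (fun t => cexp (- freq m * t%:C) * (appell k t)%:C).
Proof.
have [c1 c2] := cderive_continuous (cderive_cexp (- freq m)).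
have [d1 d2] : ccontinuous (fun t => cexp (- freq m * t%:C)).
  split.
    apply: (@is_derive_continuous _ _ (fun t => Re (- freq m * cexp (- freq m * t%:C)))) => t.
    by case: (cderive_cexp (- freq m) t).
  apply: (@is_derive_continuous _ _ (fun t => Im (- freq m * cexp (- freq m * t%:C)))) => t.
  by case: (cderive_cexp (- freq m) t).
split.
  rewrite (_ : (fun _ => _) = fun t => appell k t * Re (cexp (- freq m * t%:C))).
    exact: (fcontinuousM (@continuous_appell k) d1).
  by apply/funext => t; rewrite mulrC Re_realM.
rewrite (_ : (fun _ => _) = fun t => appell k t * Im (cexp (- freq m * t%:C))).
  exact: (fcontinuousM (@continuous_appell k) d2).
by apply/funext => t; rewrite Im_mulc /=; ring.
Qed.

(** Integration by parts. *)
Lemma fhat_rec k m : (expR (- x) * appell k.+1 1 - beta k.+1)%:C =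
  - freq m * fhat k.+1 m + fhat k m.
Proof.
pose g k t := cexp (- freq m * t%:C) * (appell k t)%:C.
rewrite /fhat -csegintZ; last exact: ccontinuous_integrand.
have cc := ccontinuous_integrand.
have ccZ : ccontinuous (fun t => - freq m * g k.+1 t).
  have [c1 c2] := cc k.+1 m; split.
    rewrite (_ : (fun _ => _) = fun t => Re (- freq m) * Re (g k.+1 t) - Im (- freq m) * Im (g k.+1 t)).
      by apply: fcontinuousB; exact: fcontinuousZ.
    by apply/funext => t; rewrite Re_mulc.
  rewrite (_ : (fun _ => _) = fun t => Re (- freq m) * Im (g k.+1 t) + Im (- freq m) * Re (g k.+1 t)).
    by apply: fcontinuousD; exact: fcontinuousZ.
  by apply/funext => t; rewrite Im_mulc.
rewrite -csegintD//.
have cs : ccontinuous (fun t => - freq m * g k.+1 t + g k t).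
  have [a1 a2] := ccZ; have [b1 b2] := cc k m; split.
    rewrite (_ : (fun _ => _) = fun t => Re (- freq m * g k.+1 t) + Re (g k t)).
      exact: fcontinuousD.
    by apply/funext => t; rewrite Re_addc.
  rewrite (_ : (fun _ => _) = fun t => Im (- freq m * g k.+1 t) + Im (g k t)).
    exact: fcontinuousD.
  by apply/funext => t; rewrite Im_addc.
rewrite (csegint_FTC ler01 cs (F := g k.+1)).
  by rewrite /g cexp_freq1 mulr0 cexp0 mul1r appell0 rcB rcM.
move=> t; apply: eq_cderive (cderiveM (cderive_cexp (- freq m) t)
  (cderive_real (is_derive_appell k t))) _.
by rewrite /g -mulrA.
Qed.

Section Periodic.
Variable delta : R.
Hypothesis beta_step : forall k, expR (- x) * appell k.+2 1 = beta k.+2.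
Hypothesis beta_jump : expR (- x) * appell 1 1 - beta 1 = delta.

Lemma fhatE k m : freq m != 0 -> fhat 0 m = 0 ->
  fhat k.+1 m = (- delta)%:C * freq m ^- k.+1.
Proof.
move=> w0 h0; have := fhat_rec 0 m; rewrite beta_jump h0 addr0 => E.
elim: k => [|k IH].
  by rewrite rcN E expr1 !mulNr opprK mulrC mulKf.
have := fhat_rec k.+1 m; rewrite beta_step subrr IH => /esym/eqP.
rewrite mulNr addrC subr_eq0 => /eqP E2; apply: (mulfI w0).
by rewrite -E2 mulrCA [freq m ^+ k.+2]exprS invfM mulVKf.
Qed.

Lemma fourier_exp_poly k : (forall m, freq m.+1 != 0) ->
  (forall m, fhat 0 m.+1 = 0) ->
  fourier_sum (fexp k.+2) = (fun M => segint 0 1 (fexp k.+2) +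
    2 * \sum_(m < M) (- delta * Re (freq m.+1 ^- k.+2))).
Proof.
move=> w0 h0; apply/funext => M; rewrite /fourier_sum; congr (_ + _ * _).
apply: eq_bigr => m _; rewrite -Re_realM -fhatE//.
transitivity (segint 0 1 (fun t =>
    Re (cexp (- freq m.+1 * t%:C) * (appell k.+2 t)%:C))); last by [].
apply: eq_segint => t _.
by rewrite [cexp _ * _]mulrC Re_realM Re_cexp_freq /fexp; ring.
Qed.

Lemma continuous_fexp k : continuous (fexp k).
Proof.
apply: (@fcontinuousM _ (fun t => expR (- x * t))); last exact: continuous_appell.
move=> t; apply: (@continuous_comp _ _ _ (fun t => - x * t) expR).
  exact: (@fcontinuousZ _ (- x) id (fun x => @cvg_id _ _)).
exact: continuous_expR.
Qed.

(** When the values at 0 and 1 agree from index 2 on and jump by [delta] at index 1,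
repeated integration by parts shows that the Fourier coefficients are the powers
- delta / (x + 2 pi i m)^(k+2); [fourier_value] then sums these powers over m. *)
Lemma exp_poly_value k S : (forall m, freq m.+1 != 0) ->
  (forall m, fhat 0 m.+1 = 0) ->
  (fun M => \sum_(m < M) Re (freq m.+1 ^- k.+2)) @ \oo --> S ->
  segint 0 1 (fexp k.+2) - 2 * delta * S = beta k.+2.
Proof.
move=> w0 h0 cS.
rewrite (@fourier_value R (fexp k.+2) (segint 0 1 (fexp k.+2) - 2 * delta * S)).
- by rewrite /fexp mulr0 expR0 mul1r appell0.
- exact: continuous_fexp.
- by rewrite /fexp mulr0 expR0 mul1r appell0 mulr1 beta_step.
rewrite fourier_exp_poly//.
rewrite (_ : (fun M : nat => _) = fun M => segint 0 1 (fexp k.+2) -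
    (2 * delta) * \sum_(m < M) Re (freq m.+1 ^- k.+2)).
  by apply: cvgB; [exact: cvg_cst|apply: cvgM => //; exact: cvg_cst].
by apply/funext => M; rewrite -mulr_sumr; ring.
Qed.

End Periodic.
End ExpPolynomials.

Section Lipschitz.
Variable R : realType.
Implicit Types (x : R).

(** At [i = 0] and [r = 0] this is 1, since the power 0^0 is 1. *)
Definition lambert_term i x r : R := r%:R ^+ i / i`!%:R * expR (- x * r%:R).
Definition lambert i x : R := limn (fun M => \sum_(r < M) lambert_term i x r).

Lemma fact_neq0 n : n`!%:R != 0 :> R.
Proof. by rewrite pnatr_eq0 -lt0n fact_gt0. Qed.

Lemma lambert_term_ge0 i x r : 0 <= lambert_term i x r.
Proof. by rewrite mulr_ge0 ?expR_ge0// divr_ge0 ?exprn_ge0. Qed.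

Lemma cvg_lambert i x : 0 < x ->
  (fun M => \sum_(r < M) lambert_term i x r) @ \oo --> lambert i x.
Proof.
(* From exp u >= u^(i+2) / (i+2)!, the smallest power that leaves 1 / r^2. *)
move=> x0; pose C := expR x * (i.+2)`!%:R / x ^+ i.+2.
have [|l cl _] := @inv_sq_series R (lambert_term i x) C; last first.
  by apply/cvg_ex; exists l.
move=> r; rewrite ger0_norm ?lambert_term_ge0// /lambert_term.
have r0 : (0 : R) < r.+1%:R by rewrite ltr0n.
have xr : 0 < x * r.+1%:R by rewrite mulr_gt0.
have -> : expR (- x * r%:R) = expR x / expR (x * r.+1%:R).
  by rewrite -expRB; congr expR; rewrite -natr1; ring.
have E : (x * r.+1%:R) ^+ i.+2 / (i.+2)`!%:R <= expR (x * r.+1%:R).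
  by apply: le_trans (expR_ge1Dxn i.+1 (ltW xr)); rewrite lerDr.
apply: (@le_trans _ _ (r.+1%:R ^+ i * (expR x / ((x * r.+1%:R) ^+ i.+2 / (i.+2)`!%:R)))).
  apply: ler_pM; rewrite ?divr_ge0 ?expR_ge0 ?exprn_ge0//.
  - apply: (@le_trans _ _ (r%:R ^+ i)).
      by rewrite ler_piMr ?exprn_ge0// invf_le1 ?ler1n ?ltr0n fact_gt0.
    by apply: lerXn2r; rewrite ?nnegrE// ler_nat.
  - rewrite ler_wpM2l ?expR_ge0// lef_pV2 ?posrE ?expR_gt0// divr_gt0 ?exprn_gt0//.
rewrite le_eqVlt; apply/orP; left; apply/eqP; rewrite /C exprMn.
have h1 := fact_neq0 i.+2; have h2 := expf_neq0 i.+2 (lt0r_neq0 x0).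
have h3 := lt0r_neq0 r0; have h4 := expf_neq0 i h3.
rewrite (exprD r.+1%:R 2 i : r.+1%:R ^+ i.+2 = _).
move: h1 h2 h3 h4; move: (x ^+ i.+2) ((r.+1%:R : R) ^+ i) ((i.+2)`!%:R : R) (r.+1%:R : R) => u v w z h1 h2 h3 h4.
by field; rewrite h1 h2 h3 h4.
Qed.

(** The shift of r by 1, with (r + 1)^i expanded by the binomial formula; the
exceptional term at [i = 0] is the one with r = 0. *)
Lemma lambert_step i x : 0 < x ->
  expR (- x) * \sum_(j < i.+1) lambert (i - j) x / j`!%:R = lambert i x - (i == 0)%N%:R.
Proof.
move=> x0.
pose L i M := \sum_(r < M) lambert_term i x r.
have EM M : expR (- x) * \sum_(j < i.+1) L (i - j)%N M / j`!%:R =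
    L i M.+1 - (i == 0)%N%:R.
  have -> : L i M.+1 = (i == 0)%N%:R + \sum_(r < M) lambert_term i x r.+1.
    rewrite /L big_ord_recl; congr (_ + _).
    rewrite /lambert_term mulr0 expR0 mulr1; case: (i) => [|n].
      by rewrite expr0 fact0 divr1.
    by rewrite exprS !mul0r.
  rewrite addrAC subrr add0r mulr_sumr.
  transitivity (\sum_(j < i.+1) \sum_(r < M)
      expR (- x) * (lambert_term (i - j) x r / j`!%:R)).
    by apply: eq_bigr => j _; rewrite mulr_suml mulr_sumr.
  rewrite exchange_big /=; apply: eq_bigr => r _.
  rewrite /lambert_term -[r.+1%:R]natr1 mulrDr mulr1 expRD exprDn !mulr_suml.
  apply: eq_bigr => j _; rewrite expr1n mulr1 -mulr_natr.
  have ji : (j <= i)%N by rewrite -ltnS.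
  have := bin_fact ji => /(congr1 (fun n => n%:R : R)); rewrite !natrM => <-.
  have h1 := fact_neq0 j; have h2 := fact_neq0 (i - j).
  have h3 : 'C(i, j)%:R != 0 :> R by rewrite pnatr_eq0 -lt0n bin_gt0.
  by field; rewrite h1 h2 h3.
have c1 : (fun M => expR (- x) * \sum_(j < i.+1) L (i - j)%N M / j`!%:R) @ \oo -->
    expR (- x) * \sum_(j < i.+1) lambert (i - j) x / j`!%:R.
  apply: cvgM; first exact: cvg_cst.
  apply: cvg_big => [|j _]; first exact: add_continuous.
  by apply: cvgM; [exact: cvg_lambert|exact: cvg_cst].
have c2 : (fun M => L i M.+1 - (i == 0)%N%:R) @ \oo --> lambert i x - (i == 0)%N%:R.
  apply: cvgB; last exact: cvg_cst.
  by have := @cvg_lambert i x x0; rewrite -(cvg_shiftS (L i)).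
rewrite -(cvg_lim (@Rhausdorff R) c1); apply: cvg_lim => //.
by rewrite (funext EM).
Qed.

Let lambert_coef x i : R := if i is i'.+1 then lambert i' x else 0.

Lemma norm_freq_le x m l : (0 < l)%N ->
  `|Re (freq x m.+1 ^- (2 * l))| <= 1 * m.+1%:R ^- 2.
Proof.
move=> l0; have m0 : (0 : R) < m.+1%:R by rewrite ltr0n.
have pi1 : 1 <= 2 * pi :> R.
  by have := pi_ge2 R; lra.
have N1 : m.+1%:R ^+ 2 <= normsq (freq x m.+1).
  rewrite /normsq Re_freq Im_freq; apply: (@le_trans _ _ ((2 * pi * m.+1%:R) ^+ 2)).
    apply: lerXn2r; rewrite ?nnegrE ?mulr_ge0 ?pi_ge0// ?(ltW m0)//.
    by apply: ler_peMl => //; exact: ltW.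
  by rewrite lerDr sqr_ge0.
have m1 : 1 <= m.+1%:R ^+ 2 :> R by rewrite exprn_ege1// ler1n.
have w0 : freq x m.+1 != 0.
  apply/negP => /eqP w0; have := lt_le_trans (lt_le_trans ltr01 m1) N1.
  by rewrite w0 /normsq /= expr0n /= addr0 ltxx.
apply: le_trans (le_norm_Re_expV l w0) _; rewrite mul1r.
have N0 : 0 < normsq (freq x m.+1).
  by exact: (lt_le_trans (lt_le_trans ltr01 m1) N1).
rewrite lef_pV2 ?posrE ?exprn_gt0//; apply: (le_trans N1).
rewrite -[leLHS]expr1; apply: ler_weXn2l => //.
exact: le_trans m1 N1.
Qed.

Lemma freq_neq0 x m : x != 0 \/ (0 < m)%N -> freq x m != 0.
Proof.
move=> h; apply/eqP => w0; have := congr1 (@complex.Re R) w0; have := congr1 (@complex.Im R) w0.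
rewrite Re_freq Im_freq /= => /eqP; rewrite !mulf_eq0 !pnatr_eq0 /= gt_eqF ?pi_gt0//=.
by case: h => [/negP x0 _ /eqP //|m0 /eqP m00]; rewrite m00 in m0.
Qed.

(** With the values of [lambert] as [beta], exp (- x t) [appell (2 l) t] is the sum
over r >= 0 of exp (- x (r + t)) (r + t)^(2l-1) / (2l-1)!. It is a periodisation,
whose Fourier coefficients are the (x + 2 pi i m)^(-2l). *)
Theorem lipschitz x l : 0 < x -> (0 < l)%N ->
  (fun M => \sum_(m < M) Re (freq x m.+1 ^- (2 * l))) @ \oo -->
  (lambert (2 * l - 1) x - x ^- (2 * l)) / 2.
Proof.
move=> x0 l0.
have [k kE] : exists k, (2 * l = k.+2)%N by exists (2 * l - 2)%N; lia.
have k1E : (2 * l - 1 = k.+1)%N by rewrite kE subn1.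
have [S cS _] := inv_sq_series (fun m => norm_freq_le x m l0).
suff -> : (lambert (2 * l - 1) x - x ^- (2 * l)) / 2 = S by [].
have step n : expR (- x) * appell (lambert_coef x) n.+2 1 = lambert_coef x n.+2.
  rewrite /appell big_ord_recr /= subnn mul0r addr0 -[RHS]subr0 -(@lambert_step n.+1 x x0).
  congr (_ * _); apply: eq_bigr => j _; rewrite expr1n mul1r.
  by rewrite subSn// -ltnS.
have jump : expR (- x) * appell (lambert_coef x) 1 1 - lambert_coef x 1 = - 1.
  have := @lambert_step 0 x x0; rewrite big_ord1 /= => E.
  rewrite /appell big_ord_recr big_ord1 /= mul0r addr0 expr0 mul1r.
  by rewrite E addrAC subrr add0r.
have h0 m : fhat x (lambert_coef x) 0 m = 0.
  have z0 : segint 0 1 (fun=> 0 : R) = 0 by rewrite segint_cst// mul0r.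
  rewrite /fhat (@eq_csegint _ _ (fun=> 0)) => [|t _]; first by rewrite /csegint /= z0.
  by rewrite /appell big_ord1 /= mul0r mulr0.
have w0 m : freq x m != 0 by apply: freq_neq0; left; rewrite gt_eqF.
have := exp_poly_value (k := k) step jump (fun m => w0 m.+1) (fun m => h0 m.+1).
move=> /(_ S); rewrite -kE => /(_ cS) E.
(* This is the Fourier coefficient at 0. *)
have I : segint 0 1 (fexp x (lambert_coef x) (2 * l)) = x ^- (2 * l).
  have := fhatE step jump k.+1 (w0 0%N) (h0 0%N) => /(congr1 (@complex.Re R)).
  rewrite Re_realM opprK mul1r -kE => H.
  transitivity (Re (freq x 0 ^- (2 * l))).
    rewrite -H; apply: eq_segint => t _.
    by rewrite [cexp _ * _]mulrC Re_realM Re_cexp_freq mulr0 mul0r cos0 mulr1 mulrC.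
  by rewrite /freq mulr0 mulr0 addr0 -rcX -rcV.
have lE : lambert_coef x (2 * l) = lambert k.+1 x by rewrite kE.
have ES (s t u : R) : s - 2 * -1 * t = u -> (u - s) / 2 = t by move=> <-; field.
by rewrite k1E; apply: ES; rewrite -lE -E I.
Qed.

End Lipschitz.

Section Euler.
Variable R : realType.

Let bernoulli_coef i : R := ratr (bernoulli_num i) / i`!%:R.

Lemma bernoulli_coef_rec n : \sum_(j < n.+1) bernoulli_coef (n - j) / j.+1`!%:R = (n == 0)%N%:R.
Proof.
have f0 := fact_neq0 R n.+1; apply: (mulfI f0).
transitivity (ratr (\sum_(k < n.+1) 'C(n.+1, k)%:R * bernoulli_num k) : R); last first.
  by rewrite bernoulli_num_rec ratr_nat; case: n {f0} => [|n] /=; rewrite ?mulr0 ?mulr1.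
rewrite raddf_sum mulr_sumr (reindex_inj rev_ord_inj); apply: eq_bigr => j _ /=.
have jn : (j <= n)%N by rewrite -ltnS.
rewrite subSS subKn// rmorphM /= ratr_nat /bernoulli_coef.
have -> : (n - j).+1 = (n.+1 - j)%N by rewrite subSn.
have := bin_fact (leqW jn) => /(congr1 (fun n => n%:R : R)); rewrite !natrM => <-.
have h1 := fact_neq0 R j; have h2 := fact_neq0 R (n.+1 - j).
by field; rewrite h1 h2.
Qed.

(** The same computation at x = 0, with the Bernoulli polynomials, divided by
factorials, as Appell sequence. *)
Theorem euler_zeta l : (0 < l)%N ->
  (fun M => \sum_(m < M) (m.+1%:R ^- (2 * l) : R)) @ \oo -->
  - (-1) ^+ l * (2 * pi) ^+ (2 * l) / (2 * (2 * l)`!%:R) *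
    ratr (bernoulli_num (2 * l)).
Proof.
move=> l0.
have [k kE] : exists k, (2 * l = k.+2)%N by exists (2 * l - 2)%N; lia.
have step n : expR (- 0) * appell bernoulli_coef n.+2 1 = bernoulli_coef n.+2.
  rewrite oppr0 expR0 mul1r /appell big_ord_recl /= subn0 expr0 fact0 invr1 !mulr1.
  rewrite -[RHS]addr0; congr (_ + _); rewrite -[RHS](bernoulli_coef_rec n.+1).
  by apply: eq_bigr => j _; rewrite expr1n mul1r /bump add1n subSS.
have jump : expR (- 0) * appell bernoulli_coef 1 1 - bernoulli_coef 1 = 1.
  rewrite oppr0 expR0 mul1r /appell big_ord_recl /= subn0 expr0 fact0 invr1 !mulr1.
  rewrite addrAC subrr add0r -[RHS](bernoulli_coef_rec 0) !big_ord1 /= expr1n mul1r.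
  by [].
have w0 m : freq (0 : R) m.+1 != 0 by apply: freq_neq0; right.
have h0 m : fhat 0 bernoulli_coef 0 m.+1 = 0.
  have cc : ccontinuous (fun t => cexp (- freq (0 : R) m.+1 * t%:C)).
    split.
      apply: (@is_derive_continuous _ _ (fun t => Re (- freq (0 : R) m.+1 * cexp (- freq (0 : R) m.+1 * t%:C)))) => t.
      by case: (cderive_cexp (- freq 0 m.+1) t).
    apply: (@is_derive_continuous _ _ (fun t => Im (- freq (0 : R) m.+1 * cexp (- freq (0 : R) m.+1 * t%:C)))) => t.
    by case: (cderive_cexp (- freq 0 m.+1) t).
  have w1 : - freq (0 : R) m.+1 != 0 by rewrite oppr_eq0.
  rewrite /fhat (@eq_csegint _ _ (fun t => (bernoulli_coef 0)%:C * cexp (- freq 0 m.+1 * t%:C))); last first.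
    by move=> t _; rewrite /appell big_ord1 /= expr0 fact0 invr1 !mulr1 mulrC.
  rewrite csegintZ// (@csegint_FTC _ (fun t => (- freq 0 m.+1)^-1 * cexp (- freq 0 m.+1 * t%:C)) _ 0 1)//; last first.
    by move=> t; apply: eq_cderive (cderiveZ _ (cderive_cexp (- freq 0 m.+1) t)) _; rewrite mulKf.
  by rewrite cexp_freq1 mulr0 cexp0 oppr0 expR0 subrr mulr0.
have freqE m : Re (freq (0 : R) m.+1 ^- (2 * l)) =
    (-1) ^+ l / (2 * pi) ^+ (2 * l) * m.+1%:R ^- (2 * l).
  have -> : freq (0 : R) m.+1 ^- (2 * l) = ((-1) ^+ l / (2 * pi * m.+1%:R) ^+ (2 * l))%:C.
    rewrite /freq add0r exprMn exprM sqr_i !rcE invfM; congr (_ * _).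
    by rewrite -[LHS]exprVn invrN1.
  by rewrite /= exprMn invfM mulrA.
have [S cS _] := inv_sq_series (fun m => @norm_freq_le R 0 m l l0).
have := exp_poly_value (k := k) step jump w0 h0.
move=> /(_ S); rewrite -kE => /(_ cS).
have -> : segint 0 1 (fexp 0 bernoulli_coef (2 * l)) = 0.
  have D (t : R) : is_derive t 1 (appell bernoulli_coef k.+3) (fexp 0 bernoulli_coef k.+2 t).
    by rewrite /fexp oppr0 mul0r expR0 mul1r; exact: is_derive_appell.
  rewrite kE (segint_FTC ler01 (@continuous_fexp R 0 bernoulli_coef k.+2) (fun t _ => D t)) appell0.
  by have := step k.+1; rewrite oppr0 expR0 mul1r => ->; rewrite subrr.
move=> E; set c := (-1) ^+ l / (2 * pi) ^+ (2 * l) in freqE.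
have p0 : (2 * pi) ^+ (2 * l) != 0 :> R.
  by rewrite expf_neq0// mulf_neq0 ?pnatr_eq0// gt_eqF ?pi_gt0.
have c0 : c != 0 by rewrite mulf_neq0 ?signr_eq0// invr_neq0.
have -> : (fun M => \sum_(m < M) (m.+1%:R ^- (2 * l) : R)) =
    (fun M => c^-1 * \sum_(m < M) Re (freq (0 : R) m.+1 ^- (2 * l))).
  apply/funext => M; rewrite mulr_sumr; apply: eq_bigr => m _.
  by rewrite freqE mulKf.
have SE : S = - bernoulli_coef (2 * l) / 2.
  have ES (s u : R) : 0 - 2 * 1 * s = u -> s = - u / 2 by move=> <-; field.
  exact: ES.
rewrite [X in _ --> X](_ : _ = c^-1 * S); last first.
  rewrite SE /bernoulli_coef /c; have h1 := fact_neq0 R (2 * l).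
  have := signr_eq0 R l; have : (-1) ^+ l * (-1) ^+ l = 1 :> R by rewrite -expr2 sqrr_sign.
  move: p0 h1; move: ((2 * pi) ^+ (2 * l)) ((2 * l)`!%:R : R) (ratr _) ((-1) ^+ l : R).
  by move=> u v b s u0 v0 ss s0; field: ss; rewrite u0 v0 s0.
by apply: cvgM => //; exact: cvg_cst.
Qed.

End Euler.

(** * Lattice sums over a quadrant *)

Section SumOverM.
Variable R : realType.
Variable l : nat.
Hypothesis l2 : (1 < l)%N.
Implicit Types (c y : R) (m n : nat).

(** The sum over m >= 1 of Re (c + i m)^(-2l), according to Lipschitz's formula. *)
Definition row_sum c : R :=
  ((2 * pi) ^+ (2 * l) * lambert (2 * l - 1) (2 * pi * c) - c ^- (2 * l)) / 2.

Let twopi_gt0 : 0 < 2 * pi :> R.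
Proof. by rewrite mulr_gt0 ?pi_gt0. Qed.

Lemma cvg_row_sum c : 0 < c ->
  (fun M => \sum_(m < M) Re (lin c m.+1%:R 1 ^- (2 * l))) @ \oo --> row_sum c.
Proof.
move=> c0; have x0 : 0 < 2 * pi * c by rewrite mulr_gt0.
have l0 : (0 < l)%N by exact: ltnW.
have L := lipschitz x0 l0; set a := (2 * pi) ^+ (2 * l) : R.
have a0 : a != 0 by rewrite expf_neq0// gt_eqF.
have E m : Re (lin c m.+1%:R 1 ^- (2 * l)) =
    a * Re (freq (2 * pi * c) m.+1 ^- (2 * l)).
  have -> : freq (2 * pi * c) m.+1 = (2 * pi)%:C * lin c m.+1%:R 1.
    apply: eq_complexP; rewrite ?Re_freq ?Im_freq ?Re_realM ?Im_mulc ?Re_lin ?Im_lin//.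
    by move: (2 * pi) => u /=; ring.
  by rewrite exprMn invfM -rcX -rcV Re_realM mulrA divff// mul1r.
rewrite (_ : (fun M : nat => _) = (fun M => a *
    \sum_(m < M) Re (freq (2 * pi * c) m.+1 ^- (2 * l)))); last first.
  by apply/funext => M; rewrite mulr_sumr; apply: eq_bigr => m _; rewrite E.
rewrite (_ : row_sum c = a * ((lambert (2 * l - 1) (2 * pi * c) - (2 * pi * c) ^- (2 * l)) / 2)).
  by apply: cvgM => //; exact: cvg_cst.
rewrite /row_sum -/a exprMn -/a; have := expf_neq0 (2 * l) (lt0r_neq0 c0).
by move: (c ^+ (2 * l)) => u u0; field; rewrite u0 a0.
Qed.

Lemma norm_lattice_le c m : 0 < c ->
  `|Re (lin c m.+1%:R 1 ^- (2 * l))| <= (c ^+ 2 + m.+1%:R ^+ 2) ^- l.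
Proof.
move=> c0; have := le_norm_Re_expV l (lin_neq0 m.+1%:R 1 (lt0r_neq0 c0)).
by rewrite normsq_lin expr1n mulr1.
Qed.

(** By (c^2 + m^2)^2 >= c^2 m^2; the two variables are separated so that both sums
converge. *)
Lemma norm_lattice_le_prod c m : 1 <= c ->
  `|Re (lin c m.+1%:R 1 ^- (2 * l))| <= c ^- 2 * m.+1%:R ^- 2.
Proof.
move=> c1; have c0 := lt_le_trans ltr01 c1; apply: le_trans (norm_lattice_le m c0) _.
have c2 : 1 <= c ^+ 2 by rewrite exprn_ege1.
have m2 : 1 <= m.+1%:R ^+ 2 :> R by rewrite exprn_ege1// ler1n.
have s0 : 0 < c ^+ 2 + m.+1%:R ^+ 2 by apply: addr_gt0; exact: lt_le_trans ltr01 _.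
have p0 : 0 < c ^+ 2 * m.+1%:R ^+ 2 by apply: mulr_gt0; exact: lt_le_trans ltr01 _.
rewrite -invfM lef_pV2 ?posrE ?exprn_gt0//.
apply: (@le_trans _ _ ((c ^+ 2 + m.+1%:R ^+ 2) ^+ 2)); last first.
  by apply: ler_weXn2l => //; rewrite (le_trans c2)// lerDl (le_trans ler01).
have := sqr_ge0 (c ^+ 2); have := sqr_ge0 (m.+1%:R ^+ 2 : R).
by rewrite sqrrD; move: p0; move: (c ^+ 2) (m.+1%:R ^+ 2) => u v; rewrite mulr2n; lra.
Qed.

Lemma row_sum_tail c M : 1 <= c -> (0 < M)%N ->
  `|row_sum c - \sum_(m < M) Re (lin c m.+1%:R 1 ^- (2 * l))| <= c ^- 2 / M%:R.
Proof.
move=> c1 M0; have [s cs H] := inv_sq_series (fun m => norm_lattice_le_prod m c1).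
have := cvg_row_sum (lt_le_trans ltr01 c1).
move=> /(cvg_lim (@Rhausdorff R)) <-; rewrite (cvg_lim (@Rhausdorff R) cs).
exact: H.
Qed.

Lemma norm_row_sum_le c : 1 <= c -> `|row_sum c| <= 2 * c ^- 2.
Proof.
move=> c1; have := row_sum_tail c1 (ltn0Sn 0); rewrite big_ord1 divr1 => h1.
have := norm_lattice_le_prod 0 c1; rewrite expr1n invr1 mulr1 => h2.
rewrite -[row_sum c](subrK (Re (lin c 1%:R 1 ^- (2 * l)))).
by apply: le_trans (ler_normD _ _) _; rewrite mulr_natl mulr2n lerD.
Qed.

Lemma inv_sqr_le (y : R) n : 1 <= y -> (n.+1%:R * y) ^- 2 <= n.+1%:R ^- 2.
Proof.
move=> y1; have n0 : (0 : R) < n.+1%:R by rewrite ltr0n.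
have y0 := lt_le_trans ltr01 y1.
have ny : n.+1%:R <= n.+1%:R * y by rewrite ler_peMr// ltW.
rewrite lef_pV2 ?posrE ?exprn_gt0 ?mulr_gt0//.
by apply: lerXn2r => //; rewrite nnegrE ltW// mulr_gt0.
Qed.

Lemma natM_ge1 (y : R) n : 1 <= y -> 1 <= n.+1%:R * y.
Proof. by move=> y1; rewrite -[leLHS]mulr1 ler_pM// ler1n. Qed.

Definition lattice_sum y : R := limn (fun N => \sum_(n < N) row_sum (n.+1%:R * y)).

Lemma cvg_lattice_sum y : 1 <= y ->
  (fun N => \sum_(n < N) row_sum (n.+1%:R * y)) @ \oo --> lattice_sum y.
Proof.
move=> y1; have [|s cs _] := @inv_sq_series R (fun n => row_sum (n.+1%:R * y)) 2.
  move=> n; apply: le_trans (norm_row_sum_le (natM_ge1 n y1)) _.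
  by rewrite ler_pM2l ?inv_sqr_le.
by apply/cvg_ex; exists s.
Qed.

(** Square truncations reach the iterated sum because the rows converge
uniformly fast. *)
Lemma cvg_square_lattice y : 1 <= y ->
  (fun N => \sum_(m < N) \sum_(n < N) Re (lin (n.+1%:R * y) m.+1%:R 1 ^- (2 * l)))
    @ \oo --> lattice_sum y.
Proof.
move=> y1; pose T N n := \sum_(m < N) Re (lin (n.+1%:R * y) m.+1%:R 1 ^- (2 * l)).
rewrite (_ : (fun N : nat => _) = (fun N => \sum_(n < N) row_sum (n.+1%:R * y) -
    \sum_(n < N) (row_sum (n.+1%:R * y) - T N n))); last first.
  by apply/funext => N; rewrite exchange_big /= sumrB opprB addrC subrK.
rewrite -[lattice_sum y]subr0; apply: cvgB; first exact: cvg_lattice_sum.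
apply/cvgrPdist_le => e e0; near=> N; rewrite sub0r normrN.
have N0 : (0 < N)%N by near: N; exists 1%N.
apply: le_trans (ler_norm_sum _ _ _) _.
apply: (@le_trans _ _ (\sum_(n < N) (n.+1%:R ^- 2 * N%:R^-1))).
  apply: ler_sum => n _; apply: le_trans (row_sum_tail (natM_ge1 n y1) N0) _.
  by rewrite ler_wpM2r ?invr_ge0// inv_sqr_le.
rewrite -mulr_suml; apply: (@le_trans _ _ (2 * N%:R^-1)).
  rewrite ler_wpM2r ?invr_ge0//; case: (N) N0 => // N' _.
  rewrite big_ord_recl expr1n invr1 (_ : 2 = 1 + 1)// lerD2l.
  have := @sum_inv_sq R 1 N'.+1 isT; rewrite invr1.
  by rewrite big_add1 /= big_mkord.
rewrite ler_pdivrMr ?ltr0n// mulrC -ler_pdivrMr//.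
by near: N; exact: nbhs_infty_ger.
Unshelve. all: by end_near. Qed.

End SumOverM.

Section DominatedLimit.
Variable R : realType.
Notation mu := (@lebesgue_measure R).
Variables (p k : nat).
Hypotheses (p0 : (0 < p)%N) (pk : (p <= k)%N).

Let k0 : (0 < k)%N. Proof. exact: leq_trans pk. Qed.

(** Comparison with the telescoping terms 2 / ((c + m) (c + m + 1)). The factor 1/c
is the gain in decay that [norm_square_sum_le] needs. *)
Lemma sum_inv_quadratic (c : R) M : 0 < c ->
  \sum_(m < M) (c ^+ 2 + m.+1%:R ^+ 2)^-1 <= 2 / c.
Proof.
move=> c0; apply: (@le_trans _ _ (\sum_(0 <= m < M)
    (2 * (- (c + m.+1%:R)^-1 - - (c + m%:R)^-1)))).
  rewrite big_mkord; apply: ler_sum => m _.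
  have m0 : (0 : R) <= m%:R by [].
  set u : R := c + m%:R; have u0 : 0 < u by rewrite ltr_wpDr.
  have -> : c + m.+1%:R = u + 1 by rewrite /u -natr1 addrA.
  have -> : 2 * (- (u + 1)^-1 - - u^-1) = (2^-1 * (u * (u + 1)))^-1.
    by field; rewrite !lt0r_neq0// addr_gt0.
  have q0 : 0 < c ^+ 2 + m.+1%:R ^+ 2.
    by rewrite addr_gt0 ?exprn_gt0.
  have u1 : 0 < u + 1 by rewrite addr_gt0.
  have h0 : 0 < 2^-1 * (u * (u + 1)) by rewrite mulr_gt0 ?mulr_gt0 ?invr_gt0.
  rewrite lef_pV2 ?posrE//.
  have := sqr_ge0 (c - m.+1%:R); rewrite /u -natr1; nra.
rewrite -mulr_sumr GRing.Theory.telescope_sumr//= addr0 opprK.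
by rewrite ler_wpM2l// gerDr oppr_le0 invr_ge0 addr_ge0// ltW.
Qed.

(** Bounding one factor 1 / (c^2 + m^2) by 1 / m^2 would give no more than y^(-2k):
the additional factor 1/y comes from [sum_inv_quadratic]. Without it the product
with [period_poly], of size y^(2k-1), would not be integrable. *)
Lemma norm_square_sum_le N (y : R) : 1 <= y ->
  `|square_sum k N y| <= 4 * y ^- (2 * k).+1.
Proof.
move=> y1; have y0 := lt_le_trans ltr01 y1.
apply: (@le_trans _ _ (\sum_(n < N) (2 * y ^- (2 * k).+1) * n.+1%:R ^- 2)).
  rewrite /square_sum exchange_big /=; apply: le_trans (ler_norm_sum _ _ _) _.
  apply: ler_sum => n _; apply: le_trans (ler_norm_sum _ _ _) _.
  set c : R := n.+1%:R * y; have c0 : 0 < c by rewrite mulr_gt0.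
  apply: (@le_trans _ _ (c ^- (2 * k) * (2 / c))); last first.
    have n1 : 1 <= n.+1%:R :> R by rewrite ler1n.
    have -> : c ^- (2 * k) * (2 / c) = (2 * y ^- (2 * k).+1) * n.+1%:R ^- (2 * k).+1.
      rewrite /c !exprS exprMn; have := lt0r_neq0 y0.
      have := expf_neq0 (2 * k) (lt0r_neq0 y0).
      have := expf_neq0 (2 * k) (nat1_neq0 R n); have := nat1_neq0 R n.
      move: ((n.+1%:R : R) ^+ (2 * k)) (n.+1%:R : R) (y ^+ (2 * k)) => a b d b0 a0 d0 yn0.
      by field; rewrite a0 b0 d0 yn0.
    rewrite ler_wpM2l ?mulr_ge0 ?invr_ge0 ?exprn_ge0 ?(ltW y0)//.
    rewrite lef_pV2 ?posrE ?exprn_gt0// ler_weXn2l//; lia.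
  apply: le_trans (ler_wpM2l _ (sum_inv_quadratic N c0)); last first.
    by rewrite invr_ge0 exprn_ge0 ?ltW.
  rewrite mulr_sumr; apply: ler_sum => m _.
  apply: le_trans (norm_lattice_le k.+1 m c0) _.
  have q0 : 0 < c ^+ 2 + m.+1%:R ^+ 2 by rewrite addr_gt0 ?exprn_gt0.
  rewrite exprSr invfM ler_wpM2r ?invr_ge0 ?(ltW q0)//.
  rewrite exprM lef_pV2 ?posrE ?exprn_gt0 ?exprn_gt0//.
  apply: lerXn2r; rewrite ?nnegrE ?exprn_ge0 ?(ltW q0) ?(ltW c0)//.
  by rewrite lerDl exprn_ge0.
rewrite -mulr_sumr; apply: (@le_trans _ _ ((2 * y ^- (2 * k).+1) * 2)); last first.
  by rewrite mulrAC -natrM.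
rewrite ler_wpM2l ?mulr_ge0 ?invr_ge0 ?exprn_ge0 ?(ltW y0)//.
case: N => [|N]; first by rewrite big_ord0.
rewrite big_ord_recl expr1n invr1 (_ : 2 = 1 + 1)// lerD2l.
have := @sum_inv_sq R 1 N.+1 isT; rewrite invr1.
by rewrite big_add1 /= big_mkord.
Qed.

Lemma norm_square_integrand_le : exists C : R, forall N y, 1 <= y ->
  `|period_poly p k y * square_sum k N y| <= C * y ^- 2.
Proof.
have [C C0 HC] := reduced_tail_le R p0 pk; exists (4 * C) => N y y1.
have y0 := lt_le_trans ltr01 y1.
have y01 : 0 <= y^-1 <= 1 by rewrite invr_ge0 ltW//= invf_le1.
rewrite normrM /period_poly normrM ger0_norm ?exprn_ge0 ?(ltW y0)//.
apply: (@le_trans _ _ ((y ^+ (2 * k) * (C * y^-1)) * (4 * y ^- (2 * k).+1))).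
  by rewrite ler_pM ?mulr_ge0 ?exprn_ge0 ?(ltW y0)// ?norm_square_sum_le// ler_wpM2l ?exprn_ge0 ?(ltW y0)// HC.
rewrite le_eqVlt; apply/orP; left; apply/eqP; rewrite exprS.
have := expf_neq0 (2 * k) (lt0r_neq0 y0); have := lt0r_neq0 y0.
by move: (y ^+ (2 * k)) => u yn0 u0; field; rewrite u0 yn0.
Qed.

(** For each N the integral of the square partial sum is known exactly, by
[integral_square_sum]; dominated convergence passes to the limit. *)
Lemma square_sums_limit :
  mu.-integrable `[(1 : R)%R, +oo[
    (EFin \o (fun y => period_poly p k y * lattice_sum k.+1 y)) /\
  (fun N => \sum_(m < N) \sum_(n < N) beta_int R p k m n) @ \oo -->
    (beta_half R k)^-1 * (\int[mu]_(y in `[(1 : R)%R, +oo[)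
      (period_poly p k y * lattice_sum k.+1 y))%R.
Proof.
have [C HC] := norm_square_integrand_le.
pose D := `[(1 : R)%R, +oo[%classic.
pose F N y := (period_poly p k y * square_sum k N y)%:E : \bar R.
pose f y := (period_poly p k y * lattice_sum k.+1 y)%:E : \bar R.
have k1 : (1 < k.+1)%N by rewrite ltnS.
have mD : measurable D by exact: measurable_itv.
have iF N : mu.-integrable D (F N).
  by have [] := integral_square_sum R p0 pk N.
have mF N : measurable_fun D (F N) by exact: measurable_int (iF N).
have Ff y : D y -> F ^~ y @ \oo --> f y.
  rewrite /D /= in_itv/= andbT => y1; apply: cvg_EFin.
    by apply: nearW.
  apply: cvgM; first exact: cvg_cst.
  exact: (cvg_square_lattice k1 y1).
have mf : measurable_fun D f by exact: (emeasurable_fun_cvg F f mF Ff).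
have ig : mu.-integrable D (fun y => (C * y ^- 2)%:E).
  have [i1 _] := integral_inv (@fcontinuous_cst R C).
  by apply: eq_integrable i1 => // y _ /=; rewrite mulrC.
have [||i0 _ cF] := @dominated_convergence _ _ R mu D mD F f _ mF mf _ ig.
- exact: aeW.
- apply: aeW => y N; rewrite /D /= in_itv/= andbT => y1.
  by rewrite lee_fin HC.
split; first exact: i0.
have bn0 := beta_half_neq0 R k.
have If : (\int[mu]_(y in D) f y)%E = ((\int[mu]_(y in D)
    (period_poly p k y * lattice_sum k.+1 y))%R)%:E.
  by rewrite /Rintegral fineK//; apply: integrable_fin_num => //; exact: i0.
have IF N : (\int[mu]_(y in D) F N y)%E =
    (beta_half R k * \sum_(m < N) \sum_(n < N) beta_int R p k m n)%:E.
  have [_ <-] := integral_square_sum R p0 pk N.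
  by rewrite /Rintegral fineK//; apply: integrable_fin_num => //; exact: iF.
have cR : (fun N => beta_half R k * \sum_(m < N) \sum_(n < N) beta_int R p k m n)
    @ \oo --> (\int[mu]_(y in D) (period_poly p k y * lattice_sum k.+1 y))%R.
  rewrite If in cF; have H := fine_cvg cF.
  rewrite (_ : (fun N : nat => _) = fine \o (fun N => (\int[mu]_(y in D) F N y)%E)).
    exact: H.
  by apply/funext => N /=; rewrite IF.
rewrite (_ : (fun N : nat => _) = (fun N => (beta_half R k)^-1 * (beta_half R k *
    \sum_(m < N) \sum_(n < N) beta_int R p k m n))); last first.
  by apply/funext => N; rewrite mulKf.
by apply: cvgM => //; exact: cvg_cst.
Qed.

End DominatedLimit.

(** * Lattice sums and Eisenstein series *)

Section Lambert.
Variable R : realType.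

Lemma sum_divisor_sigma s n K : (0 < n)%N -> (n <= K)%N ->
  divisor_sigma s n = \sum_(d < K | (d.+1 %| n)%N) (d.+1 ^ s)%N.
Proof.
move=> n0 nK; rewrite /divisor_sigma.
have P : perm_eq (divisors n) [seq d <- index_iota 1 K.+1 | (d %| n)%N].
  apply: uniq_perm; rewrite ?divisors_uniq ?filter_uniq ?iota_uniq// => d.
  rewrite -dvdn_divisors// mem_filter mem_index_iota ltnS.
  case: (boolP (d %| n)%N) => //= dn; apply/esym.
  by rewrite (dvdn_gt0 n0 dn) (leq_trans (dvdn_leq n0 dn) nK).
by rewrite (perm_big _ P) big_filter big_add1 /= big_mkord.
Qed.

Variable u : nat -> nat -> R.
Hypothesis u0 : forall n d, 0 <= u n d.

(** Both sides run over the pairs with (n + 1) (d + 1) <= K: on the left they are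
grouped by the value of the product, on the right by rows. *)
Lemma hyperbola_sum K :
  \sum_(k < K) \sum_(d < K | (d.+1 %| k.+1)%N) u (k.+1 %/ d.+1)%N.-1 d =
  \sum_(n < K) \sum_(d < K | (n.+1 * d.+1 <= K)%N) u n d.
Proof.
transitivity (\sum_(k < K) \sum_(d < K) \sum_(n < K | (n.+1 * d.+1 == k.+1)%N) u n d).
  apply: eq_bigr => k _; rewrite big_mkcond /=; apply: eq_bigr => d _.
  case: ifPn => [dk|ndk]; last first.
    rewrite big1// => n /eqP E; exfalso; move: ndk; rewrite -E dvdn_mull//.
  have q0 : (0 < (k.+1 %/ d.+1))%N by rewrite divn_gt0// dvdn_leq.
  have qK : ((k.+1 %/ d.+1)%N.-1 < K)%N.
    rewrite -ltnS prednK//; apply: leq_ltn_trans (leq_div _ _) _.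
    by rewrite ltnS.
  rewrite (big_pred1 (Ordinal qK))// => n /=.
  apply/eqP/eqP => [E|->/=]; last by rewrite prednK// divnK.
  by apply: val_inj => /=; rewrite -E mulnK.
rewrite exchange_big /= [RHS](eq_bigr _ (fun n _ => big_mkcond _ _)).
rewrite [RHS]exchange_big /=.
apply: eq_bigr => d _; rewrite (exchange_big_dep xpredT)//=.
apply: eq_bigr => n _; case: ifPn => [ndK|].
  have kK : ((n.+1 * d.+1).-1 < K)%N by rewrite prednK ?muln_gt0.
  by rewrite (big_pred1 (Ordinal kK)).
rewrite -ltnNge => ndK; rewrite big1// => k /eqP E.
by move: ndK; rewrite E ltnS leqNgt ltn_ord.
Qed.

(** Since the terms are nonnegative, the sum under the hyperbola is squeezed between
the iterated sum and its finite rectangles. *)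
Lemma cvg_hyperbola (v : nat -> R) (S : R) :
  (forall n, (fun M => \sum_(d < M) u n d) @ \oo --> v n) ->
  (fun N => \sum_(n < N) v n) @ \oo --> S ->
  (fun K => \sum_(n < K) \sum_(d < K | (n.+1 * d.+1 <= K)%N) u n d) @ \oo --> S.
Proof.
move=> uv vS.
have uM n M : \sum_(d < M) u n d <= v n.
  apply: (cvgr_to_ge (uv n)); near=> M'; have MM : (M <= M')%N by near: M'; exists M.
  rewrite -(big_mkord xpredT (u n)) -[leRHS](big_mkord xpredT (u n)).
  by rewrite (big_cat_nat (leq0n M) MM) /= lerDl sumr_ge0.
have v0 n : 0 <= v n by have := uM n 0%N; rewrite big_ord0.
have vN N : \sum_(n < N) v n <= S.
  apply: (cvgr_to_ge vS); near=> M'; have MM : (N <= M')%N by near: M'; exists N.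
  rewrite -(big_mkord xpredT v) -[leRHS](big_mkord xpredT v).
  by rewrite (big_cat_nat (leq0n N) MM) /= lerDl sumr_ge0.
have hi K : \sum_(n < K) \sum_(d < K | (n.+1 * d.+1 <= K)%N) u n d <= S.
  apply: le_trans (vN K); apply: ler_sum => n _; apply: le_trans (uM n K).
  by rewrite [leRHS](bigID (fun d : 'I_K => (n.+1 * d.+1 <= K)%N)) /= lerDl sumr_ge0.
apply/cvgrPdist_le => e e0.
have [N HN] : exists N, S - e / 2 <= \sum_(n < N) v n.
  have /cvgrPdist_le /(_ (e / 2)) [|N _ HN] := vS; first by rewrite divr_gt0.
  exists N; have := HN N (leqnn N); rewrite ler_distl => /andP[+ _].
  by move=> /= h; rewrite lerBlDr; have := HN N (leqnn N); rewrite /= ler_distlC => /andP[]; rewrite lerBlDr.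
have cM : (fun M => \sum_(n < N) \sum_(d < M) u n d) @ \oo --> \sum_(n < N) v n.
  by apply: cvg_big => [|n _]; [exact: add_continuous|exact: uv].
have [M HM] : exists M, \sum_(n < N) v n - e / 2 <= \sum_(n < N) \sum_(d < M) u n d.
  have /cvgrPdist_le /(_ (e / 2)) [|M _ HM] := cM; first by rewrite divr_gt0.
  by exists M; have := HM M (leqnn M); rewrite /= ler_distlC => /andP[].
near=> K; rewrite ger0_norm ?subr_ge0// lerBlDr.
have KM : (N * M <= K)%N by near: K; exists (N * M)%N.
have KN' : (N <= K)%N by near: K; exists N.
have KM' : (M <= K)%N by near: K; exists M.
have lo : \sum_(n < N) \sum_(d < M) u n d <=
    \sum_(n < K) \sum_(d < K | (n.+1 * d.+1 <= K)%N) u n d.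
  rewrite -(big_mkord xpredT (fun n => \sum_(d < M) u n d)).
  rewrite -[leRHS](big_mkord xpredT (fun n => \sum_(d < K | (n.+1 * d.+1 <= K)%N) u n d)).
  rewrite [leRHS](big_cat_nat (leq0n N) KN') /=.
  rewrite -[leLHS]addr0; apply: lerD; last by rewrite !sumr_ge0// => n _; rewrite sumr_ge0.
  apply: ler_sum_nat => n /andP[_ nN].
  rewrite -(big_mkord xpredT (u n)) -[leRHS](big_mkord (fun d => n.+1 * d.+1 <= K)%N (u n)).
  rewrite [leRHS](big_cat_nat (leq0n M) KM') /= -[leLHS]addr0 lerD ?sumr_ge0//.
  rewrite big_nat_cond [leRHS]big_nat_cond le_eqVlt; apply/orP; left; apply/eqP.
  apply: eq_bigl => d; case: (ltnP d M) => //= dM; rewrite ?andbT ?andbF//.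
  by apply/esym; apply: leq_trans KM; apply: leq_mul.
have : S <= e / 2 + (e / 2 + \sum_(n < N) \sum_(d < M) u n d) by lra.
by lra.
Unshelve. all: by end_near. Qed.

End Lambert.

Section EisensteinReal.
Variable R : realType.
Variable l : nat.
Hypothesis l2 : (1 < l)%N.
Implicit Types y : R.

Lemma limn_real (u : nat -> R) (S : R) : u @ \oo --> S ->
  limn (fun N => (u N)%:C : R[i]^o) = S%:C.
Proof.
move=> uS; apply: (@cvg_lim (R[i]^o)) => //.
apply/cvgrPdist_lt => e e0.
have eE : e = (Re e)%:C.
  by have := ger0_Im (ltW e0); case: (e) => a b /= ->.
have e1 : 0 < Re e by move: e0; rewrite ltcE /= => /andP[].
have /cvgrPdist_lt /(_ _ e1) := uS; apply: filterS => N.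
by rewrite -rcB normc_def /= expr0n addr0 sqrtr_sqr [X in _ -> _ < X]eE ltcR.
Qed.

Let lambert_at y (n : nat) : R := lambert (2 * l - 1) (2 * pi * (n.+1%:R * y)).

Definition lambert_sum y : R := limn (fun N => \sum_(n < N) lambert_at y n).

Let twopi0 : 0 < 2 * pi :> R.
Proof. by rewrite mulr_gt0 ?pi_gt0. Qed.

Lemma twopiX_neq0 : (2 * pi) ^+ (2 * l) != 0 :> R.
Proof. by rewrite expf_neq0// gt_eqF. Qed.

Definition zeta_even : R := - (-1) ^+ l * (2 * pi) ^+ (2 * l) /
  (2 * (2 * l)`!%:R) * ratr (bernoulli_num (2 * l)).

(** The terms c^(-2l) of the rows at c = (n + 1) y add up to zeta(2l) y^(-2l). *)
Lemma lambert_lattice y : 1 <= y ->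
  (fun N => \sum_(n < N) lambert_at y n) @ \oo --> lambert_sum y /\
  lattice_sum l y =
    ((2 * pi) ^+ (2 * l) * lambert_sum y - y ^- (2 * l) * zeta_even) / 2.
Proof.
move=> y1; have y0 := lt_le_trans ltr01 y1.
have cl := cvg_lattice_sum l2 y1.
have cz := @euler_zeta R l (ltnW l2).
have E n : lambert_at y n = ((2 * pi) ^+ (2 * l))^-1 *
    (2 * row_sum l (n.+1%:R * y) + y ^- (2 * l) * n.+1%:R ^- (2 * l)).
  rewrite /row_sum -/(lambert_at y n) (exprMn _ n.+1%:R); have u0 := twopiX_neq0.
  have := expf_neq0 (2 * l) (nat1_neq0 R n); have := expf_neq0 (2 * l) (lt0r_neq0 y0).
  move: u0; move: ((2 * pi) ^+ (2 * l)) (y ^+ (2 * l)) ((n.+1%:R : R) ^+ (2 * l)).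
  by move=> u v w u0 v0 w0; field; rewrite u0 v0 w0.
have c1 : (fun N => \sum_(n < N) lambert_at y n) @ \oo --> ((2 * pi) ^+ (2 * l))^-1 *
    (2 * lattice_sum l y + y ^- (2 * l) * zeta_even).
  rewrite (_ : (fun N : nat => _) = (fun N => ((2 * pi) ^+ (2 * l))^-1 *
    (2 * (\sum_(n < N) row_sum l (n.+1%:R * y)) +
     y ^- (2 * l) * \sum_(n < N) n.+1%:R ^- (2 * l)))); last first.
    apply/funext => N; rewrite !mulr_sumr -big_split mulr_sumr.
    by apply: eq_bigr => n _; rewrite E.
  apply: cvgM; first exact: cvg_cst.
  apply: cvgD; apply: cvgM => //; exact: cvg_cst.
have LE : lambert_sum y = ((2 * pi) ^+ (2 * l))^-1 *
    (2 * lattice_sum l y + y ^- (2 * l) * zeta_even).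
  exact: (cvg_lim (@Rhausdorff R) c1).
split; first by rewrite LE.
rewrite LE; have := twopiX_neq0.
move: ((2 * pi) ^+ (2 * l)) (y ^- (2 * l) * zeta_even) (lattice_sum l y).
by move=> u v w u0; field.
Qed.

Definition eis_real y : R := (2 * l - 1)`!%:R * lambert_sum y.

(** The q-expansion is a Lambert series: with q = exp (- 2 pi y), collecting the
terms d^(2l-1) q^(n d) by the product n d gives the divisor sums. *)
Lemma eisenstein0_real y : 1 <= y ->
  eisenstein0 l ('i%C * y%:C) = (eis_real y)%:C.
Proof.
move=> y1; have y0 := lt_le_trans ltr01 y1.
rewrite /eisenstein0 /eisenstein mulNr addrAC addNr add0r.
have qE : cexp (2 * (pi : R)%:C * 'i%C * ('i%C * y%:C)) = (expR (- (2 * pi * y)))%:C.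
  rewrite (_ : 2 * (pi : R)%:C * 'i%C * ('i%C * y%:C) = (- (2 * pi * y))%:C).
    by rewrite /cexp /= cos0 sin0 mulr1.
  rewrite !rcE; have := @sqr_i R; move: ('i%C) ((pi : R)%:C) => i p ii; ring: ii.
rewrite qE /Cseries; set q := expR _; pose s := (2 * l - 1)%N.
have s0 : (0 < s)%N by rewrite /s; lia.
pose u n d : R := (d.+1%:R ^+ s) * expR (- (2 * pi * (n.+1%:R * y)) * d.+1%:R).
have u0 n d : 0 <= u n d by rewrite mulr_ge0 ?exprn_ge0 ?expR_ge0.
have uv n : (fun M => \sum_(d < M) u n d) @ \oo --> s`!%:R * lambert_at y n.
  have x0 : 0 < 2 * pi * (n.+1%:R * y) by rewrite !mulr_gt0// pi_gt0.
  have := @cvg_lambert R s _ x0; rewrite -cvg_shiftS /= => c.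
  rewrite (_ : (fun M : nat => _) = (fun M => s`!%:R *
      \sum_(r < M.+1) lambert_term s (2 * pi * (n.+1%:R * y)) r)).
    by apply: cvgM => //; exact: cvg_cst.
  apply/funext => M; rewrite big_ord_recl {1}/lambert_term.
  rewrite (_ : (0%:R : R) ^+ s = 0); last by rewrite -(prednK s0) exprS mul0r.
  rewrite !mul0r add0r mulr_sumr; apply: eq_bigr => d _.
  rewrite /lambert_term /u; have := fact_neq0 R s.
  by move: (s`!%:R : R) => f f0; field.
have vS : (fun N => \sum_(n < N) s`!%:R * lambert_at y n) @ \oo --> eis_real y.
  rewrite (_ : (fun N : nat => _) = (fun N => s`!%:R * \sum_(n < N) lambert_at y n)).
    by apply: cvgM; [exact: cvg_cst|have [] := lambert_lattice y1].
  by apply/funext => N; rewrite mulr_sumr.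
have cH := cvg_hyperbola u0 uv vS.
rewrite (_ : (fun N : nat => _) =
    (fun N => (\sum_(1 <= n < N) (divisor_sigma s n)%:R * q ^+ n)%:C : R[i]^o)); last first.
  apply/funext => N; rewrite rmorph_sum /=; apply: eq_bigr => n _.
  by rewrite !rcE.
apply: limn_real.
rewrite -cvg_shiftS /=.
rewrite (_ : (fun N : nat => _) = (fun K => \sum_(n < K) \sum_(d < K | (n.+1 * d.+1 <= K)%N) u n d)) //.
apply/funext => K /=; rewrite -hyperbola_sum big_add1 /= big_mkord.
apply: eq_bigr => k _; rewrite (sum_divisor_sigma s (ltn0Sn k) (ltn_ord k)).
rewrite natr_sum mulr_suml; apply: eq_bigr => d dk.
rewrite natrX /u; congr (_ * _); rewrite prednK; last by rewrite divn_gt0// dvdn_leq.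
rewrite /q -expRM_natl; congr expR.
rewrite -[in LHS](divnK dk) natrM; move: (_ %/ _)%N => a; ring.
Qed.

End EisensteinReal.

(** * Gaussian moments *)

Section GammaIntegral.
Variable R : realType.
Notation mu := (@lebesgue_measure R).
Implicit Types (c y : R).

Definition gauss c y : R := expR (- (c * y ^+ 2)).

Lemma is_derive_gauss c y : is_derive y 1 (gauss c) (- (2 * c * y) * gauss c y).
Proof.
have d : is_derive y 1 (fun y => - (c * y ^+ 2)) (- (c * (2%:R * y ^+ 1))).
  exact: (rderiveN (rderiveZ c (rderiveX 1 y))).
apply: eq_is_derive (rderive_comp (is_derive_expR _) d) _.
by rewrite /gauss expr1; ring.
Qed.

Lemma continuous_gauss c : continuous (gauss c).
Proof. exact: is_derive_continuous (is_derive_gauss c). Qed.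

Lemma cvg_monomial_gauss c n : 0 < c -> y ^+ n * gauss c y @[y --> +oo%R] --> (0 : R).
Proof.
(* From exp u >= u^(n+1) / (n+1)! at u = c y^2. *)
move=> c0; pose C := (n.+1)`!%:R / c ^+ n.+1.
have C0 : 0 < C by rewrite divr_gt0 ?exprn_gt0// ltr0n fact_gt0.
apply/cvgrPdist_le => e e0; near=> y.
have y0 : 0 < y by near: y; exact: nbhs_pinfty_gt.
have y1 : 1 <= y by near: y; exact: nbhs_pinfty_ge.
have ye : C / e <= y by near: y; apply: nbhs_pinfty_ge; exact: num_real.
rewrite sub0r normrN ger0_norm; last by rewrite mulr_ge0 ?expR_ge0// exprn_ge0// ltW.
have u0 : 0 < c * y ^+ 2 by rewrite mulr_gt0 ?exprn_gt0.
have E : (c * y ^+ 2) ^+ n.+1 / (n.+1)`!%:R <= expR (c * y ^+ 2).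
  by apply: le_trans (expR_ge1Dxn n (ltW u0)); rewrite lerDr.
have F0 : (0 : R) < (n.+1)`!%:R by rewrite ltr0n fact_gt0.
have q0 : 0 < (c * y ^+ 2) ^+ n.+1 / (n.+1)`!%:R by rewrite divr_gt0 ?exprn_gt0.
apply: (@le_trans _ _ (y ^+ n * ((c * y ^+ 2) ^+ n.+1 / (n.+1)`!%:R)^-1)).
  rewrite /gauss expRN ler_wpM2l ?exprn_ge0 ?(ltW y0)//.
  by rewrite lef_pV2 ?posrE ?expR_gt0.
have -> : y ^+ n * ((c * y ^+ 2) ^+ n.+1 / (n.+1)`!%:R)^-1 = C / y ^+ n.+2.
  rewrite /C exprMn -exprM (_ : (2 * n.+1 = n + n.+2)%N); last by lia.
  rewrite exprD; have := lt0r_neq0 F0; have := expf_neq0 n.+1 (lt0r_neq0 c0).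
  have := expf_neq0 n (lt0r_neq0 y0); have := expf_neq0 n.+2 (lt0r_neq0 y0).
  move: (y ^+ n) (y ^+ n.+2) (c ^+ n.+1) (n.+1`!%:R : R) => a b d f b0 a0 d0 f0.
  by field; rewrite a0 b0 d0 f0.
rewrite ler_pdivrMr ?exprn_gt0//.
apply: (@le_trans _ _ (e * y)); first by rewrite mulrC -ler_pdivrMr.
by rewrite ler_pM2l// -[leLHS]expr1 ler_weXn2l.
Unshelve. all: by end_near. Qed.

(** Integration by parts lowers the exponent by 2. *)
Lemma gauss_primitive c l : 0 < c -> exists F : R -> R,
  [/\ forall y, is_derive y 1 F (y ^+ (2 * l).+1 * gauss c y),
      F y @[y --> +oo%R] --> (0 : R) &
      F 0 = - (l`!%:R / (2 * c ^+ l.+1))].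
Proof.
move=> c0; have cn0 := lt0r_neq0 c0; elim: l => [|l [F [dF Foo F0]]].
  exists (fun y => - (2 * c)^-1 * gauss c y); split.
  - move=> y; apply: eq_is_derive (rderiveZ _ (is_derive_gauss c y)) _.
    by rewrite muln0 expr1; field.
  - rewrite -[X in _ --> X](mulr0 (- (2 * c)^-1)); apply: cvgM; first exact: cvg_cst.
    have := cvg_monomial_gauss 0 c0; apply: cvg_trans; apply: near_eq_cvg.
    by near=> y; rewrite expr0 mul1r.
  - by rewrite /gauss expr0n mulr0 oppr0 expR0 fact0 expr1; field.
exists (fun y => (l.+1%:R / c) * F y - (2 * c)^-1 * (y ^+ (2 * l).+2 * gauss c y)); split.
- move=> y; apply: eq_is_derive (rderiveD (rderiveZ _ (dF y)) (rderiveN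
    (rderiveZ _ (rderiveM (rderiveX (2 * l).+1 y) (is_derive_gauss c y))))) _.
  rewrite mulnS !exprS; move: (y ^+ (2 * l)) (gauss c y) => u v.
  by field.
- rewrite -[X in _ --> X](_ : l.+1%:R / c * 0 - (2 * c)^-1 * 0 = 0); last by rewrite !mulr0 subr0.
  apply: cvgB; apply: cvgM => //; try exact: cvg_cst.
  exact: cvg_monomial_gauss.
- rewrite F0 (exprS 0) !mul0r mulr0 subr0 factS natrM [c ^+ l.+2]exprS.
  have := expf_neq0 l.+1 cn0; move: (c ^+ l.+1) => u u0.
  by field; rewrite u0 cn0.
Unshelve. all: by end_near. Qed.

Lemma gamma_integral c l : 0 < c ->
  (\int[mu]_(y in `[(0 : R)%R, +oo[) (y ^+ (2 * l).+1 * gauss c y)%:E =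
   (l`!%:R / (2 * c ^+ l.+1))%:E)%E.
Proof.
move=> c0; have [F [dF Foo F0]] := gauss_primitive l c0.
have cf : continuous (fun y => y ^+ (2 * l).+1 * gauss c y).
  by apply: (@fcontinuousM _ (fun y => y ^+ _)); [exact: fcontinuousXn|exact: continuous_gauss].
have cF := is_derive_continuous dF.
rewrite (@ge0_continuous_FTC2y R (fun y => y ^+ (2 * l).+1 * gauss c y) F 0 0).
- by rewrite F0 sub0e -EFinN opprK.
- by move=> y y0; rewrite mulr_ge0 ?exprn_ge0 ?expR_ge0.
- exact: continuous_subspaceT.
- exact: Foo.
- by move=> y _; have [] := dF y.
- exact: (cvg_at_right_filter (cF 0)).
- by move=> y _; rewrite derive1E; have [_ ->] := dF y.
Qed.

(** The substitution x -> y x. *)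
Lemma segint_scale (h : R -> R) y : continuous h -> 0 <= y ->
  segint 0 y h = segint 0 1 (fun x => y * h (y * x)).
Proof.
move=> ch y0; have [H dH] := antiderivative ch.
have lt0 (x : R) : 0 <= x -> -1 < x by exact: lt_le_trans (ltrN10 _).
have L (x : R) : is_derive x 1 (fun x => y * x) y.
  by apply: eq_is_derive (rderiveZ y (rderive_id x)) _; rewrite mulr1.
have c1 : continuous (fun x => y * h (y * x)).
  apply: fcontinuousZ => x; apply: (@continuous_comp _ _ _ (fun x => y * x) h); last exact: ch.
  exact: (@fcontinuousZ _ y id (fun x => @cvg_id _ _)).
rewrite (segint_FTC y0 ch (fun x hx => dH x (lt0 x (proj1 (andP hx))))).
have D (x : R) : 0 <= x <= 1 -> is_derive x 1 (fun x => H (y * x)) (y * h (y * x)).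
  move=> /andP[x0 _]; have := rderive_comp (dH _ (lt0 _ (mulr_ge0 y0 x0))) (L x).
  by move=> d; apply: eq_is_derive d _; rewrite mulrC.
by rewrite (segint_FTC ler01 c1 D) mulr1 mulr0.
Qed.

End GammaIntegral.

(** * A product of two Gaussians over the simplex *)

Section SimplexIntegral.
Variable R : realType.
Notation mu := (@lebesgue_measure R).

Lemma EFin_segint (h : R -> R) a b : continuous h ->
  (\int[mu]_(x in `[a, b]) (h x)%:E = (segint a b h)%:E)%E.
Proof.
move=> ch; rewrite /segint /Rintegral fineK//.
by apply: integrable_fin_num => //; exact: continuous_integrable.
Qed.

Lemma measurable_simplex2 : measurable (@simplex2 R).
Proof.
have -> : @simplex2 R = ((fun t : R * R => 0 < t.1) @^-1` [set true]) `&`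
    ((fun t : R * R => t.1 <= t.2) @^-1` [set true]).
  by apply/seteqP; split => t /= [].
apply: measurableI; rewrite -[X in measurable X]setTI.
  by apply: measurable_fun_ltr => //; exact: measurable_fst.
by apply: measurable_fun_ler.
Qed.

Lemma measurable_fst_comp (h : R -> R) : continuous h ->
  measurable_fun [set: R * R] (fun t => h t.1).
Proof.
move=> ch; apply: (measurableT_comp (f := h)); last exact: measurable_fst.
exact: continuous_measurable_fun.
Qed.

Lemma measurable_snd_comp (h : R -> R) : continuous h ->
  measurable_fun [set: R * R] (fun t => h t.2).
Proof.
move=> ch; apply: (measurableT_comp (f := h)); last exact: measurable_snd.
exact: continuous_measurable_fun.
Qed.

Variables (a b : R) (p q : nat).
Hypothesis a0 : a != 0.

Let h (x : R) := x ^+ (2 * p).+1 * gauss (pi * b ^+ 2) x.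
Let g (y : R) := y ^+ (2 * q).+1 * gauss (pi * a ^+ 2) y.
Let l := (p + q).+1.
Let scaled_gauss (t : R * R) := t.1 ^+ (2 * p).+1 *
  (t.2 ^+ (2 * l).+1 * gauss (pi * (a ^+ 2 + b ^+ 2 * t.1 ^+ 2)) t.2).

Lemma continuous_monomial_gauss n (c : R) :
  continuous (fun x : R => x ^+ n * gauss c x).
Proof. by apply: (@fcontinuousM _ (fun y => y ^+ _)); [exact: fcontinuousXn|exact: continuous_gauss]. Qed.

Let ch : continuous h. Proof. exact: continuous_monomial_gauss. Qed.
Let cg : continuous g. Proof. exact: continuous_monomial_gauss. Qed.

Let h0 x : 0 <= x -> 0 <= h x.
Proof. by move=> x0; rewrite mulr_ge0 ?exprn_ge0 ?expR_ge0. Qed.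

Let g0 x : 0 <= x -> 0 <= g x.
Proof. by move=> x0; rewrite mulr_ge0 ?exprn_ge0 ?expR_ge0. Qed.

Lemma continuous_scaled_gauss1 y : continuous (fun x => scaled_gauss (x, y)).
Proof.
have cc : continuous (fun x : R => - (pi * (a ^+ 2 + b ^+ 2 * x ^+ 2) * y ^+ 2)).
  apply: fcontinuousN; apply: (@fcontinuousM _ _ (fun=> y ^+ 2)); last exact: fcontinuous_cst.
  apply: fcontinuousZ; apply: (@fcontinuousD _ (fun=> a ^+ 2)); first exact: fcontinuous_cst.
  by apply: fcontinuousZ; exact: fcontinuousXn.
apply: (@fcontinuousM _ (fun x => x ^+ _)); first exact: fcontinuousXn.
apply: (@fcontinuousZ _ (y ^+ (2 * l).+1)) => x.
exact: (continuous_comp (cc x) (@continuous_expR R _)).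
Qed.

Lemma scale_gauss y : 0 <= y -> g y * segint 0 y h = segint 0 1 (fun x => scaled_gauss (x, y)).
Proof.
move=> y0; rewrite segint_scale// -segintZ; last first.
  apply: fcontinuousZ => x; apply: (@continuous_comp _ _ _ (fun x => y * x) h); last exact: ch.
  exact: (@fcontinuousZ _ y id (fun x => @cvg_id _ _)).
apply: eq_segint => x _; rewrite /scaled_gauss /g /h /= /gauss /l.
have -> : - (pi * (a ^+ 2 + b ^+ 2 * x ^+ 2) * y ^+ 2) =
   - (pi * a ^+ 2 * y ^+ 2) + - (pi * b ^+ 2 * (y * x) ^+ 2).
  by move: (pi : R) => P; ring.
have -> : ((2 * (p + q).+1).+1 = (2 * q).+1 + (1 + (2 * p).+1))%N by lia.
rewrite expRD exprMn (exprD y (2 * q).+1) (exprD y 1) expr1; ring.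
Qed.

Let T1 := `[(0 : R)%R, 1]%classic.
Let T2 := `[(0 : R)%R, +oo[%classic.

Lemma inner_simplex y : (\int[mu]_x ((fun t : R * R => (h t.1 * g t.2)%:E) \_ (@simplex2 R)) (x, y))%E =
  ((fun y => (g y * segint 0 y h)%:E) \_ T2) y.
Proof.
have [y0|y0] := leP 0 y; last first.
  rewrite patchE memNset; last by rewrite /T2 /= in_itv/= andbT; apply/negP; rewrite -ltNge.
  rewrite integral0_eq// => x _; rewrite patchE memNset// => -[/= x0 xy].
  by have := lt_le_trans x0 (le_trans xy (ltW y0)); rewrite ltxx.
rewrite patchE mem_set; last by rewrite /T2 /= in_itv/= y0.
transitivity (\int[mu]_(x in `]0%R, y]) ((fun x => g y * h x) x)%:E)%E.
  rewrite [RHS]integral_mkcond; apply: eq_integral => x _; rewrite !patchE.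
  case: ifPn => [|].
    by rewrite inE => -[/= x0 xy]; rewrite mem_set; [rewrite mulrC|rewrite /= in_itv/= x0].
  rewrite notin_setE => nD; rewrite memNset//= in_itv/= => /andP[x0 xy].
  by apply: nD.
rewrite integral_itv_obnd_cbnd; last first.
  apply/measurable_EFinP; apply: measurable_funS (continuous_measurable_fun (fcontinuousZ (c := g y) ch)) => //.
rewrite EFin_segint; last exact: fcontinuousZ.
by rewrite segintZ.
Qed.

Lemma measurable_scaled_gauss : measurable_fun [set: R * R] scaled_gauss.
Proof.
apply: measurable_funM; first exact: (measurable_fst_comp (@fcontinuousXn R (2 * p).+1)).
apply: measurable_funM; first exact: (measurable_snd_comp (@fcontinuousXn R (2 * l).+1)).
apply: (measurableT_comp (f := expR)); first exact: measurable_expR.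
apply: measurable_funN => /=; apply: measurable_funM.
  apply: (@measurable_fst_comp (fun x => pi * (a ^+ 2 + b ^+ 2 * x ^+ 2))).
  apply: fcontinuousZ; apply: (@fcontinuousD _ (fun=> a ^+ 2)); first exact: fcontinuous_cst.
  by apply: fcontinuousZ; exact: fcontinuousXn.
exact: (measurable_snd_comp (@fcontinuousXn R 2)).
Qed.

Lemma scaled_gauss_ge0 x y : 0 <= x -> 0 <= y -> 0 <= scaled_gauss (x, y).
Proof.
move=> x0 y0; apply: mulr_ge0; first exact: exprn_ge0.
by apply: mulr_ge0; [exact: exprn_ge0|exact: expR_ge0].
Qed.

(** With t1 = x t2 the product of the Gaussians is exp (- pi (a^2 + b^2 x^2) t2^2);
after an exchange of the two integrations the one over t2 is [gamma_integral]. *)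
Lemma simplex_integral :
  (\int[(mu \x mu)%E]_(t in @simplex2 R) (h t.1 * g t.2)%:E =
   (l`!%:R / (2 * pi ^+ l.+1) *
    segint 0 1 (fun x => x ^+ (2 * p).+1 / (a ^+ 2 + b ^+ 2 * x ^+ 2) ^+ l.+1))%:E)%E.
Proof.
have mD := measurable_simplex2.
have mhg : measurable_fun [set: R * R] (fun t : R * R => (h t.1 * g t.2)%:E).
  by apply/measurable_EFinP; apply: measurable_funM;
    [exact: measurable_fst_comp|exact: measurable_snd_comp].
rewrite integral_mkcond fubini_tonelli2; last 2 first.
- apply/(measurable_restrictT _ mD); exact: measurable_funS mhg.
- move=> [x y]; rewrite patchE; case: ifPn => //; rewrite inE => -[/= x0 xy].
  by rewrite lee_fin mulr_ge0 ?h0 ?g0 ?(ltW x0)// (le_trans (ltW x0)).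
transitivity (\int[mu]_y ((fun y => (g y * segint 0 y h)%:E) \_ T2) y)%E.
  by apply: eq_integral => y _; exact: inner_simplex.
(* The substitution t1 = x t2 has made the domain a product. *)
pose GD := (EFin \o scaled_gauss) \_ (T1 `*` T2).
have mS : measurable (T1 `*` T2) by apply: measurableX; exact: measurable_itv.
have mGD : measurable_fun setT GD.
  apply/(measurable_restrictT _ mS); apply: measurable_funS (_ : measurable_fun setT _) => //.
  by apply/measurable_EFinP; exact: measurable_scaled_gauss.
have GD0 t : (0 <= GD t)%E.
  rewrite /GD patchE; case: ifPn => //; case: t => x y; rewrite inE => -[] /=.
  by rewrite /T1 /T2 /= !in_itv/= andbT => /andP[x0 _] y0; rewrite lee_fin scaled_gauss_ge0.
transitivity (\int[mu]_y \int[mu]_x GD (x, y))%E.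
  apply: eq_integral => y _; rewrite patchE; case: ifPn => [|ny].
    rewrite inE /T2 /= in_itv/= andbT => y0.
    rewrite scale_gauss// -EFin_segint; last exact: continuous_scaled_gauss1.
    rewrite integral_mkcond; apply: eq_integral => x _; rewrite /GD !patchE.
    have -> : ((x, y) \in T1 `*` T2) = (x \in T1).
      apply/idP/idP; rewrite !inE; first by case.
      by move=> xT; split => //=; rewrite /T2 /= in_itv/= y0.
    by [].
  rewrite integral0_eq// => x _; rewrite /GD patchE memNset// => -[_ /= yT].
  by move: ny; rewrite notin_setE; apply.
rewrite -fubini_tonelli//.
transitivity (\int[mu]_(x in `[0%R, 1%R]) ((fun x => l`!%:R / (2 * pi ^+ l.+1) *
    (x ^+ (2 * p).+1 / (a ^+ 2 + b ^+ 2 * x ^+ 2) ^+ l.+1)) x)%:E)%E; last first.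
  by rewrite EFin_segint ?segintZ//; [exact: continuous_poly_div|apply: fcontinuousZ; exact: continuous_poly_div].
rewrite [RHS]integral_mkcond; apply: eq_integral => x _; rewrite [RHS]patchE.
case: ifPn => [|nx]; last first.
  rewrite integral0_eq// => y _; rewrite /GD patchE memNset// => -[/= xT _].
  by move: nx; rewrite notin_setE; apply.
rewrite inE /= => xT.
have c0 : 0 < a ^+ 2 + b ^+ 2 * x ^+ 2.
  by rewrite ltr_pwDl ?sqr_gt0_neq0// mulr_ge0 ?sqr_ge0.
transitivity (\int[mu]_(y in T2) ((x ^+ (2 * p).+1)%:E *
    (y ^+ (2 * l).+1 * gauss (pi * (a ^+ 2 + b ^+ 2 * x ^+ 2)) y)%:E))%E.
  rewrite [RHS]integral_mkcond; apply: eq_integral => y _; rewrite /GD !patchE.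
  have -> : ((x, y) \in T1 `*` T2) = (y \in T2).
    by apply/idP/idP; rewrite !inE; [case|split].
  by case: ifPn => // _; rewrite /scaled_gauss /= EFinM.
have x0 : 0 <= x by move: xT; rewrite /T1 /= in_itv/= => /andP[].
rewrite ge0_integralZl_EFin//; last 3 first.
- by move=> y; rewrite /T2 /= in_itv/= andbT => y0; rewrite lee_fin mulr_ge0 ?exprn_ge0 ?expR_ge0.
- apply/measurable_EFinP; apply: measurable_funS (_ : measurable_fun setT _) => //.
  by apply: continuous_measurable_fun; exact: continuous_monomial_gauss.
- by rewrite exprn_ge0.
rewrite gamma_integral; last by rewrite mulr_gt0 ?pi_gt0.
rewrite -EFinM exprMn; congr _%:E.
have p0 := expf_neq0 l.+1 (lt0r_neq0 (pi_gt0 R)).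
have d0 := expf_neq0 l.+1 (lt0r_neq0 c0).
move: p0 d0; move: ((pi : R) ^+ l.+1) ((a ^+ 2 + b ^+ 2 * x ^+ 2) ^+ l.+1) => u v u0 v0.
by field; rewrite u0 v0.
exact: measurable_itv.
Qed.

End SimplexIntegral.

(** * Real limits as sums in the extended reals, and theta as a series *)

Section RealSeries.
Variable R : realType.

Lemma nneseries_real (u : nat -> R) (s : R) :
  (fun N => \sum_(n < N) u n) @ \oo --> s ->
  (\sum_(n <oo) (u n)%:E = s%:E)%E.
Proof.
move=> us; apply: cvg_lim => //.
rewrite (_ : (fun N : nat => _) = EFin \o (fun N => \sum_(n < N) u n)).
  by apply: cvg_comp us _; exact: cvg_id.
by apply/funext => N /=; rewrite sumEFin big_mkord.
Qed.

(** For nonnegative terms, partial sums over squares and over rectangles have the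
same supremum. *)
Lemma nneseries_square (u : nat -> nat -> R) (s : R) : (forall m n, 0 <= u m n) ->
  (fun N => \sum_(m < N) \sum_(n < N) u m n) @ \oo --> s ->
  (\sum_(m <oo) \sum_(n <oo) (u m n)%:E = s%:E)%E.
Proof.
move=> u0 us; apply/eqP; rewrite eq_le; apply/andP; split.
  apply: lime_le.
    by apply: is_cvg_nneseries => m _ _; apply: nneseries_ge0 => n _ _; rewrite lee_fin.
  apply: nearW => M; rewrite -nneseries_sum//; last by move=> n m _; rewrite lee_fin.
  apply: lime_le.
    by apply: is_cvg_nneseries => m _ _; apply: sume_ge0 => n _; rewrite lee_fin.
  apply: nearW => N.
  under eq_bigr do rewrite sumEFin.
  rewrite sumEFin lee_fin; apply: (cvgr_to_ge us); near=> K.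
  have MK : (M <= K)%N by near: K; exists M.
  have NK : (N <= K)%N by near: K; exists N.
  rewrite exchange_big /= -[leRHS](big_mkord xpredT (fun m => \sum_(n < K) u m n)).
  rewrite [leRHS](big_cat_nat (leq0n M) MK) /= -[leLHS]addr0 lerD//; last first.
    by rewrite sumr_ge0// => m _; rewrite sumr_ge0.
  apply: ler_sum => m _; rewrite -[leRHS](big_mkord xpredT (u m)).
  by rewrite [leRHS](big_cat_nat (leq0n N) NK) /= lerDl sumr_ge0.
set X := (\sum_(m <oo) _)%E.
have sqX N : ((\sum_(m < N) \sum_(n < N) u m n)%:E <= X)%E.
  have inner m : (0 <= \sum_(n <oo) (u m n)%:E)%E.
    by apply: nneseries_ge0 => n _ _; rewrite lee_fin.
  apply: (@le_trans _ _ (\sum_(0 <= m < N) \sum_(n <oo) (u m n)%:E)%E); last first.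
    by apply: nneseries_lim_ge => m _ _; exact: inner.
  rewrite big_mkord -sumEFin; apply: lee_sum => m _; rewrite -sumEFin.
  rewrite -(big_mkord xpredT (fun n => (u m n)%:E)).
  by apply: nneseries_lim_ge => n _ _; rewrite lee_fin.
have X0 : (0 <= X)%E.
  by apply: nneseries_ge0 => m _ _; apply: nneseries_ge0 => n _ _; rewrite lee_fin.
move: X X0 sqX => [x _ sqX|_ _|//]; last by rewrite leey.
by rewrite lee_fin; apply: (cvgr_to_le us); apply: nearW => N; rewrite -lee_fin.
Unshelve. all: by end_near. Qed.

End RealSeries.

Section ThetaSeries.
Variable R : realType.
Implicit Types t : R.

Lemma theta_series t : 0 < t -> exists s : R,
  [/\ (fun M => \sum_(m < M) gauss (pi * m.+1%:R ^+ 2) t) @ \oo --> s,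
      theta t = 1 + 2 * s & theta0 t = 2 * s].
Proof.
move=> t0; pose g m := gauss (pi * m%:R ^+ 2) t.
have pt0 : 0 < pi * t ^+ 2 by rewrite mulr_gt0 ?pi_gt0 ?exprn_gt0.
have [|s cs _] := @inv_sq_series R (fun m => g m.+1) (pi * t ^+ 2)^-1.
  move=> m; rewrite ger0_norm ?expR_ge0// /g /gauss expRN -invfM.
  have m0 : (0 : R) < m.+1%:R by rewrite ltr0n.
  rewrite lef_pV2 ?posrE ?expR_gt0 ?mulr_gt0 ?exprn_gt0 ?pi_gt0//.
  apply: le_trans (expR_ge1Dx _); rewrite mulrAC.
  by rewrite lerDr.
have E : (\esum_(n in [set: int]) (expR (- (pi * n%:~R ^+ 2 * t ^+ 2)))%:E = (1 + 2 * s)%:E)%E.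
  have pos (n : int) : (0 <= (expR (- (pi * n%:~R ^+ 2 * t ^+ 2)))%:E)%E.
    by rewrite lee_fin expR_ge0.
  rewrite (esumID [set n : int | 0 <= n])//.
  rewrite !setTI (reindex_esum [set: nat] _ Posz)//; last first.
    split => //=.
    - by move=> x y _ _ [].
    - by move=> [n|n] //= _; exists n.
  rewrite (reindex_esum [set: nat] _ Negz)//; last first.
    split => //=.
    - by move=> x y _ _ [].
    - by move=> [n|n] //= h; exists n.
  rewrite -!nneseries_esumT//.
  rewrite (@nneseries_real _ (fun m => g m) (1 + s)); last first.
    rewrite -cvg_shiftS /= (_ : (fun N : nat => _) = fun N => 1 + \sum_(m < N) g m.+1).
      by apply: cvgD; [exact: cvg_cst|exact: cs].
    apply/funext => N; rewrite big_ord_recl; congr (_ + _).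
    by rewrite /g /gauss expr0n mulr0 mul0r oppr0 expR0.
  rewrite (eq_eseriesr (g := fun m => (g m.+1)%:E)); last first.
    by move=> m _; rewrite /g /gauss NegzE mulrNz sqrrN.
  by rewrite (nneseries_real cs) -EFinD; congr _%:E; ring.
have tE : theta t = 1 + 2 * s by rewrite /theta E.
by exists s; split => //; rewrite /theta0 tE addrAC subrr add0r.
Qed.

End ThetaSeries.

(** * Termwise integration of the theta functions *)

Section XiIntegrals.
Variable R : realType.
Notation mu := (@lebesgue_measure R).
Notation mu2 := (@lebesgue_measure R \x @lebesgue_measure R)%E.
Variables p q : nat.
Let l := (p + q).+1.

(** The integers m and - m contribute equally to theta. *)
Definition theta_weight (m : nat) : R := if m is 0 then 1 else 2.

Lemma cvg_theta (t : R) : 0 < t ->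
  (fun M => \sum_(m < M) theta_weight m * gauss (pi * m%:R ^+ 2) t) @ \oo --> theta t.
Proof.
move=> t0; have [s [cs -> _]] := theta_series t0.
rewrite -cvg_shiftS /= (_ : (fun N : nat => _) = fun N => 1 +
    2 * \sum_(m < N) gauss (pi * m.+1%:R ^+ 2) t).
  by apply: cvgD; [exact: cvg_cst|apply: cvgM; [exact: cvg_cst|exact: cs]].
apply/funext => N; rewrite big_ord_recl /= mulr_sumr; congr (_ + _).
by rewrite /gauss expr0n mulr0 mul0r oppr0 expR0 mulr1.
Qed.

Lemma cvg_theta0 (t : R) : 0 < t ->
  (fun M => \sum_(m < M) 2 * gauss (pi * m.+1%:R ^+ 2) t) @ \oo --> theta0 t.
Proof.
move=> t0; have [s [cs _ ->]] := theta_series t0.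
rewrite (_ : (fun N : nat => _) = fun N =>
    2 * \sum_(m < N) gauss (pi * m.+1%:R ^+ 2) t).
  by apply: cvgM; [exact: cvg_cst|exact: cs].
by apply/funext => N; rewrite mulr_sumr.
Qed.

(** The integral over the simplex of the Gaussians of frequencies b and n + 1, with
the powers that give the arguments 2 l1 and 2 l2. *)
Definition pair_weight (b : R) (n : nat) : R := l`!%:R / (2 * pi ^+ l.+1) *
  segint 0 1 (fun x => x ^+ (2 * p).+1 / (n.+1%:R ^+ 2 + b ^+ 2 * x ^+ 2) ^+ l.+1).

Let F (c b : R) (n : nat) (t : R * R) : R :=
  c * (t.1 ^+ (2 * p).+1 * gauss (pi * b ^+ 2) t.1) *
  (2 * (t.2 ^+ (2 * q).+1 * gauss (pi * n.+1%:R ^+ 2) t.2)).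

Let F_ge0 c b n t : 0 <= c -> @simplex2 R t -> 0 <= F c b n t.
Proof.
move=> c0 [t1 t12]; have t2 := le_trans (ltW t1) t12.
by rewrite /F !mulr_ge0 ?expR_ge0 ?exprn_ge0 ?(ltW t1).
Qed.

Let measurable_hg b n : measurable_fun [set: R * R] (fun t : R * R =>
  (t.1 ^+ (2 * p).+1 * gauss (pi * b ^+ 2) t.1 *
  (t.2 ^+ (2 * q).+1 * gauss (pi * n.+1%:R ^+ 2) t.2))%:E).
Proof.
apply/measurable_EFinP; apply: measurable_funM.
  exact: measurable_fst_comp (@continuous_monomial_gauss R _ _).
exact: measurable_snd_comp (@continuous_monomial_gauss R _ _).
Qed.

Let FE c b n t : (F c b n t)%:E = ((c * 2)%:E *
  (t.1 ^+ (2 * p).+1 * gauss (pi * b ^+ 2) t.1 *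
  (t.2 ^+ (2 * q).+1 * gauss (pi * n.+1%:R ^+ 2) t.2))%:E)%E.
Proof. by rewrite -EFinM /F; congr _%:E; ring. Qed.

Let mF c b n : measurable_fun (@simplex2 R) (fun t => (F c b n t)%:E).
Proof.
apply: measurable_funS (_ : measurable_fun setT _) => //.
rewrite (_ : (fun t => _) = (fun t : R * R => ((c * 2)%:E *
  (t.1 ^+ (2 * p).+1 * gauss (pi * b ^+ 2) t.1 *
  (t.2 ^+ (2 * q).+1 * gauss (pi * n.+1%:R ^+ 2) t.2))%:E)%E)).
  by apply: measurable_funeM; exact: measurable_hg.
by apply/funext => t; rewrite FE.
Qed.

Let integral_F c b n : 0 <= c ->
  (\int[mu2]_(t in @simplex2 R) (F c b n t)%:E = (c * 2 * pair_weight b n)%:E)%E.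
Proof.
move=> c0; under eq_integral do rewrite FE.
rewrite ge0_integralZl_EFin//; last 4 first.
- exact: measurable_simplex2.
- move=> t [t1 t12]; have t2 := le_trans (ltW t1) t12.
  by rewrite lee_fin !mulr_ge0 ?expR_ge0 ?exprn_ge0 ?(ltW t1).
- exact: measurable_funS (measurable_hg b n).
- by rewrite mulr_ge0.
by rewrite (simplex_integral b p q (nat1_neq0 R n)) -EFinM.
Qed.

(** Everything being nonnegative, the double series can be integrated termwise. *)
Lemma integral_theta_pair :
  (\int[mu2]_(t in @simplex2 R)
     (theta t.1 * t.1 ^+ (2 * p).+1 * (theta0 t.2 * t.2 ^+ (2 * q).+1))%:E =
   \sum_(m <oo) \sum_(n <oo) (theta_weight m * 2 * pair_weight m%:R n)%:E)%E.
Proof.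
have mD := @measurable_simplex2 R.
have w0 m : 0 <= theta_weight m by case: m.
transitivity (\int[mu2]_(t in @simplex2 R)
    \sum_(m <oo) \sum_(n <oo) (F (theta_weight m) m%:R n t)%:E)%E.
  apply: eq_integral => t; rewrite inE => -[t1 t12].
  have t2 := lt_le_trans t1 t12.
  pose A := t.1 ^+ (2 * p).+1; pose B := t.2 ^+ (2 * q).+1.
  transitivity (\sum_(m <oo) (theta_weight m * gauss (pi * m%:R ^+ 2) t.1 * A *
      (theta0 t.2 * B))%:E)%E.
    apply/esym; apply: nneseries_real.
    rewrite (_ : (fun N : nat => _) = fun N => (\sum_(m < N) theta_weight m *
        gauss (pi * m%:R ^+ 2) t.1) * A * (theta0 t.2 * B)).
      by apply: cvgM; [apply: cvgM; [exact: cvg_theta|exact: cvg_cst]|exact: cvg_cst].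
    by apply/funext => N; rewrite !mulr_suml.
  apply: eq_eseriesr => m _; apply/esym; apply: nneseries_real.
  rewrite (_ : (fun N : nat => _) = fun N => theta_weight m *
      gauss (pi * m%:R ^+ 2) t.1 * A * ((\sum_(n < N) 2 *
        gauss (pi * n.+1%:R ^+ 2) t.2) * B)).
    apply: cvgM; first exact: cvg_cst.
    by apply: cvgM; [exact: cvg_theta0|exact: cvg_cst].
  apply/funext => N; rewrite mulr_suml mulr_sumr; apply: eq_bigr => n _.
  by rewrite /F /A /B; ring.
rewrite integral_nneseries//; last 2 first.
- move=> m; apply: ge0_emeasurable_sum => n *; last exact: mF.
  by rewrite lee_fin F_ge0.
- move=> m t Dt; apply: nneseries_ge0 => n _ _; by rewrite lee_fin F_ge0.
apply: eq_eseriesr => m _; rewrite integral_nneseries//; last 2 first.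
- by move=> n; exact: mF.
- by move=> n t Dt; rewrite lee_fin F_ge0.
by apply: eq_eseriesr => n _; rewrite integral_F.
Qed.

Lemma integral_theta0_single :
  (\int[mu2]_(t in @simplex2 R)
     (t.1 ^+ (2 * p).+1 * (theta0 t.2 * t.2 ^+ (2 * q).+1))%:E =
   \sum_(n <oo) (2 * pair_weight 0 n)%:E)%E.
Proof.
have mD := @measurable_simplex2 R.
transitivity (\int[mu2]_(t in @simplex2 R) \sum_(n <oo) (F 1 0 n t)%:E)%E.
  apply: eq_integral => t; rewrite inE => -[t1 t12].
  have t2 := lt_le_trans t1 t12.
  pose A := t.1 ^+ (2 * p).+1; pose B := t.2 ^+ (2 * q).+1.
  apply/esym; apply: nneseries_real.
  rewrite (_ : (fun N : nat => _) = fun N => A * ((\sum_(n < N) 2 *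
        gauss (pi * n.+1%:R ^+ 2) t.2) * B)).
    apply: cvgM; first exact: cvg_cst.
    by apply: cvgM; [exact: cvg_theta0|exact: cvg_cst].
  apply/funext => N; rewrite mulr_suml mulr_sumr; apply: eq_bigr => n _.
  have g1 : gauss (pi * 0 ^+ 2) t.1 = 1 by rewrite /gauss expr0n mulr0 mul0r oppr0 expR0.
  by rewrite /F /A /B g1; ring.
rewrite integral_nneseries//; last 2 first.
- by move=> n; exact: mF.
- by move=> n t Dt; rewrite lee_fin F_ge0.
by apply: eq_eseriesr => n _; rewrite integral_F// mul1r.
Qed.

End XiIntegrals.

(** * The double xi value as a sum of rational integrals *)

Section XiValue.
Variable R : realType.
Notation mu := (@lebesgue_measure R).
Notation mu2 := (@lebesgue_measure R \x @lebesgue_measure R)%E.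
Variables p q : nat.
Let l := (p + q).+1.

Lemma cpow_nat n (t : R) : 0 < t -> cpow t ((2 * n.+1)%:R - 1) = (t ^+ (2 * n).+1)%:C.
Proof.
move=> t0; have -> : (2 * n.+1)%:R - 1 = ((2 * n).+1%:R)%:C :> R[i].
  by rewrite rc_nat mulnS -[in LHS]natr1 addrK.
rewrite /cpow -rcM /cexp /= cos0 sin0 expRM_natl lnK ?posrE//.
by apply: eq_complexP => /=; rewrite ?mulr1 ?mulr0 ?mul0r ?subr0 ?addr0.
Qed.

Lemma Cintegral_real d (T : measurableType d) (nu : {measure set T -> \bar R})
    (D : set T) (f : T -> R[i]) (r : T -> R) (v : R) :
  (forall t, D t -> f t = (r t)%:C) -> (\int[nu]_(t in D) (r t)%:E = v%:E)%E ->
  Cintegral nu D f = v%:C.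
Proof.
move=> fr rv; apply: eq_complexP => /=.
  rewrite (_ : Rintegral _ _ _ = (\int[nu]_(t in D) r t)%R).
    by rewrite /Rintegral rv.
  by apply: eq_Rintegral => t; rewrite inE => /fr ->.
rewrite (_ : Rintegral _ _ _ = (\int[nu]_(t in D) (0 : R))%R).
  by rewrite /Rintegral integral0.
by apply: eq_Rintegral => t; rewrite inE => /fr ->.
Qed.

Let A0 : R := l`!%:R / (2 * pi ^+ l.+1).

Let A0_ge0 : 0 <= A0.
Proof. by rewrite divr_ge0// mulr_ge0// exprn_ge0// pi_ge0. Qed.

Lemma pair_weight0 n : pair_weight p q 0 n =
  A0 * (n.+1%:R ^- (2 * l.+1) / (2 * p.+1%:R)).
Proof.
rewrite /pair_weight; congr (_ * _).
transitivity (segint 0 1 (fun x : R => n.+1%:R ^- (2 * l.+1) * x ^+ (2 * p).+1)).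
  by apply: eq_segint => x _; rewrite expr0n mul0r addr0 -exprM mulrC.
rewrite segintZ; last exact: fcontinuousXn.
congr (_ * _); have D (x : R) : is_derive x 1 (fun x => (2 * p.+1%:R)^-1 * x ^+ (2 * p).+2) (x ^+ (2 * p).+1).
  apply: eq_is_derive (rderiveZ _ (rderiveX (2 * p).+1 x)) _.
  rewrite mulrA (_ : (2 * p).+2%:R = 2 * p.+1%:R :> R) ?mulVf ?mul1r ?mulf_neq0 ?pnatr_eq0//.
  by rewrite -natrM mulnS.
rewrite (segint_FTC ler01 (@fcontinuousXn R _) (fun x _ => D x)).
by rewrite expr1n exprS mul0r mulr0 subr0 mulr1.
Qed.

Lemma pair_weightS m n : pair_weight p q m.+1%:R n = A0 * beta_int R p.+1 l m n.
Proof.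
rewrite /pair_weight /beta_int; congr (_ * segint _ _ _).
by rewrite (_ : (2 * p.+1 - 1 = (2 * p).+1)%N)//; lia.
Qed.

Lemma beta_int_ge0 m n : 0 <= beta_int R p.+1 l m n.
Proof.
apply: Rintegral_ge0 => x /=; rewrite in_itv/= => /andP[x0 _].
by rewrite divr_ge0 ?exprn_ge0// addr_ge0 ?mulr_ge0 ?exprn_ge0.
Qed.

Lemma cvg_pair_weight0 :
  (fun N => \sum_(n < N) 2 * pair_weight p q 0 n) @ \oo -->
  A0 * zeta_even R l.+1 / p.+1%:R.
Proof.
rewrite (_ : (fun N : nat => _) = fun N => (A0 / p.+1%:R) * \sum_(n < N) n.+1%:R ^- (2 * l.+1)).
  rewrite (_ : A0 * zeta_even R l.+1 / p.+1%:R = A0 / p.+1%:R * zeta_even R l.+1).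
    by apply: cvgM; [exact: cvg_cst|exact: euler_zeta].
  by rewrite mulrAC.
apply/funext => N; rewrite mulr_sumr; apply: eq_bigr => n _; rewrite pair_weight0.
have := nat1_neq0 R p; have := expf_neq0 (2 * l.+1) (nat1_neq0 R n).
by move: (_ ^+ (2 * l.+1)) => u u0 p0; field; rewrite u0 nat1r p0.
Qed.

(** The constant term of the first theta function has frequency 0 and yields the zeta
value; all other frequencies come in pairs with a factor 4 altogether. *)
Lemma theta_pair_value T :
  (fun N => \sum_(m < N) \sum_(n < N) beta_int R p.+1 l m n) @ \oo --> T ->
  (\int[mu2]_(t in @simplex2 R)
     (theta t.1 * t.1 ^+ (2 * p).+1 * (theta0 t.2 * t.2 ^+ (2 * q).+1))%:E =
   (A0 * zeta_even R l.+1 / p.+1%:R + 4 * A0 * T)%:E)%E.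
Proof.
move=> cT; rewrite integral_theta_pair.
pose f m := (\sum_(n <oo) (theta_weight R m * 2 * pair_weight p q m%:R n)%:E)%E.
have w0 m : 0 <= theta_weight R m by case: m.
have W0 (m n : nat) : 0 <= pair_weight p q (m%:R : R) n.
  apply: mulr_ge0 => //; apply: Rintegral_ge0 => x /=; rewrite in_itv/= => /andP[x0 _].
  by rewrite divr_ge0 ?exprn_ge0// addr_ge0 ?mulr_ge0 ?exprn_ge0.
have f0 m : (0 <= f m)%E.
  by apply: nneseries_ge0 => n _ _; rewrite lee_fin; apply: mulr_ge0 => //; exact: mulr_ge0.
rewrite (nneseries_recl (f := f))// EFinD; congr (_ + _)%E.
  apply: nneseries_real; rewrite (_ : (fun N : nat => _) =
      fun N => \sum_(n < N) 2 * pair_weight p q 0 n); first exact: cvg_pair_weight0.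
  by apply/funext => N; apply: eq_bigr => n _; rewrite mul1r.
rewrite -(nneseries_addn (f := f) 1)//.
rewrite (eq_eseriesr (g := fun m => \sum_(n <oo) (4 * A0 * beta_int R p.+1 l m n)%:E)%E); last first.
  move=> m _; rewrite addn1 /f; apply: eq_eseriesr => n _; congr _%:E.
  by rewrite pair_weightS /=; ring.
apply: nneseries_square => [m n|].
  apply: mulr_ge0; last exact: beta_int_ge0.
  by apply: mulr_ge0.
rewrite (_ : (fun N : nat => _) = fun N => 4 * A0 *
    \sum_(m < N) \sum_(n < N) beta_int R p.+1 l m n).
  by apply: cvgM => //; exact: cvg_cst.
by apply/funext => N; rewrite mulr_sumr; apply: eq_bigr => m _; rewrite mulr_sumr.
Qed.

End XiValue.

Section DoubleXi.
Variable R : realType.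
Variables p q : nat.
Let l := (p + q).+1.

(** The subtracted integral is the frequency 0 part with the two arguments exchanged,
which accounts for the difference of reciprocals. *)
Theorem double_xi_value (T : R) :
  (fun N => \sum_(m < N) \sum_(n < N) beta_int R p.+1 l m n) @ \oo --> T ->
  double_xi (2 * p.+1)%:R (2 * q.+1)%:R =
  (l`!%:R / (2 * pi ^+ l.+1) *
   (4 * T + zeta_even R l.+1 * (p.+1%:R^-1 - q.+1%:R^-1)))%:C.
Proof.
move=> cT; rewrite /double_xi.
rewrite (Cintegral_real _ (theta_pair_value cT)); last first.
  by move=> t [t1 t12]; rewrite !cpow_nat ?(lt_le_trans t1)// !rcM.
have X2 : (\int[(@lebesgue_measure R \x @lebesgue_measure R)%E]_(t in @simplex2 R)
     (t.1 ^+ (2 * q).+1 * (theta0 t.2 * t.2 ^+ (2 * p).+1))%:E =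
   (l`!%:R / (2 * pi ^+ l.+1) * zeta_even R l.+1 / q.+1%:R)%:E)%E.
  rewrite integral_theta0_single (nneseries_real (@cvg_pair_weight0 R q p)).
  by rewrite [(q + p)%N]addnC.
rewrite (Cintegral_real _ X2); last first.
  by move=> t [t1 t12]; rewrite !cpow_nat ?(lt_le_trans t1)// !rcM.
by rewrite -rcB; congr _%:C; rewrite -/l; ring.
Qed.

End DoubleXi.

(** * The period polynomial on the imaginary axis *)

Section PeriodPolynomial.
Variable F : numFieldType.
Variables p q : nat.
Let l := (p + q).+1.

(** With [odd_coef], the coefficients of [real_period], over a numeric field in order to be
evaluated both in the rationals and in the reals. *)
Definition even_coef j : F :=
  (-1) ^+ l.+1 * (tail_coef F q.+1 l j - (j == 0)%N%:R * tail_coef F p.+1 l 0)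
  - (j == l)%:R * tail_coef F p.+1 l 0.

Definition odd_coef : F := - (-1) ^+ l.+1 * \sum_(j < l.+1) tail_coef F q.+1 l j.

(** Reversing j exchanges the roles of l1 and l2, so that y^(2k) times the tail
polynomial of l1 at 1/y is up to sign the tail polynomial of l2 at y. *)
Lemma tail_coef_rev j : (j <= l)%N -> tail_coef F p.+1 l (l - j) = (-1) ^+ l.+1 * tail_coef F q.+1 l j.
Proof.
move=> jl; rewrite /tail_coef bin_sub//.
have -> : (-1) ^+ (l - j) = (-1) ^+ l * (-1) ^+ j :> F.
  rewrite -{2}(subnK jl) exprD -mulrA -expr2 sqrr_sign mulr1//.
have -> : (2 * p.+1 - 1)%:R - (2 * (l - j))%:R = - ((2 * q.+1 - 1)%:R - (2 * j)%:R) :> F.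
  apply/eqP; rewrite opprB subr_eq addrAC eq_sym subr_eq -!natrD eqr_nat /l; lia.
by rewrite invrN exprS; ring.
Qed.

End PeriodPolynomial.

Section RealPeriod.
Variable R : realType.
Variables p q : nat.
Let l := (p + q).+1.

Definition real_period (y : R) : R :=
  \sum_(j < l.+1) even_coef R p q j * y ^+ (2 * j) + odd_coef R p q * y ^+ (2 * q.+1 - 1).

(** The polynomial of l2 in y has the same shape as that of l1 in 1/y. *)
Lemma real_periodE y : real_period y = (-1) ^+ l.+1 *
  (tail_poly q.+1 l y - tail_coef R p.+1 l 0 * coboundary l y).
Proof.
rewrite /real_period /even_coef /odd_coef -/l.
under eq_bigr do rewrite mulrBl mulrBr mulrBl.
rewrite sumrB sumrB /tail_poly.
have -> : \sum_(j < l.+1) tail_coef R q.+1 l j * (y ^+ (2 * j) - y ^+ (2 * q.+1 - 1)) =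
    \sum_(j < l.+1) tail_coef R q.+1 l j * y ^+ (2 * j) -
    (\sum_(j < l.+1) tail_coef R q.+1 l j) * y ^+ (2 * q.+1 - 1).
  by rewrite mulr_suml -sumrB; apply: eq_bigr => j _; rewrite mulrBr.
have -> : \sum_(j < l.+1) (-1) ^+ l.+1 * tail_coef R q.+1 l j * y ^+ (2 * j) =
    (-1) ^+ l.+1 * \sum_(j < l.+1) tail_coef R q.+1 l j * y ^+ (2 * j).
  by rewrite mulr_sumr; apply: eq_bigr => j _; rewrite -mulrA.
have -> : \sum_(i < l.+1) (-1) ^+ l.+1 * ((i == 0 :> nat)%N%:R * tail_coef R p.+1 l 0) *
    y ^+ (2 * i) = (-1) ^+ l.+1 * tail_coef R p.+1 l 0.
  rewrite big_ord_recl /= muln0 expr0 mul1r mulr1 big1 ?addr0// => j _.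
  by rewrite !mul0r mulr0 mul0r.
have -> : \sum_(i < l.+1) (i == l :> nat)%:R * tail_coef R p.+1 l 0 * y ^+ (2 * i) =
    tail_coef R p.+1 l 0 * y ^+ (2 * l).
  rewrite big_ord_recr /= eqxx mul1r big1 ?add0r// => j _.
  by rewrite ltn_eqF ?ltn_ord// !mul0r.
rewrite /coboundary; have : (-1) ^+ l.+1 * (-1) ^+ l.+1 = 1 :> R by rewrite -expr2 sqrr_sign.
move: ((-1) ^+ l.+1) => e ee; ring: ee.
Qed.

Lemma period_polyE y : y != 0 -> period_poly p.+1 l y = real_period y.
Proof.
move=> y0; rewrite real_periodE /period_poly /reduced_tail !mulrBr; congr (_ - _).
  rewrite /tail_poly !mulr_sumr (reindex_inj rev_ord_inj); apply: eq_bigr => j _ /=.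
  have jl : (j <= l)%N by rewrite -ltnS.
  rewrite subSS (tail_coef_rev R jl).
  have D m n : y ^+ (m + n) * y^-1 ^+ n = y ^+ m by rewrite exprD exprVn mulfK ?expf_neq0.
  have E1 : y ^+ (2 * l) * y^-1 ^+ (2 * (l - j)) = y ^+ (2 * j).
    by rewrite -[RHS](D _ (2 * (l - j))%N) -mulnDr subnKC.
  have E2 : y ^+ (2 * l) * y^-1 ^+ (2 * p.+1 - 1) = y ^+ (2 * q.+1 - 1).
    by rewrite -[RHS](D _ (2 * p.+1 - 1)%N); congr (y ^+ _ * _); rewrite /l; lia.
  by rewrite -E1 -E2; ring.
rewrite /coboundary exprVn; have := expf_neq0 (2 * l) y0.
have : (-1) ^+ l.+1 * (-1) ^+ l.+1 = 1 :> R by rewrite -expr2 sqrr_sign.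
by move: ((-1) ^+ l.+1) (y ^+ (2 * l)) => e u ee u0; field: ee.
Qed.

Lemma continuous_real_period : continuous real_period.
Proof.
apply: fcontinuousD; last by apply: fcontinuousZ; exact: fcontinuousXn.
by apply: continuous_sum => j; apply: fcontinuousZ; exact: fcontinuousXn.
Qed.

(** The case a = 1, b = 0 of [kernel_identity]. *)
Lemma segint_tail_poly P k : (0 < P)%N -> (P <= k)%N ->
  segint 0 1 (@tail_poly R P k) = beta_half R k / (2 * P%:R).
Proof.
move=> P0 Pk; have := kernel_identity 0 (oner_neq0 R) P0 Pk.
rewrite (@eq_segint _ _ (@tail_poly R P k)); last first.
  move=> x _; rewrite (_ : lin 1 0 x = 1) ?expr1n ?invr1 ?mulr1//.
  by apply: eq_complexP; rewrite ?Re_lin ?Im_lin ?mul0r.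
move=> ->; congr (_ * _); have [n nE] : exists n, (2 * P - 1 = n.+1)%N.
  by exists (2 * P - 2)%N; lia.
transitivity (segint 0 1 (fun x : R => x ^+ n.+1)).
  by apply: eq_segint => x _; rewrite expr0n mul0r addr0 !expr1n divr1 nE.
have PE : n.+2%:R = 2 * P%:R :> R by rewrite -natrM; congr _%:R; lia.
have D (x : R) : is_derive x 1 (fun x => n.+2%:R^-1 * x ^+ n.+2) (x ^+ n.+1).
  apply: eq_is_derive (rderiveZ _ (rderiveX n.+1 x)) _.
  by rewrite mulKf// pnatr_eq0.
rewrite (segint_FTC ler01 (@fcontinuousXn R _) (fun x _ => D x)).
by rewrite expr1n exprS mul0r mulr0 subr0 mulr1 PE.
Qed.

Notation mu := (@lebesgue_measure R).
Let L := l.+1.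

Let L2 : (1 < L)%N. Proof. by []. Qed.

Lemma segint_reduced_tail : segint 0 1 (@reduced_tail R p.+1 l) =
  beta_half R l / (2 * p.+1%:R) - tail_coef R p.+1 l 0 * segint 0 1 (@coboundary R l).
Proof.
rewrite -(@segint_tail_poly p.+1 l)//; last by rewrite /l; lia.
rewrite -segintZ; last exact: continuous_coboundary.
rewrite -segintN; last by apply: fcontinuousZ; exact: continuous_coboundary.
rewrite -segintD//; first exact: continuous_tail_poly.
by apply: fcontinuousN; apply: fcontinuousZ; exact: continuous_coboundary.
Qed.

Lemma segint_real_period : segint 0 1 real_period = (-1) ^+ L *
  (beta_half R l / (2 * q.+1%:R) - tail_coef R p.+1 l 0 * segint 0 1 (@coboundary R l)).
Proof.
have cc : continuous (fun x : R => - (tail_coef R p.+1 l 0 * coboundary l x)).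
  by apply: fcontinuousN; apply: fcontinuousZ; exact: continuous_coboundary.
have ct := @continuous_tail_poly R q.+1 l.
rewrite -(@segint_tail_poly q.+1 l)//; last by rewrite /l; lia.
rewrite -segintZ; last exact: continuous_coboundary.
rewrite -segintN; last by apply: fcontinuousZ; exact: continuous_coboundary.
rewrite -segintD// -segintZ; last exact: fcontinuousD.
by apply: eq_segint => y _; rewrite real_periodE.
Qed.

(** The zeta term of [lambert_lattice], multiplied by the polynomial, is an integral
of the form treated in [integral_inv]. *)
Lemma period_eisenstein_integral :
  mu.-integrable `[(1 : R)%R, +oo[ (EFin \o (fun y => real_period y * eis_real L y)) /\
  2 * (\int[mu]_(y in `[(1 : R)%R, +oo[) (period_poly p.+1 l y * lattice_sum L y))%R =
  (2 * pi) ^+ (2 * L) / (2 * L - 1)`!%:R *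
    (\int[mu]_(y in `[(1 : R)%R, +oo[) (real_period y * eis_real L y))%R
  - zeta_even R L * segint 0 1 (@reduced_tail R p.+1 l).
Proof.
have pl : (p.+1 <= l)%N by rewrite /l; lia.
have [i1 _] := square_sums_limit R (ltn0Sn p) pl.
have [i2 e2] := integral_inv (@continuous_reduced_tail R p.+1 l).
set c := (2 * L - 1)`!%:R / (2 * pi) ^+ (2 * L) : R.
have F0 := fact_neq0 R (2 * L - 1); have P0 := twopiX_neq0 R L.
pose f1 y : R := period_poly p.+1 l y * lattice_sum L y.
pose f2 y : R := y ^- 2 * reduced_tail p.+1 l y^-1.
(* The Lambert series expressed through the lattice sum and y^(-2 L), the integrals
of which are known. *)
pose f3 y : R := c * (2 * f1 y + zeta_even R L * f2 y).
have E y : y \in `[(1 : R)%R, +oo[%classic -> f3 y = real_period y * eis_real L y.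
  rewrite inE/= in_itv/= andbT => y1; have y0 := lt_le_trans ltr01 y1.
  have [_ lE] := lambert_lattice L2 y1.
  rewrite /f3 /f1 /f2 lE -period_polyE ?gt_eqF// /eis_real /period_poly /c.
  have -> : y ^- 2 = y ^+ (2 * l) * y ^- (2 * L).
    rewrite /L mulnS (exprD y 2); have := expf_neq0 (2 * l) (lt0r_neq0 y0).
    have := expf_neq0 2 (lt0r_neq0 y0).
    by move: (y ^+ (2 * l)) (y ^+ 2) => u v v0 u0; field; rewrite u0 v0.
  move: P0; move: ((2 * pi) ^+ (2 * L)) (y ^- (2 * L)) (lambert_sum _ _) => u v w u0.
  by field; rewrite u0.
have iZ (k : R) f : mu.-integrable `[(1 : R)%R, +oo[ (EFin \o f) ->
    mu.-integrable `[(1 : R)%R, +oo[ (EFin \o (fun y => k * f y)).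
  by move=> fi; apply: (@integrableZl _ _ _ mu) fi => //; exact: measurable_itv.
have i1' : mu.-integrable `[(1 : R)%R, +oo[ (EFin \o (fun y => 2 * f1 y)).
  exact: iZ.
have i2' : mu.-integrable `[(1 : R)%R, +oo[ (EFin \o (fun y => zeta_even R L * f2 y)).
  exact: iZ.
have i12 : mu.-integrable `[(1 : R)%R, +oo[ (EFin \o (fun y => 2 * f1 y + zeta_even R L * f2 y)).
  by apply: (@integrableD _ _ _ mu) i1' i2'; exact: measurable_itv.
have i3 : mu.-integrable `[(1 : R)%R, +oo[ (EFin \o f3).
  exact: iZ.
split.
  by apply: eq_integrable i3 => // y yD /=; rewrite E.
have -> : (\int[mu]_(y in `[(1 : R)%R, +oo[) (real_period y * eis_real L y))%R =
    c * (2 * (\int[mu]_(y in `[(1 : R)%R, +oo[) f1 y)%R +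
    zeta_even R L * segint 0 1 (@reduced_tail R p.+1 l)).
  rewrite -e2 -!RintegralZl// -RintegralD// -RintegralZl//.
  by apply: eq_Rintegral => y yD; rewrite -E.
rewrite -/f1 /c; move: (segint _ _ _) ((2 * pi) ^+ (2 * L)) P0 => s u u0.
by field; rewrite u0 F0.
Qed.

(** The zeta value in terms of the constant term of the Eisenstein series. *)
Lemma zeta_evenE : - zeta_even R L * (-1) ^+ L =
  (2 * pi) ^+ (2 * L) / (2 * L - 1)`!%:R * (ratr (bernoulli_num (2 * L)) / (4 * L)%:R).
Proof.
rewrite /zeta_even; have F0 := fact_neq0 R (2 * L - 1).
have eL : (2 * L = (2 * L - 1).+1)%N by rewrite /L; lia.
have -> : (2 * L)`!%:R = 2 * L%:R * (2 * L - 1)`!%:R :> R.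
  by rewrite {1}eL factS -eL (natrM _ (2 * L)) (natrM _ 2).
have -> : (4 * L)%:R = 4 * L%:R :> R by rewrite natrM.
have : (-1) ^+ L * (-1) ^+ L = 1 :> R by rewrite -expr2 sqrr_sign.
have : L%:R != 0 :> R by rewrite pnatr_eq0.
move: F0; move: ((-1) ^+ L) ((2 * pi) ^+ (2 * L)) (ratr _) ((2 * L - 1)`!%:R : R) (L%:R : R).
move=> e u b f r f0 r0 ee; by field: ee; rewrite f0 r0.
Qed.

(** The integrals of the coboundary over [0, 1] in [segint_reduced_tail] and
[segint_real_period] agree and cancel; what is left of the two integrals is the
difference of reciprocals in [double_xi_value]. *)
Theorem xi_eichler_real :
  double_xi (2 * p.+1)%:R (2 * q.+1)%:R = (l`!%:R * (2 * pi) ^+ (2 * L) /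
    (pi ^+ L * (beta_half R l * (2 * L - 1)`!%:R)) *
   ((\int[mu]_(y in `[(1 : R)%R, +oo[) (real_period y * eis_real L y))%R +
    ratr (bernoulli_num (2 * L)) / (4 * L)%:R * segint 0 1 real_period))%:C.
Proof.
have pl : (p.+1 <= l)%N by rewrite /l; lia.
have [_ cT] := square_sums_limit R (ltn0Sn p) pl.
have [_ E] := period_eisenstein_integral.
rewrite (double_xi_value cT); congr _%:C; rewrite -/l -/L.
have Z := zeta_evenE; move: Z E; rewrite segint_reduced_tail segint_real_period.
set I := Rintegral _ _ _; set J := Rintegral _ _ _; set B := ratr _ / _.
set s := segint _ _ _; set a := tail_coef _ _ _ _.
have b0 := beta_half_neq0 R l; have F0 := fact_neq0 R (2 * L - 1).
have P0 : pi ^+ L != 0 :> R by rewrite expf_neq0// gt_eqF ?pi_gt0.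
have p0 := nat1_neq0 R p; have q0 := nat1_neq0 R q.
have ee : (-1) ^+ L * (-1) ^+ L = 1 :> R by rewrite -expr2 sqrr_sign.
(* K is the ratio between the lattice sums and the Eisenstein series. *)
move=> Z E; set K := _ / _`!%:R in Z E.
have {}Z : K * (B * (-1) ^+ L) = - zeta_even R L by rewrite mulrA -Z -mulrA ee mulr1.
have {}E : K * J = 2 * I + zeta_even R L * (beta_half R l / (2 * p.+1%:R) - a * s).
  by rewrite E subrK.
have -> : l`!%:R * (2 * pi) ^+ (2 * L) / (pi ^+ L * (beta_half R l * (2 * L - 1)`!%:R)) =
    l`!%:R / (pi ^+ L * beta_half R l) * K.
  rewrite /K; move: b0 F0 P0; move: ((2 * pi) ^+ (2 * L)) (pi ^+ L : R) (beta_half R l) => u v b.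
  by move: ((2 * L - 1)`!%:R : R) => f b0 f0 v0; field; rewrite b0 f0 v0.
rewrite -[RHS]mulrA [K * _]mulrDr E (mulrA B) (mulrA K) Z.
move: b0 P0 p0 q0; move: (pi ^+ L : R) (beta_half R l) (zeta_even R L) => v b z b0 v0.
move: (p.+1%:R : R) (q.+1%:R : R) => x y x0 y0.
by field; rewrite b0 v0 x0 y0.
Qed.

End RealPeriod.

(** * Rationality and the theorem *)

Section Rationality.
Variable R : realType.
Variables p q : nat.
Let l := (p + q).+1.
Let L := l.+1.
Notation mu := (@lebesgue_measure R).

Lemma ratr_tail_coef P k j : ratr (tail_coef rat P k j) = tail_coef R P k j.
Proof.
by rewrite /tail_coef fmorph_div rmorphM rmorphB rmorph_sign !rmorph_nat.
Qed.

Lemma ratr_beta_half k : ratr (beta_half rat k) = beta_half R k.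
Proof.
rewrite /beta_half rmorph_sum; apply: eq_bigr => j _.
by rewrite fmorph_div rmorphM rmorph_sign !rmorph_nat.
Qed.

Lemma ratr_even_coef j : ratr (even_coef rat p q j) = even_coef R p q j.
Proof.
rewrite /even_coef -!ratr_tail_coef; rewrite -[(-1) ^+ _ in RHS](rmorph_sign ratr).
move: (tail_coef rat _ _ _) (tail_coef rat _ _ _) ((-1) ^+ _ : rat) => u v e.
by rewrite rmorphB !rmorphM rmorphB rmorphM !rmorph_nat.
Qed.

Lemma ratr_odd_coef : ratr (odd_coef rat p q) = odd_coef R p q.
Proof.
rewrite /odd_coef rmorphM rmorphN rmorph_sign rmorph_sum; congr (_ * _).
by apply: eq_bigr => j _; exact: ratr_tail_coef.
Qed.

Lemma ratr_complex (x : rat) : ratr x = (ratr x : R)%:C :> R[i].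
Proof. by rewrite (fmorph_rat (real_complex R)). Qed.

(** The powers of pi in the denominators have cancelled: this is a rational number. *)
Definition period_scale (F : numFieldType) : F :=
  l`!%:R * 4 ^+ L / (beta_half F l * (2 * L - 1)`!%:R).

Lemma ratr_period_scale : ratr (period_scale rat) = period_scale R.
Proof.
rewrite /period_scale; have -> : (4 : rat) ^+ L = (4 ^ L)%:R by rewrite natrX.
have -> : (4 : R) ^+ L = (4 ^ L)%:R by rewrite natrX.
rewrite -ratr_beta_half; move: (beta_half rat l) => b.
rewrite fmorph_div (rmorphM ratr l`!%:R) (rmorphM ratr b).
by rewrite !rmorph_nat.
Qed.

(** The signs in [eichler_odd] and [eichler_even] undo the powers of i that
tau = i y produces. *)
Definition eichler_odd : rat := period_scale rat * (-1) ^+ q.+1 * odd_coef rat p q.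
Definition eichler_even k : rat := period_scale rat * (-1) ^+ k * even_coef rat p q k.

Definition eichler_poly : {poly R[i]} :=
  (ratr eichler_odd * 'i%C) *: 'X^(2 * q.+1 - 1)
  + \sum_(k < L) ratr (eichler_even k) *: 'X^(2 * k).

Lemma ratr_eichler_odd : ratr eichler_odd = period_scale R * (-1) ^+ q.+1 * odd_coef R p q.
Proof.
rewrite -ratr_odd_coef -ratr_period_scale -[(-1) ^+ _ in RHS](rmorph_sign ratr) /eichler_odd.
by move: (odd_coef _ _ _) (period_scale _) ((-1) ^+ _ : rat) => u v e; rewrite !rmorphM.
Qed.

Lemma ratr_eichler_even k :
  ratr (eichler_even k) = period_scale R * (-1) ^+ k * even_coef R p q k.
Proof.
rewrite -ratr_even_coef -ratr_period_scale -[(-1) ^+ _ in RHS](rmorph_sign ratr) /eichler_even.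
by move: (even_coef _ _ _ _) (period_scale _) ((-1) ^+ _ : rat) => u v e; rewrite !rmorphM.
Qed.

Lemma exprCi_even k : 'i%C ^+ (2 * k) = (-1) ^+ k :> R[i].
Proof. by rewrite exprM sqr_i. Qed.

Lemma eichler_polyE (y : R) :
  eichler_poly.['i%C * y%:C] = (period_scale R * real_period p q y)%:C.
Proof.
rewrite /eichler_poly hornerD hornerZ hornerXn horner_sum /real_period mulrDr rcD [RHS]addrC; congr (_ + _).
  have ii : 'i%C * 'i%C ^+ (2 * q.+1 - 1) = ((-1) ^+ q.+1)%:C :> R[i].
    rewrite -exprS (_ : (2 * q.+1 - 1).+1 = 2 * q.+1)%N; last by lia.
    by rewrite exprCi_even rcX rcN.
  rewrite exprMn (mulrA (_ * 'i%C)) -(mulrA _ 'i%C) ii ratr_complex ratr_eichler_odd.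
  rewrite -rcX -!rcM; congr _%:C.
  move: (odd_coef _ _ _) (period_scale _) (y ^+ _) => u v w.
  have : (-1) ^+ q.+1 * (-1) ^+ q.+1 = 1 :> R by rewrite -expr2 sqrr_sign.
  by move: ((-1) ^+ q.+1) => e ee; ring: ee.
rewrite mulr_sumr (rmorph_sum (real_complex R)); apply: eq_bigr => k _ /=.
rewrite hornerZ hornerXn exprMn exprCi_even ratr_complex ratr_eichler_even.
have -> : (-1) ^+ k = ((-1) ^+ k)%:C :> R[i] by rewrite rcX rcN.
rewrite -rcX -!rcM; congr _%:C.
move: (even_coef _ _ _ _) (period_scale _) (y ^+ _) => u v w.
have : (-1) ^+ k * (-1) ^+ k = 1 :> R by rewrite -expr2 sqrr_sign.
by move: ((-1) ^+ k) => e ee; ring: ee.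
Qed.

Lemma Cintegral_integrable (D : set R) (f : R -> R[i]) (r : R -> R) :
  (forall t, D t -> f t = (r t)%:C) -> measurable D -> mu.-integrable D (EFin \o r) ->
  Cintegral mu D f = (\int[mu]_(t in D) r t)%R%:C.
Proof.
move=> fr mD ir; have := Cintegral_real (nu := mu) fr; apply.
by rewrite /Rintegral fineK// integrable_fin_num.
Qed.

Lemma reg_eichler_real : reg_eichler L eichler_poly = 'i%C * (period_scale R *
   ((\int[mu]_(y in `[(1 : R)%R, +oo[) (real_period p q y * eis_real L y))%R +
    ratr (bernoulli_num (2 * L)) / (4 * L)%:R * segint 0 1 (@real_period R p q)))%:C.
Proof.
have [ir _] := period_eisenstein_integral R p q.
rewrite /reg_eichler; congr (_ * _).
have cr := @continuous_real_period R p q.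
rewrite (@Cintegral_integrable _ _
   (fun y => period_scale R * (real_period p q y * eis_real L y))); first last.
- by apply: (@integrableZl _ _ _ mu) ir => //; exact: measurable_itv.
- exact: measurable_itv.
- move=> y; rewrite /= in_itv/= andbT => y1.
  by rewrite eichler_polyE eisenstein0_real// -rcM -mulrA.
rewrite (@Cintegral_integrable _ _ (fun y => period_scale R * real_period p q y)); first last.
- by apply: continuous_integrable; exact: fcontinuousZ.
- exact: measurable_itv.
- by move=> y _; rewrite eichler_polyE.
rewrite RintegralZl// -/(segint 0 1 _) segintZ// ratr_complex -rc_nat -rcV -!rcM -rcD.
by rewrite mulrDr (mulrCA (period_scale R) (ratr _ / _)).
Qed.

Lemma xi_eichler : (pi : R)%:C ^- L * double_xi (2 * p.+1)%:R (2 * q.+1)%:R =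
  'i%C^-1 * reg_eichler L eichler_poly.
Proof.
have i0 : 'i%C != 0 :> R[i] by rewrite eq_complex /= eqxx oner_eq0.
rewrite reg_eichler_real mulKf// xi_eichler_real -rcX -rcV -rcM mulrA; congr (_ * _)%:C.
have -> : (2 * pi) ^+ (2 * (p + q).+2) = 4 ^+ L * (pi ^+ L) ^+ 2 :> R.
  by rewrite (exprM (2 * pi) 2) (exprMn 2 2 pi) (exprMn L) (exprAC pi) -natrX.
have := beta_half_neq0 R l; have := fact_neq0 R (2 * L - 1).
have : pi ^+ L != 0 :> R by rewrite expf_neq0// gt_eqF ?pi_gt0.
rewrite /period_scale -/l -/L; move: (pi ^+ L : R) (beta_half R l) (4 ^+ L : R) => v b u.
move: ((2 * L - 1)`!%:R : R) (l`!%:R : R) => f g v0 f0 b0.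
by field; rewrite b0 f0 v0.
Qed.
End Rationality.

Theorem theorem9p7 (R : realType) (l1 l2 : nat)
    (hl1 : (1 <= l1)%N) (hl2 : (1 <= l2)%N) :
  let l := (l1 + l2)%N in
  exists P : {poly R[i]},
    (exists (c : rat) (a : 'I_l -> rat),
       P = (ratr c * 'i%C) *: 'X^(2 * l2 - 1)
           + \sum_(k < l) ratr (a k) *: 'X^(2 * k)) /\
    ((pi : R)%:C) ^- (l1 + l2) * double_xi (2 * l1)%:R (2 * l2)%:R
      = 'i%C^-1 * reg_eichler l P.
Proof.
case: l1 l2 hl1 hl2 => [|p] [|q]// _ _ /=.
have lE : (p.+1 + q.+1 = (p + q).+2)%N by rewrite addSn addnS.
exists (eichler_poly R p q); split; last by rewrite lE; exact: xi_eichler.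
by rewrite lE; exists (eichler_odd p q), (eichler_even p q).
Qed.
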